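(* Let $k$ be a field of characteristic $0$, let $C$ be a coaugmented conilpotent coassociative DG $k$-coalgebra equipped with a cyclic pairing of degree $m$, and let $A$ be an augmented associative DG $k$-algebra that is Koszul dual to $C$. Then for each $n$ there is a commutative diagram of $\overline{\mathrm{HC}}_\bullet(A)$-module homomorphisms $$\begin{array}{ccc} \overline{\mathrm{HC}}_\bullet(A)&\xrightarrow{\ B\ }&\overline{\mathrm{HH}}_{\bullet+1}(A)\\[2pt] {\scriptstyle\mathrm{Tr}_n}\big\downarrow&&\big\downarrow{\scriptstyle\mathrm{Tr}_n}\\[2pt] \mathrm{HR}_\bullet(A,n)&\xrightarrow{\ d\ }&\mathrm H_\bullet[\Omega^1(\mathrm{DRep}_n(A))] \end{array}$$ where $B$ is the Connes differential and $d$ is induced by the universal derivation.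
   Context: Conventions. All complexes are over $k$ and homologically graded, $\otimes=\otimes_k$, $W[-1]_i=W_{i+1}$, unspecified signs $\pm$ are given by the Koszul sign rule. All Lie brackets and Lie actions are of homological degree $m+2$. Cyclic coalgebra. Write $\bar C$ for the coaugmentation coideal of $C$ with reduced coproduct $v\mapsto v'\otimes v''$. A cyclic pairing of degree $m$ on $C$ is a symmetric bilinear pairing $\langle -,-\rangle:\bar C\times\bar C\to k$ of degree $m$ with $\langle v',w\rangle v''=\pm\langle v,w''\rangle w'$ and $\langle du,v\rangle\pm\langle u,dv\rangle=0$. Put $V=\bar C[-1]$ with the induced skew-symmetric pairing of degree $m+2$. $R=\boldsymbol{\Omega}(C)$ is the cobar construction, $R\cong T_kV$ as a graded algebra; $A$ is Koszul dual to $C$ means there is a quasi-isomorphism $R\to A$ of augmented DG algebras (a cofibrant resolution). $\bar R$ is the augmentation ideal. Brackets. For $v_i,w_j\in V$ put $$\{\!\{v_1\cdots v_r,\,w_1\cdots w_s\}\!\}=\sum_{i,j}\pm\langle v_i,w_j\rangle\,(w_1\cdots w_{j-1}v_{i+1}\cdots v_r)\otimes(v_1\cdots v_{i-1}w_{j+1}\cdots w_s),$$ zero if one entry is $1$, and $\{-,-\}=\mu\circ\{\!\{-,-\}\!\}:R\otimes R\to R$, $\mu$ the product. With $R_\natural=R/(k+[R,R])$ this induces a DG Lie bracket on $R_\natural$ and an action of $R_\natural$ on $R$ by derivations (preserving $\bar R$). $R_\natural$ also acts on $R\otimes R$ by $\{r,a\otimes b\}=\{r,a\}\otimes b\pm a\otimes\{r,b\}$,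 preserving $\Omega^1R=\ker(\mu)\subset R\otimes R$ and descending to $\Omega^1R_\natural:=\Omega^1R/[R,\Omega^1R]$. The universal derivation is $dr=r\otimes 1-1\otimes r$. One has $\Omega^1R\cong R\otimes V\otimes R$ via $b\otimes v\otimes c\mapsto bv\otimes c-b\otimes vc$ and $\Omega^1R_\natural\cong R\otimes V$. Homologies. $\overline{\mathrm{HC}}_\bullet(A)=\mathrm H_\bullet(R_\natural)$ (reduced cyclic homology), with the induced graded Lie bracket. $\overline{\mathrm{HH}}_\bullet(A)\cong\mathrm H_\bullet[\mathrm{cone}(\beta:\Omega^1R_\natural\to\bar R)]$, $\beta(r\otimes v)=[r,v]$ (reduced Hochschild homology), with the graded Lie module structure over $\overline{\mathrm{HC}}_\bullet(A)$ induced by the $R_\natural$-actions on $\Omega^1R_\natural$ and $\bar R$. $B$ is induced by the map $R_\natural\to\Omega^1R_\natural$ coming from $d$, whose composite with $\beta$ is $0$, viewed as a map $R_\natural\to\mathrm{cone}(\beta)[-1]$. Representation homology. $\mathcal M_n(k)$ denotes $n\times n$ matrices, with elementary matrices $e_{ij}$ and dual basis $e_{ij}^*$. $R_n$ is the commutative DG algebra with universal $n$-dimensional representation $\pi_n:R\to\mathcal M_n(R_n)$ (universal among DG algebra maps $R\to\mathcal M_n(B)$, $B$ commutative). As a graded algebra $R_n=\mathrm{Sym}(\mathcal M_n^*(k)\otimes V)$ and $\pi_n(v)=\sum_{i,j}v_{ij}\otimes e_{ij}$ with $v_{ij}=e_{ij}^*\otimes v$. $\mathrm{DRep}_n(A)$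 is represented by $R_n$, $\mathrm{HR}_\bullet(A,n)=\mathrm H_\bullet(R_n)$ and $\Omega^1(\mathrm{DRep}_n(A))=\Omega^1(R_n)$ (Kähler differentials). Traces. The left $\mathrm{Tr}_n$ is induced by $R_\natural\to R_n$, $\bar r\mapsto\mathrm{Tr}(\pi_n(r))$. Let also $\pi_n:\Omega^1R\to\mathcal M_n(\Omega^1R_n)$ be the unique $R$-bimodule map with $\pi_n(dr)=(d\otimes\mathrm{id})(\pi_n(r))$; composing with the matrix trace gives $\mathrm{Tr}_n:\Omega^1R_\natural\to\Omega^1R_n$. The right vertical map is induced by $\mathrm{cone}(\beta)\to\Omega^1R_\natural[1]\xrightarrow{\mathrm{Tr}_n}\Omega^1R_n[1]$. Module structures on the bottom row. $R_n$ has the DG Poisson bracket determined on generators by the trace pairing on $\mathcal M_n(k)$ tensored with the pairing on $V$: $\{v_{ij},w_{kl}\}=\pm\delta_{il}\delta_{jk}\langle v,w\rangle$. For this bracket $\mathrm{Tr}_n:R_\natural\to R_n$ is a DG Lie algebra homomorphism. $R_n$ acts on $\Omega^1R_n$ by $\{x,b\,dc\}=\{x,b\}dc\pm b\,d\{x,c\}$. Through $\mathrm{Tr}_n$, $R_\natural$ acts on $R_n$ and $\Omega^1R_n$, and hence $\overline{\mathrm{HC}}_\bullet(A)$ acts on $\mathrm{HR}_\bullet(A,n)$ and $\mathrm H_\bullet[\Omega^1(\mathrm{DRep}_n(A))]$.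
   Formalization: The left Tr_n is not strictly a module homomorphism: {v,w}=⟨v,w⟩ is zero in HC but acts as n⟨v,w⟩ in HR. Proved instead: [r]·Tr_n[s]=Tr_n([r]·[s])+n·ε({r,s})·[1], with ε the constant term; also \bar R is identified with R/k so that R_♮ acts on it. *)

(* Defs.v *)
From HB Require Import structures.
From mathcomp Require Import all_boot all_order all_algebra finmap.
From mathcomp.multinomials Require Import monalg.
From mathcomp Require Import boolp.

Set Implicit Arguments.
Unset Strict Implicit.
Unset Printing Implicit Defensive.

Import GRing.Theory.
Local Open Scope ring_scope.
Local Open Scope quotient_scope.

(* Overview.  All algebras and bimodules of the statement are written as
   subquotients of free modules on words: a graded vector space is a family of
   vector spaces indexed by int, a letter is a homogeneous element, and
   T(V) = k<letters>/(multilinearity).  Maps are given on words, extended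
   linearly, and compared modulo the relations.  Homology is an honest
   vector space. *)

(* the free algebra k<L> on a set L of letters ... *)
Notation frA k L := {malg k[{fmonom L}]}.
(* ... and its tensor square, with basis the pairs of words *)
Notation frAA k L := {malg k[(seq L * seq L)%type]}.

Section LinearAlgebra.
Variable k : fieldType.

Inductive span (U : lmodType k) (S : U -> Prop) : U -> Prop :=
| span0 : span S 0
| spanZD a x y : S x -> span S y -> span S (a *: x + y).

Section Span.
Variables (U : lmodType k) (S : U -> Prop).

Lemma span_gen x : S x -> span S x.
Proof. by move=> Sx; rewrite -[x]addr0 -[x]scale1r; apply: spanZD (span0 S). Qed.

Lemma spanD x y : span S x -> span S y -> span S (x + y).
Proof.
elim=> [|a u v Su _ IH] Sy; first by rewrite add0r.
by rewrite -addrA; apply: spanZD => //; apply: IH.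
Qed.

Lemma spanZ a x : span S x -> span S (a *: x).
Proof.
elim=> [|b u v Su _ IH]; first by rewrite scaler0; apply: span0.
by rewrite scalerDr scalerA; apply: spanZD.
Qed.

Lemma spanN x : span S x -> span S (- x).
Proof. by move=> Sx; rewrite -scaleN1r; apply: spanZ. Qed.

Definition in_span : {pred U} := fun x => `[< span S x >].

Fact in_span_submod : submod_closed in_span.
Proof.
split; first by apply/asboolP; apply: span0.
move=> a x y /asboolP Sx /asboolP Sy; apply/asboolP.
by apply: spanD => //; apply: spanZ.
Qed.
HB.instance Definition _ := GRing.isSubmodClosed.Build k U in_span in_span_submod.

Record spanT := SpanT { spanT_val : U; spanT_in : in_span spanT_val }.
HB.instance Definition _ := [isSub for spanT_val].
HB.instance Definition _ := [Choice of spanT by <:].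
HB.instance Definition _ := [SubChoice_isSubLmodule of spanT by <:].

Definition quo_rel (x y : U) : bool := `[< span S (x - y) >].

Fact quo_rel_equiv : equiv_class_of quo_rel.
Proof.
split=> [x|x y|y x z].
- by apply/asboolP; rewrite subrr; apply: span0.
- by apply/asboolP/asboolP => /spanN; rewrite opprB.
- move=> /asboolP xy /asboolP yz; apply/asboolP.
  by have := spanD xy yz; rewrite addrA subrK.
Qed.
Canonical quo_equiv := EquivRelPack quo_rel_equiv.

Definition quo := {eq_quot quo_equiv}.
HB.instance Definition _ := Choice.on quo.

Definition qcls (x : U) : quo := \pi_quo x.
Definition qrep (q : quo) : U := repr q.

Lemma qrepK q : qcls (qrep q) = q. Proof. exact: reprK. Qed.

Lemma qclsP x y : qcls x = qcls y <-> span S (x - y).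
Proof. by split=> [/eqmodP/asboolP|h]; [|apply/eqmodP/asboolP]. Qed.

Definition quo_add (p q : quo) := qcls (qrep p + qrep q).
Definition quo_opp (p : quo) := qcls (- qrep p).
Definition quo_scale (a : k) (p : quo) := qcls (a *: qrep p).

Lemma qrep_cls x : span S (qrep (qcls x) - x).
Proof. by apply/qclsP; rewrite qrepK. Qed.

Lemma quo_addE x y : quo_add (qcls x) (qcls y) = qcls (x + y).
Proof.
by apply/qclsP; rewrite opprD addrACA; apply: spanD; apply: qrep_cls.
Qed.
Lemma quo_oppE x : quo_opp (qcls x) = qcls (- x).
Proof. by apply/qclsP; rewrite -opprD; apply/spanN/qrep_cls. Qed.
Lemma quo_scaleE a x : quo_scale a (qcls x) = qcls (a *: x).
Proof. by apply/qclsP; rewrite -scalerBr; apply/spanZ/qrep_cls. Qed.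

Fact quo_addA : associative quo_add.
Proof.
move=> p q r; rewrite -(qrepK p) -(qrepK q) -(qrepK r).
by rewrite !quo_addE addrA.
Qed.
Fact quo_addC : commutative quo_add.
Proof. by move=> p q; rewrite /quo_add addrC. Qed.
Fact quo_add0 : left_id (qcls 0) quo_add.
Proof. by move=> p; rewrite -(qrepK p) quo_addE add0r. Qed.
Fact quo_addN : left_inverse (qcls 0) quo_opp quo_add.
Proof. by move=> p; rewrite -(qrepK p) quo_oppE quo_addE addNr. Qed.
HB.instance Definition _ :=
  GRing.isZmodule.Build quo quo_addA quo_addC quo_add0 quo_addN.

Fact quo_scaleA a b p : quo_scale a (quo_scale b p) = quo_scale (a * b) p.
Proof. by rewrite -(qrepK p) !quo_scaleE scalerA. Qed.
Fact quo_scale1 : left_id 1 quo_scale.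
Proof. by move=> p; rewrite -(qrepK p) quo_scaleE scale1r. Qed.
Fact quo_scaleDr : right_distributive quo_scale +%R.
Proof.
move=> a p q; rewrite -(qrepK p) -(qrepK q).
by rewrite [_ + _]quo_addE !quo_scaleE scalerDr [RHS]quo_addE.
Qed.
Fact quo_scaleDl p : {morph quo_scale^~ p : a b / a + b}.
Proof.
by move=> a b; rewrite -(qrepK p) !quo_scaleE scalerDl [RHS]quo_addE.
Qed.
HB.instance Definition _ := GRing.Zmodule_isLmodule.Build k quo
  quo_scaleA quo_scale1 quo_scaleDr quo_scaleDl.

Fact qcls_linear : linear qcls.
Proof.
by move=> a x y; rewrite [X in _ = X + _]quo_scaleE [RHS]quo_addE.
Qed.
HB.instance Definition _ := GRing.isLinear.Build k U quo _ qcls qcls_linear.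

End Span.

(* The complex  sub/(span rel)  with differential induced by dif.  An element
   of the subquotient is homogeneous of degree i if it has a representative
   satisfying hdg i. *)
Record subq := Subq {
  amb : lmodType k;
  sub : amb -> Prop;
  rel : amb -> Prop;
  dif : amb -> amb;
  hdg : int -> amb -> Prop }.

Section Homology.
Variable X : subq.

Definition cyc (x : amb X) := sub x /\ span (@rel X) (dif x).
Definition bnd_gen (x : amb X) := rel x \/ exists2 y, sub y & x = dif y.

Definition homology :=
  quo (fun z : spanT cyc => span bnd_gen (spanT_val z)).
HB.instance Definition _ := GRing.Lmodule.on homology.

(* junk value 0 outside of the space of cycles *)
Definition cls (x : amb X) : homology :=
  if pselect (in_span cyc x) is left Zx then qcls _ (SpanT Zx) else 0.

Definition Hdeg (i : int) (h : homology) :=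
  exists x, [/\ cyc x, hdg i x & h = cls x].
End Homology.

Definition induces (X Y : subq) (f : amb X -> amb Y)
    (F : homology X -> homology Y) :=
  forall x, cyc x -> cyc (f x) /\ F (cls x) = cls (f x).

Definition induces2 (X Y Z : subq) (f : amb X -> amb Y -> amb Z)
    (F : homology X -> homology Y -> homology Z) :=
  forall x y, cyc x -> cyc y -> cyc (f x y) /\ F (cls x) (cls y) = cls (f x y).

Definition sg (i : int) : k := (-1) ^+ `|i|%N.

Definition graded_map (X Y : subq) (e : int) (f : homology X -> homology Y) :=
  forall i h, Hdeg i h -> Hdeg (i + e) (f h).

Definition graded_op (X Y Z : subq) (e : int)
    (f : homology X -> homology Y -> homology Z) :=
  forall i j g h, Hdeg i g -> Hdeg j h -> Hdeg (i + j + e) (f g h).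

(* f : M -> M' is a homomorphism of degree e of modules over a graded Lie
   algebra L whose bracket and actions a, a' have degree N: an element x of
   degree i acts by an operator of degree i + N, which passes f with the
   Koszul sign. *)
Definition lie_mod_hom (L M M' : subq) (N e : int)
    (a : homology L -> homology M -> homology M)
    (a' : homology L -> homology M' -> homology M')
    (f : homology M -> homology M') :=
  graded_map e f /\
  forall i x y, Hdeg i x -> f (a x y) = sg (e * (i + N)) *: a' x (f y).

Definition lext (K : choiceType) (M : lmodType k) (f : K -> M)
    (u : {malg k[K]}) : M :=
  \sum_(x <- msupp u) u@_x *: f x.

Lemma lextEw (K : choiceType) (M : lmodType k) (f : K -> M) u (d : {fset K}) :
  fsubset (msupp u) d -> lext f u = \sum_(x <- d) u@_x *: f x.
Proof.
move=> le; rewrite [LHS](big_fset_incl _ le) => //= x xd /mcoeff_outdom ->.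
by rewrite scale0r.
Qed.

Lemma lextU (K : choiceType) (M : lmodType k) (f : K -> M) (x : K) :
  lext f << x >> = f x.
Proof.
by rewrite (lextEw _ msuppU_le) big_seq_fset1 mcoeffUU scale1r.
Qed.

Fact lext_linear (K : choiceType) (M : lmodType k) (f : K -> M) :
  linear (lext f).
Proof.
move=> a u v; pose d := fsetU (msupp u) (msupp v).
have le1 : fsubset (msupp u) d by apply: fsubsetUl.
have le2 : fsubset (msupp v) d by apply: fsubsetUr.
have le3 : fsubset (msupp (a *: u + v)) d.
  by apply: fsubset_trans (msuppD_le _ _) _; apply/fsetSU/msuppZ_le.
rewrite (lextEw _ le1) (lextEw _ le2) (lextEw _ le3) scaler_sumr -big_split /=.
by apply: eq_bigr => x _; rewrite mcoeffD mcoeffZ scalerDl scalerA.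
Qed.
HB.instance Definition _ (K : choiceType) (M : lmodType k) (f : K -> M) :=
  GRing.isLinear.Build k {malg k[K]} M _ (lext f) (lext_linear f).

Definition lext2 (K K' : choiceType) (M : lmodType k) (f : K -> K' -> M)
    (u : {malg k[K]}) (v : {malg k[K']}) : M :=
  lext (fun x => lext (f x) v) u.

Definition homog (K : choiceType) (dg : K -> int) (i : int) (u : {malg k[K]}) :=
  forall x, x \in msupp u -> dg x = i.

Section Words.
Variables (L : choiceType) (dg : L -> int).
Notation F := (frA k L).
Notation FF := (frAA k L).

Definition mono (w : seq L) : F := << FMonom w >>.
Definition pmono (w w' : seq L) : FF := << (w, w') >>.

Definition wdeg (w : seq L) : int := \sum_(a <- w) dg a.
Definition pdeg (p : seq L * seq L) : int := wdeg p.1 + wdeg p.2.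

Definition homF (i : int) (u : F) : Prop :=
  homog (fun w : {fmonom L} => wdeg w) i u.
Definition homFF (i : int) (p : FF) : Prop := homog pdeg i p.

Definition ideal (S : F -> Prop) : F -> Prop :=
  span (fun u => exists w s w', S s /\ u = mono w * s * mono w').

Definition aug (u : F) : k := u@_(FMonom [::]).
Definition augI (u : F) : F := u - aug u *: 1.

Definition tens (u v : F) : FF :=
  lext2 (fun w w' : {fmonom L} => pmono w w') u v.
Definition mulm (p : FF) : F := lext (fun q => mono (q.1 ++ q.2)) p.

Lemma monoM w w' : mono w * mono w' = mono (w ++ w').
Proof.
rewrite [LHS]fgmulUU mulr1; congr (<< _ >>); apply/eqP.
by rewrite fmP fmM.
Qed.

(* relations of (F/I) (x) (F/I) *)
Definition trel (I : F -> Prop) (p : FF) :=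
  exists u v, (I u \/ I v) /\ p = tens u v.

Fixpoint derw (d : L -> F) (w : seq L) : F :=
  if w is a :: r then d a * mono r + sg (dg a) *: (mono [:: a] * derw d r)
  else 0.
Definition der (d : L -> F) (u : F) : F := lext (fun w : {fmonom L} => derw d w) u.
Definition derT (d : L -> F) (p : FF) : FF :=
  lext (fun q => tens (derw d q.1) (mono q.2)
                 + sg (wdeg q.1) *: tens (mono q.1) (derw d q.2)) p.

(* {x, a (x) b} = {x, a} (x) b + (-1)^{(|x| + N)|a|} a (x) {x, b} *)
Definition actT (N : int) (b : seq L -> seq L -> F) (u : F) (p : FF) : FF :=
  lext2 (fun (x : {fmonom L}) q =>
    tens (b x q.1) (mono q.2)
    + sg ((wdeg x + N) * wdeg q.1) *: tens (mono q.1) (b x q.2)) u p.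

End Words.
End LinearAlgebra.

Section Coalgebra.
Variables (k : fieldType) (C : int -> lmodType k).

Definition hletter := {i : int & C i}.
HB.instance Definition _ := Choice.on hletter.
Definition hl i (x : C i) : hletter := Tagged C x.
Definition hdeg (a : hletter) : int := tag a.

Notation F := (frA k hletter).
Definition gen i (x : C i) : F := mono k [:: hl x].

Definition multilin (u : F) : Prop :=
  exists i (a : k) (x y : C i), u = gen (a *: x + y) - a *: gen x - gen y.

(* the tensor algebra T(C); C (x) C is its part of length 2 *)
Definition tensA := quo (ideal multilin).
HB.instance Definition _ := GRing.Lmodule.on tensA.
Definition tcls (u : F) : tensA := qcls (ideal multilin) u.
Definition trep (t : tensA) : F := qrep t.

(* the degree i part of C (x) C *)
Definition tens2 (i : int) (t : tensA) : Prop :=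
  exists2 u, t = tcls u &
    span (fun v => exists a b, hdeg a + hdeg b = i /\ v = mono k [:: a; b]) u.

(* f (x) id (x) ... (x) id and id (x) f *)
Definition opl (f : hletter -> F) (u : F) : F :=
  lext (fun w : {fmonom hletter} =>
    if (w : seq _) is a :: r then f a * mono k r else 0) u.
Definition opr (f : hletter -> F) (u : F) : F :=
  lext (fun w : {fmonom hletter} =>
    if (w : seq _) is [:: a; b] then mono k [:: a] * f b else 0) u.

End Coalgebra.

Record dgcoalg (k : fieldType) := DGCoalg {
  ccar :> int -> lmodType k;
  cd : forall i, {linear ccar i -> ccar (i - 1)};
  coprod : forall i, {linear ccar i -> tensA ccar};
  counit : forall i, {linear ccar i -> k^o};
  coone : ccar 0;
  cd_cd : forall i (x : ccar i), cd (i - 1) (cd i x) = 0;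
  coprod_deg : forall i (x : ccar i), tens2 i (coprod i x);
  counit_deg : forall i (x : ccar i), i != 0 -> counit i x = 0;
  coprod_coassoc : forall i (x : ccar i),
    tcls (opl (fun a => trep (coprod _ (tagged a))) (trep (coprod i x)))
    = tcls (opr (fun a => trep (coprod _ (tagged a))) (trep (coprod i x)));
  coprod_counitl : forall i (x : ccar i),
    tcls (opl (fun a => (counit _ (tagged a) : k) *: 1) (trep (coprod i x)))
    = tcls (gen x);
  coprod_counitr : forall i (x : ccar i),
    tcls (opr (fun a => (counit _ (tagged a) : k) *: 1) (trep (coprod i x)))
    = tcls (gen x);
  coprod_cd : forall i (x : ccar i),
    coprod _ (cd i x)
    = tcls (der (@hdeg k ccar) (fun a => gen (cd _ (tagged a))) (trep (coprod i x)));
  counit_cd : forall i (x : ccar i), counit _ (cd i x) = 0;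
  coprod_one : coprod 0 coone = tcls (mono k [:: hl coone; hl coone]);
  counit_one : counit 0 coone = 1;
  cd_one : cd 0 coone = 0
}.

Arguments cd {k d} i : rename.
Arguments coprod {k d} i : rename.
Arguments counit {k d} i : rename.

Section Cobar.
Variables (k : fieldType) (C : dgcoalg k).

Notation L := (hletter C).
Notation F := (frA k L).
Notation FF := (frAA k L).

Definition copr i (x : C i) : F := trep (coprod i x).

(* The coaugmentation coideal is taken as C/k.1, identified with the kernel of
   the counit by x |-> x - eps(x) 1.  Reduced coproducts are computed from the
   coproduct by working modulo the letter 1. *)
Definition Rgen (u : F) : Prop := multilin u \/ u = gen (coone C).
Definition Rrel : F -> Prop := ideal Rgen.

Definition conilpotent : Prop :=
  forall i (x : C i), exists r : nat,
    Rrel (iter r (opl (fun a => copr (tagged a))) (gen x)).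

(* A cyclic pairing on the coaugmentation coideal C/k.1, as a form on C with 1
   in its radical.  In the Koszul rule the comma of <-,-> carries the degree m:
   for m odd this is the convention for which {-,-} below is a DG Lie bracket. *)
Record cyclic_pairing (m : int) := CyclicPairing {
  cpair : forall i j, C i -> C j -> k;
  cpair_linl : forall i j (y : C j), linear (fun x : C i => cpair x y : k^o);
  cpair_linr : forall i j (x : C i), linear (fun y : C j => cpair x y : k^o);
  cpair_deg : forall i j (x : C i) (y : C j), i + j + m != 0 -> cpair x y = 0;
  cpair_sym : forall i j (x : C i) (y : C j),
    cpair x y = sg k (i * j) * cpair y x;
  cpair_one : forall j (y : C j), cpair (coone C) y = 0;
  cpair_cd : forall i j (x : C i) (y : C j),
    cpair (cd i x) y + sg k (i + m) * cpair x (cd j y) = 0;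
  (* (-1)^{|v''||w|} <v',w> v'' = (-1)^{|v||w'|} <v,w''> w'  in C/k.1 *)
  cpair_cyc : forall i j (v : C i) (w : C j),
    Rrel (lext (fun s : {fmonom L} => if (s : seq L) is [:: v'; v''] then
                  (sg k (hdeg v'' * j) * cpair (tagged v') w) *: mono k [:: v'']
                else 0) (copr v)
        - lext (fun s : {fmonom L} => if (s : seq L) is [:: w'; w''] then
                  (sg k (i * hdeg w') * cpair v (tagged w'')) *: mono k [:: w']
                else 0) (copr w))
}.

(* A letter x of F now stands for its desuspension in V. *)
Definition vdeg (a : L) : int := hdeg a - 1.

(* d(s^-1 x) = - s^-1 (dx) + (-1)^{|x'|} s^-1 x' s^-1 x'' *)
Definition dgen (a : L) : F :=
  - gen (cd _ (tagged a))
  + lext (fun w : {fmonom L} => if (w : seq L) is [:: b; c] then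
      sg k (hdeg b) *: mono k [:: b; c] else 0) (copr (tagged a)).

Definition dR (u : F) : F := der vdeg dgen u.

Definition Rcx : subq k :=
  @Subq k F (fun _ => True) Rrel dR (homF vdeg).

Definition natrel (u : F) : Prop :=
  [\/ Rrel u, u = 1
    | exists v w : seq L, u = mono k v * mono k w
        - sg k (wdeg vdeg v * wdeg vdeg w) *: (mono k w * mono k v)].

Definition HCcx : subq k :=
  @Subq k F (fun _ => True) natrel dR (homF vdeg).

Definition FFrel : FF -> Prop := trel Rrel.

(* representatives in FF of elements of Omega^1 R = ker(mu) *)
Definition Omega1 (p : FF) : Prop := Rrel (mulm p).

(* x.p - (-1)^{|x||p|} p.x *)
Definition bicomm (x : seq L) (p : FF) : FF :=
  lext (fun q => pmono k (x ++ q.1) q.2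
    - sg k (wdeg vdeg x * pdeg vdeg q) *: pmono k q.1 (q.2 ++ x)) p.

Definition Omega1natrel (p : FF) : Prop :=
  FFrel p \/ exists x q, Omega1 q /\ p = bicomm x q.

Definition dFF (p : FF) : FF := derT vdeg dgen p.

(* The map beta is the restriction to Omega^1 R of a (x) b |-> (-1)^{|a||b|} b a;
   see beta_rdv. *)
Definition beta (p : FF) : F :=
  lext (fun q => sg k (wdeg vdeg q.1 * wdeg vdeg q.2) *: mono k (q.2 ++ q.1)) p.

Lemma beta_rdv (r : seq L) (v : L) :
  beta (pmono k (r ++ [:: v]) [::] - pmono k r [:: v])
  = mono k r * mono k [:: v]
    - sg k (wdeg vdeg r * vdeg v) *: (mono k [:: v] * mono k r).
Proof.
rewrite /beta linearB /= !lextU /= !monoM.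
by rewrite /wdeg big_nil big_seq1 mulr0 scale1r.
Qed.

(* cone(beta) = Omega^1 R_nat [1] (+) \bar R; an element of degree i is a pair
   of elements of degrees i - 1 and i. *)
Definition HHcx : subq k :=
  @Subq k (FF * F)%type
    (fun p => Omega1 p.1 /\ aug p.2 = 0)
    (fun p => (Omega1natrel p.1 /\ p.2 = 0) \/ (p.1 = 0 /\ Rrel p.2))
    (fun p => (- dFF p.1, beta p.1 + dR p.2))
    (fun i p => homFF vdeg (i - 1) p.1 /\ homF vdeg i p.2).

Definition dnc (u : F) : FF :=
  lext (fun w : {fmonom L} => pmono k w [::] - pmono k [::] w) u.
Definition connes (u : F) : FF * F := (dnc u, 0).

Variables (m : int) (P : cyclic_pairing m).

(* sign of the desuspension: skew-symmetric, as cpair is symmetric *)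
Definition vpair (a b : L) : k :=
  sg k (hdeg a) * cpair P (tagged a) (tagged b).

Definition letter (w : seq L) (i : 'I_(size w)) : L := tnth (in_tuple w) i.
Definition pre (w : seq L) (i : nat) : seq L := take i w.
Definition post (w : seq L) (i : nat) : seq L := drop i.+1 w.

(* Koszul sign of v_< v_i v_> , w_< w_j w_>  ->  w_< v_> v_< (v_i , w_j) w_>
   where the comma has degree m + 2 = - |v_i| - |w_j|. *)
Definition dblsign (v w : seq L) (i : 'I_(size v)) (j : 'I_(size w)) : k :=
  let a := wdeg vdeg (pre v i) in let b := wdeg vdeg (post v i) in
  let c := wdeg vdeg (pre w j) in
  let x := vdeg (letter i) in let y := vdeg (letter j) in
  sg k (a * b + b * x + c * (a + b + y)).

Definition dblbr (v w : seq L) : FF :=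
  \sum_(i < size v) \sum_(j < size w)
    (dblsign i j * vpair (letter i) (letter j)) *:
      pmono k (pre w j ++ post v i) (pre v i ++ post w j).

Definition brw (v w : seq L) : F := mulm (dblbr v w).

Definition br (u v : F) : F :=
  lext2 (fun s t : {fmonom L} => brw s t) u v.

Definition actFF (u : F) (p : FF) : FF := actT vdeg (m + 2) brw u p.

(* The action on cone(beta): the operator of degree |x| + m + 2 defined by x
   passes the shift of Omega^1 R_nat [1], and \bar R is identified with R/k,
   on which R_nat acts because it acts on R by derivations. *)
Definition actHH (u : F) (p : FF * F) : FF * F :=
  (lext (fun x : {fmonom L} =>
           sg k (wdeg vdeg x + (m + 2)) *: actFF (mono k x) p.1) u,
   augI (br u p.2)).

Variable n : nat.

(* (i, j, v) stands for v_ij = e_ij^* (x) v *)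
Definition Ln := ('I_n * 'I_n * L)%type.
HB.instance Definition _ := Choice.on Ln.
Definition ndeg (a : Ln) : int := vdeg a.2.

Notation Fn := (frA k Ln).
Notation FFn := (frAA k Ln).

Definition genn (i j : 'I_n) (a : L) : Fn := mono k [:: (i, j, a)].

(* linearity in v, v_ij = 0 for v the image of 1, and graded commutativity *)
Definition Rngen (u : Fn) : Prop :=
  [\/ exists i j d (a : k) (x y : C d),
        u = genn i j (hl (a *: x + y)) - a *: genn i j (hl x) - genn i j (hl y),
      exists i j, u = genn i j (hl (coone C))
    | exists a b : Ln, u = mono k [:: a] * mono k [:: b]
        - sg k (ndeg a * ndeg b) *: (mono k [:: b] * mono k [:: a])].
Definition Rnrel : Fn -> Prop := ideal Rngen.

Definition piw (w : seq L) : 'M[Fn]_n :=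
  foldr (fun a M => (\matrix_(i, j) genn i j a) *m M) 1%:M w.
Definition pin (u : F) : 'M[Fn]_n :=
  \matrix_(i, j) lext (fun w : {fmonom L} => piw w i j) u.

(* the differential for which pin is a map of DG algebras *)
Definition dngen (a : Ln) : Fn := pin (dgen a.2) a.1.1 a.1.2.

Definition dRn (u : Fn) : Fn := der ndeg dngen u.

Definition HRcx : subq k :=
  @Subq k Fn (fun _ => True) Rnrel dRn (homF ndeg).

(* elements of R_nat = R/(k + [R,R]) are represented in \bar R *)
Definition Trn (u : F) : Fn := \tr (pin (augI u)).

Definition npair (a b : Ln) : k :=
  ((a.1.1 == b.1.2) && (a.1.2 == b.1.1))%:R * vpair a.2 b.2.

Definition nletter (w : seq Ln) (i : 'I_(size w)) : Ln := tnth (in_tuple w) i.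

(* Koszul sign of v_< v_i v_> , w_< w_j w_>  ->  v_< v_> (v_i , w_j) w_< w_> *)
Definition poisw (v w : seq Ln) : Fn :=
  \sum_(i < size v) \sum_(j < size w)
    (sg k (ndeg (nletter i) * wdeg ndeg (drop i.+1 v)
           + wdeg ndeg (take j w) * ndeg (nletter j))
     * npair (nletter i) (nletter j)) *:
      mono k (take i v ++ drop i.+1 v ++ take j w ++ drop j.+1 w).
Definition pois (u v : Fn) : Fn :=
  lext2 (fun s t : {fmonom Ln} => poisw s t) u v.

(* b (x) c stands for b dc *)

Definition Omnrel (p : FFn) : Prop :=
  trel Rnrel p \/
  exists b c c' : seq Ln, p = pmono k b (c ++ c') - pmono k (b ++ c) c'
    - sg k (wdeg ndeg c * wdeg ndeg c') *: pmono k (b ++ c') c.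

Definition HOcx : subq k :=
  @Subq k FFn (fun _ => True) Omnrel (derT ndeg dngen) (homFF ndeg).

Definition ddR (u : Fn) : FFn := tens 1 u.

(* If a (x) b lies in ker(mu) then a (x) b = - a db, sums being understood, and
   it is sent by pin to - pin(a) d(pin(b)). *)
Definition pinOmega (p : FF) : 'M[FFn]_n :=
  \matrix_(i, j) lext (fun q => - \sum_l tens (piw q.1 i l) (piw q.2 l j)) p.
Definition TrOmega (p : FF) : FFn := \tr (pinOmega p).

(* cone(beta) -> Omega^1 R_nat [1] -> Omega^1 R_n [1] *)
Definition TrHH (p : FF * F) : FFn := TrOmega p.1.

Definition actRn (u : F) (x : Fn) : Fn := pois (Trn u) x.
Definition actOm (u : F) (p : FFn) : FFn := actT ndeg (m + 2) poisw (Trn u) p.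

(* Compatibility of Tr_n : HC -> HR with the module structures.  The brackets of
   linear elements are constants: {v, w} = <v, w> 1 vanishes in R_nat, whereas
   {Tr_n v, Tr_n w} = n <v, w> 1 in R_n.  Hence Tr_n is equivariant exactly up
   to n times the constant term of {r, s}; it is strictly equivariant whenever
   {r, s} lies in \bar R. *)
Definition TrHC_hom
    (b : homology HCcx -> homology HCcx -> homology HCcx)
    (a : homology HCcx -> homology HRcx -> homology HRcx)
    (T : homology HCcx -> homology HRcx) : Prop :=
  graded_map 0 T /\
  forall r s : F, @cyc k HCcx r -> @cyc k HCcx s ->
    a (@cls k HCcx r) (T (@cls k HCcx s))
    = T (b (@cls k HCcx r) (@cls k HCcx s))
      + (n%:R * aug (br r s)) *: @cls k HRcx 1.

End Cobar.

Record augDGA (k : fieldType) := AugDGA {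
  acar : algType k;
  agr : int -> acar -> Prop;
  ad : {linear acar -> acar};
  aeps : {lrmorphism acar -> k^o};
  agr0 : forall i, agr i 0;
  agr_lin : forall i (a : k) x y, agr i x -> agr i y -> agr i (a *: x + y);
  agr_sum : forall x, exists (s : seq int) (f : int -> acar),
    (forall i, agr i (f i)) /\ x = \sum_(i <- s) f i;
  agr_free : forall (s : seq int) (f : int -> acar), uniq s ->
    (forall i, agr i (f i)) -> \sum_(i <- s) f i = 0 ->
    forall i, i \in s -> f i = 0;
  agr1 : agr 0 1;
  agrM : forall i j x y, agr i x -> agr j y -> agr (i + j) (x * y);
  agr_ad : forall i x, agr i x -> agr (i - 1) (ad x);
  ad_ad : forall x, ad (ad x) = 0;
  adM : forall i x y, agr i x -> ad (x * y) = ad x * y + sg k i *: (x * ad y);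
  aeps_deg : forall i x, i != 0 -> agr i x -> aeps x = 0;
  aeps_ad : forall x, aeps (ad x) = 0
}.

Definition Acx (k : fieldType) (A : augDGA k) : subq k :=
  @Subq k (acar A) (fun _ => True) (fun x => x = 0) (@ad k A) (@agr k A).

(* A quasi-isomorphism R -> A of augmented DG algebras. *)
Definition koszul_dual (k : fieldType) (C : dgcoalg k) (A : augDGA k) : Prop :=
  exists f : {lrmorphism frA k (hletter C) -> acar A},
    [/\ forall u, Rrel u -> f u = 0,
        forall w, agr (wdeg (@vdeg k C) w) (f (mono k w)),
        forall u, f (dR u) = ad A (f u),
        forall u, aeps A (f u) = aug u
      & exists Hf : {linear homology (Rcx C) -> homology (Acx A)},
          induces (X := Rcx C) (Y := Acx A) f Hf /\ bijective Hf].

(* Main.v *)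
(* For a word v and a letter b let phi v b be the cyclic sum of the terms
   +- <v_i, b> v_> v_<.  Then {v, -} is the derivation of R of degree
   |v| + m + 2 with values phi v b on letters, and phi factors through R_nat.
   Cyclicity of the pairing says that, modulo the relations,
   d (phi v b) = phi (d v) b + (-1)^{|v| + m + 2} {v, d b},
   so {v, -} commutes with d on R, R (x) R, Omega^1 R, R_n and Omega^1 R_n.
   On R_n it sends b_ij to pi_n (phi v b)_ij, which up to graded commutators is
   {Tr_n v, b_ij}.  Hence all maps intertwine the actions on complexes. *)

Require Import Defs.
From HB Require Import structures.
From mathcomp Require Import all_boot all_order all_algebra finmap.
From mathcomp.multinomials Require Import monalg.
From mathcomp Require Import boolp ring.
Require Import Defs.
Import GRing.Theory.
Local Open Scope ring_scope.

Set Implicit Arguments.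
Unset Strict Implicit.
Unset Printing Implicit Defensive.

(** * Signs *)

(** Compatibility with [d] is local. Before it is closed up cyclically, contraction with b is the
    double derivation v |-> sum of +- <v_i, b> v_< (x) v_>, and its commutator with [d] only sees
    the contracted letter a. There the coproduct of a leaves one letter at the left or at the right
    end of v_> v_<, and so does the coproduct of b in {v, d b}. The left ends cancel by cyclicity
    for (a, b), the right ends by cyclicity for (b, a) and symmetry, the linear terms by invariance
    of the pairing under [d]. Two obstacles shape the rest. Constants: R_nat forgets the unit but
    R_n does not, and \bar R is stable under the bracket only after projection; on the cone one
    needs that {z, beta p} has no constant term when p lies in Omega^1. Representatives: the word
    formula for the Poisson bracket is a derivation only modulo relations, and the chosen lift of
    the coproduct need not be homogeneous. So each given operation is compared with a model, and the
    passage to homology accepts a model that agrees with it up to elements whose differentials are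
    again relations. *)

Definition par (i : int) : bool := odd `|i|%N.

Lemma parD i j : par (i + j) = par i (+) par j.
Proof.
have sub m n : par (Posz m - Posz n) = odd m (+) odd n.
  case: (leqP n m) => h; first by rewrite /par subzn // oddB.
  by rewrite /par -opprB subzn 1?ltnW // abszN oddB 1?ltnW // addbC.
case: i j => [m|m] [n|n]; rewrite ?NegzE.
- by rewrite /par oddD.
- by rewrite sub /par abszN.
- by rewrite addrC sub /par abszN addbC.
- by rewrite -opprD /par !abszN oddD.
Qed.

Lemma parM i j : par (i * j) = par i && par j.
Proof. by rewrite /par abszM oddM. Qed.

Lemma parN i : par (- i) = par i.
Proof. by rewrite /par abszN. Qed.

Definition parE := (parD, parM, parN, erefl : par 0 = false,
  erefl : par 1 = true, erefl : par 2 = false).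

Lemma sgE (k : fieldType) i : sg k i = (-1) ^+ (par i).
Proof. by rewrite /sg /par signr_odd. Qed.

(** Koszul signs depend only on parities: every parity becomes a boolean, all cases are split, and
    [ring] proves the remaining numerical identity. Parity relations left as premises of the goal
    discard the impossible cases. *)
Ltac sgring :=
  rewrite ?sgE ?parE;
  repeat match goal with |- context [par ?x] =>
    let b := fresh "b" in set b := par x; move: b => b; try move: b end;
  repeat (case=> /=); rewrite ?expr0 ?expr1; intros; try discriminate; ring.

Section Sign.
Variable k : fieldType.
Lemma sgD i j : sg k (i + j) = sg k i * sg k j. Proof. by sgring. Qed.
Lemma sgK i : sg k i * sg k i = 1. Proof. by sgring. Qed.
Lemma sgN i : sg k (- i) = sg k i. Proof. by sgring. Qed.
End Sign.

(** * Spans and homology of subquotients *)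

Section Span.
Variable k : fieldType.

Lemma spanB (U : lmodType k) (S : U -> Prop) x y :
  span S x -> span S y -> span S (x - y).
Proof. by move=> hx hy; apply: spanD => //; apply: spanN. Qed.

Lemma spanBC (U : lmodType k) (S : U -> Prop) x y :
  span S (x - y) -> span S (y - x).
Proof. by move=> /spanN; rewrite opprB. Qed.

Lemma span_trans (U : lmodType k) (S : U -> Prop) y x z :
  span S (x - y) -> span S (y - z) -> span S (x - z).
Proof. by move=> hx /(spanD hx); rewrite addrA subrK. Qed.

Lemma span_cong (U : lmodType k) (S : U -> Prop) x y :
  span S (x - y) -> span S y -> span S x.
Proof. by move=> hx /(spanD hx); rewrite subrK. Qed.

Lemma span_eq (U : lmodType k) (S : U -> Prop) x y :
  x = y -> span S x -> span S y.
Proof. by move->. Qed.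

Lemma span_lin (U V : lmodType k) (S : U -> Prop) (T : V -> Prop) (f : U -> V) :
  linear f -> (forall x, S x -> span T (f x)) ->
  forall x, span S x -> span T (f x).
Proof.
move=> lf h x; elim=> [|a u v Su _ IH].
  have := lf (-1) 0 0; rewrite scaler0 addr0 scaleN1r addNr => ->.
  exact: span0.
by rewrite lf; apply: spanD => //; apply/spanZ/h.
Qed.

Lemma span_sub (U : lmodType k) (S T : U -> Prop) :
  (forall x, S x -> span T x) -> forall x, span S x -> span T x.
Proof. by move=> h; apply: (@span_lin _ _ _ _ id) => // a x y. Qed.

Lemma span_sum (U : lmodType k) (S : U -> Prop) I (r : seq I) (P : pred I) F :
  (forall i, P i -> span S (F i)) -> span S (\sum_(i <- r | P i) F i).
Proof.
by move=> h; elim/big_ind: _ => [|x y|]; [apply: span0|apply: spanD|].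
Qed.

End Span.

Section Homology.
Variable k : fieldType.

(** A [subq] carries arbitrary predicates and maps; these are the conditions under which its cycles
    form a subspace. *)
Definition linear_subq (X : subq k) :=
  [/\ linear (@dif k X) & forall x, span (@sub k X) x -> sub x].

Section One.
Variables (X : subq k) (lX : linear_subq X).

Lemma cyc_span x : span (@cyc k X) x -> cyc x.
Proof.
case: lX => ld sX h; split.
  by apply: sX; apply: span_sub h => y [sy _]; apply: span_gen.
by move: x h; apply: (span_lin ld) => x [].
Qed.

(** On a cycle the default value 0 of [cls] is excluded, and any proof of membership gives the same
    point of the subtype. *)
Lemma clsE x (cx : cyc x) :
  cls x = qcls _ (SpanT (asboolT (span_gen cx) : in_span (@cyc k X) x)).
Proof.
rewrite /cls; case: pselect => [h|[]]; last exact/asboolT/span_gen.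
by congr qcls; apply: val_inj.
Qed.

Lemma span_val (z : spanT (@cyc k X)) :
  span (fun z : spanT (@cyc k X) => span (@bnd_gen k X) (spanT_val z)) z ->
  span (@bnd_gen k X) (spanT_val z).
Proof. by move: z; apply: (@span_lin _ _ _ _ _ (@spanT_val _ _ _)). Qed.

Lemma clsP x y : cyc x -> cyc y ->
  cls x = cls y <-> span (@bnd_gen k X) (x - y).
Proof.
by move=> cx cy; rewrite !clsE qclsP; split=> [/span_val|h]; last exact: span_gen.
Qed.

Lemma cls_surj h : exists2 x, cyc x & h = @cls k X x.
Proof.
have cx : cyc (spanT_val (qrep h)).
  by apply: cyc_span; apply/asboolP; case: (qrep h).
exists (spanT_val (qrep h)) => //; rewrite clsE -[LHS]qrepK.
by congr qcls; apply: val_inj.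
Qed.

Lemma cyc_lin a x y : cyc x -> cyc y -> @cyc k X (a *: x + y).
Proof.
by move=> cx cy; apply: cyc_span; apply: spanZD => //; apply: span_gen.
Qed.

Lemma cls_lin a x y : cyc x -> cyc y ->
  @cls k X (a *: x + y) = a *: cls x + cls y.
Proof.
move=> cx cy; rewrite (clsE (cyc_lin a cx cy)) (clsE cx) (clsE cy) -linearP.
by congr qcls; apply: val_inj.
Qed.

(** Maps on homology are defined through these chosen cycles; independence of the choice is what
    [induces] and [induces2] assert. *)
Definition cyc_rep (h : homology X) : amb X := projT1 (cid2 (cls_surj h)).

Lemma cyc_rep_cyc h : cyc (cyc_rep h).
Proof. by rewrite /cyc_rep; case: cid2. Qed.

Lemma cyc_repK h : cls (cyc_rep h) = h.
Proof. by rewrite /cyc_rep; case: cid2. Qed.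
End One.

Section Map.
Variables (X Y : subq k) (lX : linear_subq X) (lY : linear_subq Y).
Variables (f : amb X -> amb Y) (c : k).
Hypotheses (lf : linear f) (sf : forall x, sub x -> sub (f x)).
Hypothesis rf : forall x, rel x -> span (@rel k Y) (f x).
Hypothesis df : forall x, sub x -> span (@rel k Y) (f (dif x) - c *: dif (f x)).
Hypothesis c0 : c != 0.

(** The nonzero scalar [c] allows maps that anticommute with the differentials, as those into and
    out of the shifted summand of the cone do. *)
Lemma induced_cyc x : cyc x -> cyc (f x).
Proof.
move=> [sx dx]; split; first exact: sf.
have h := span_cong (spanBC (df sx)) (span_lin lf rf dx).
by have := spanZ c^-1 h; rewrite scalerA mulVf // scale1r.
Qed.

Lemma induced_bnd x : span (@bnd_gen k X) x -> span (@bnd_gen k Y) (f x).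
Proof.
move: x; apply: (span_lin lf) => x [rx|[y sy ->]].
  by apply: span_sub (rf rx) => y ry; apply: span_gen; left.
have : span (@bnd_gen k Y) (f (dif y) - c *: dif (f y)).
  by apply: span_sub (df sy) => z rz; apply: span_gen; left.
move/span_cong; apply; apply: spanZ; apply: span_gen; right.
by exists (f y) => //; apply: sf.
Qed.

Definition induced (h : homology X) : homology Y := cls (f (cyc_rep lX h)).

Lemma induced_induces : induces f induced.
Proof.
move=> x cx; split; first exact: induced_cyc.
have cr := cyc_rep_cyc lX (cls x).
apply/clsP; [exact: induced_cyc|exact: induced_cyc|].
have fB u v : f (u - v) = f u - f v.
  by rewrite addrC -scaleN1r lf scaleN1r addrC.
rewrite -fB; apply: induced_bnd; apply/clsP => //.
exact: cyc_repK.
Qed.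

Lemma induced_linear : linear induced.
Proof.
move=> a g h; have [x cx ->] := cls_surj lX g; have [y cy ->] := cls_surj lX h.
rewrite -(cls_lin lX) //.
have I z (cz : cyc z) := (induced_induces cz).2.
rewrite !I //; last exact: cyc_lin.
by rewrite lf (cls_lin lY) //; apply: induced_cyc.
Qed.

Lemma induced_exists :
  exists F : {linear homology X -> homology Y}, induces f F.
Proof.
by exists (HB.pack_for {linear homology X -> homology Y} induced (GRing.isLinear.Build k _ _ _ induced induced_linear));
   exact: induced_induces.
Qed.
End Map.

(** * Bilinear operations on homology *)

Section Operation.
Variables (X Y Z : subq k).
Hypotheses (lX : linear_subq X) (lY : linear_subq Y) (lZ : linear_subq Z).
Variables (f g : amb X -> amb Y -> amb Z) (t : amb X -> amb X).
Variables (dX : amb X -> amb X) (dY : amb Y -> amb Y) (dZ : amb Z -> amb Z).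
Variable K : amb Z -> Prop.
Hypothesis gl : forall y, linear (g^~ y).
Hypothesis gr : forall x, linear (g x).
Hypothesis fl : forall y, linear (f^~ y).
Hypothesis fr : forall x, linear (f x).
Hypothesis sX : forall x : amb X, sub x.
Hypothesis fs : forall x y, sub y -> sub (f x y).
Hypothesis dXE : forall x, span (@rel k X) (dif x - dX x).
Hypothesis dYE : forall y, sub y -> span (@rel k Y) (dif y - dY y).
Hypothesis dZE : forall z, sub z -> span (@rel k Z) (dif z - dZ z).
Hypothesis dZl : linear dZ.
Hypothesis KZ : forall z, K z -> span (@rel k Z) z.
Hypothesis dK : forall z, K z -> span (@rel k Z) (dZ z).
Hypothesis fg : forall x y, sub y -> span K (f x y - g x y).
Hypothesis relX : forall x y, rel x -> sub y -> span (@rel k Z) (g x y).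
Hypothesis relY : forall x y, rel y -> span (@rel k Z) (g x y).
Hypothesis tK : forall x, t (t x) = x.
Hypothesis tl : linear t.
Hypothesis trel : forall x, rel x -> span (@rel k X) (t x).
Hypothesis td : forall x, t (dX x) = - dX (t x).
Hypothesis gd : forall x y, sub y ->
  span (@rel k Z) (dZ (g x y) - (g (dX x) y + g (t x) (dY y))).

Let gBl x x' y : g (x - x') y = g x y - g x' y.
Proof. by rewrite addrC -scaleN1r gl scaleN1r addrC. Qed.
Let gBr x y y' : g x (y - y') = g x y - g x y'.
Proof. by rewrite addrC -scaleN1r gr scaleN1r addrC. Qed.
Let fBl x x' y : f (x - x') y = f x y - f x' y.
Proof. by rewrite addrC -scaleN1r fl scaleN1r addrC. Qed.
Let fBr x y y' : f x (y - y') = f x y - f x y'.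
Proof. by rewrite addrC -scaleN1r fr scaleN1r addrC. Qed.
Let dB x y : dZ (x - y) = dZ x - dZ y.
Proof. by rewrite addrC -scaleN1r dZl scaleN1r addrC. Qed.

Let srelX x y : span (@rel k X) x -> sub y -> span (@rel k Z) (g x y).
Proof.
by move=> rx sy; move: x rx; apply: (span_lin (gl y)) => x rx; apply: relX.
Qed.

Let srelY x y : span (@rel k Y) y -> span (@rel k Z) (g x y).
Proof. by move: y; apply: (span_lin (gr x)) => y ry; apply: relY. Qed.

Let fg' x y : sub y -> span (@rel k Z) (f x y - g x y).
Proof. by move=> sy; apply: span_sub (fg x sy). Qed.

Let rel_bnd (W : subq k) (x : amb W) : span (@rel k W) x -> span (@bnd_gen k W) x.
Proof. by apply: span_sub => z rz; apply: span_gen; left. Qed.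

Let dif_bnd (W : subq k) (x : amb W) : sub x -> span (@bnd_gen k W) (dif x).
Proof. by move=> sx; apply: span_gen; right; exists x. Qed.

Let fd x y : sub y ->
  span (@rel k Z) (dif (f x y) - (g (dX x) y + g (t x) (dY y))).
Proof.
move=> sy; apply: span_trans (dZE (fs x sy)) _.
apply: span_trans (gd x sy).
by rewrite -dB; apply: (span_lin dZl dK); apply: fg.
Qed.

Let cdX x : cyc x -> span (@rel k X) (dX x).
Proof. by case=> _; apply/span_cong/spanBC/dXE. Qed.

Let cdY y : cyc y -> span (@rel k Y) (dY y).
Proof. by case=> sy; apply/span_cong/spanBC/dYE. Qed.

(** Here [f] is the given operation and [g] a model which respects relations and satisfies a Leibniz
    rule for the simplified differentials [dX], [dY], [dZ]; the sign of that rule is carried by the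
    involution [t]. Since [f] and [g] differ by the span of [K], which [dZ] sends into relations,
    [fd] gives the same rule for [f]. *)
Lemma operation_cyc x y : cyc x -> cyc y -> cyc (f x y).
Proof.
move=> cx cy; have sy := cy.1; split; first exact: fs.
apply: span_cong (fd x sy) _; apply: spanD.
  by apply: srelX => //; apply: cdX.
by apply: srelY; apply: cdY.
Qed.

Let fbl x y : span (@bnd_gen k X) x -> cyc y -> span (@bnd_gen k Z) (f x y).
Proof.
move=> hx cy; have sy := cy.1.
apply: span_cong (rel_bnd (fg' x sy)) _.
move: x hx; apply: (span_lin (gl y)) => x [rx|[z _ ->]].
  exact/rel_bnd/relX.
have h : span (@rel k Z) (g (dif z) y - dif (f z y)).
  apply: (@span_trans _ _ _ (g (dX z) y)).
    by rewrite -gBl; apply: srelX.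
  apply: spanBC; have := fd z sy; rewrite opprD addrA.
  by move/spanD/(_ (srelY (t z) (cdY cy))); rewrite subrK.
by apply: span_cong (rel_bnd h) _; apply/dif_bnd/fs.
Qed.

Let tcd x : cyc x -> span (@rel k X) (dX (t x)).
Proof.
move=> cx; rewrite -[dX _]opprK -td; apply: spanN.
by apply: (span_lin tl trel); apply: cdX.
Qed.

(** The sign of the Leibniz rule sits on the first argument, so the rule is applied to [t x]: as
    [t (t x) = x], the element [g x (dif z)] is the boundary of [f (t x) z] up to relations. *)
Let fbr x y : span (@bnd_gen k Y) y -> cyc x -> span (@bnd_gen k Z) (g x y).
Proof.
move=> hy cx; move: y hy; apply: (span_lin (gr x)) => y [ry|[z sz ->]].
  exact/rel_bnd/relY.
have h : span (@rel k Z) (g x (dif z) - dif (f (t x) z)).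
  apply: (@span_trans _ _ _ (g x (dY z))).
    by rewrite -gBr; apply/srelY/dYE.
  apply: spanBC; have := fd (t x) sz; rewrite tK opprD addrA.
  by move/spanD/(_ (srelX (tcd cx) sz)); rewrite addrAC subrK.
by apply: span_cong (rel_bnd h) _; apply/dif_bnd/fs.
Qed.

Definition operation (h : homology X) (h' : homology Y) : homology Z :=
  cls (f (cyc_rep lX h) (cyc_rep lY h')).

Lemma operation_induces : induces2 f operation.
Proof.
move=> x y cx cy; split; first exact: operation_cyc.
rewrite /operation; set x' := cyc_rep _ _; set y' := cyc_rep _ _.
have cx' : cyc x' by apply: cyc_rep_cyc.
have cy' : cyc y' by apply: cyc_rep_cyc.
apply/clsP; try exact: operation_cyc.
apply: (@span_trans _ _ _ (f x y')).
  by rewrite -fBl; apply: fbl => //; apply/clsP => //; apply: cyc_repK.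
rewrite -fBr; apply: span_cong (fbr _ cx).
  by apply/rel_bnd/fg'; case: lY => _; apply; apply: spanB; apply: span_gen;
    [case: cy'|case: cy].
by apply/clsP => //; apply: cyc_repK.
Qed.

Lemma operation_exists : exists F, induces2 f F.
Proof. by exists operation; apply: operation_induces. Qed.
End Operation.
End Homology.

(** * Identities between linear combinations *)

Section Linear.
Variables (k : fieldType) (U V W : lmodType k).

Lemma linear_id : linear (fun u : U => u). Proof. by []. Qed.
Lemma linear_0 : linear (fun u : U => 0 : V).
Proof. by move=> a x y; rewrite scaler0 addr0. Qed.
Lemma linear_add (f g : U -> V) :
  linear f -> linear g -> linear (fun u => f u + g u).
Proof. by move=> lf lg a x y; rewrite lf lg scalerDr addrACA. Qed.
Lemma linear_opp (f : U -> V) : linear f -> linear (fun u => - f u).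
Proof. by move=> lf a x y; rewrite lf opprD scalerN. Qed.
Lemma linear_scale c (f : U -> V) : linear f -> linear (fun u => c *: f u).
Proof. by move=> lf a x y; rewrite lf scalerDr !scalerA mulrC. Qed.
Lemma linear_comp (g : {linear V -> W}) (f : U -> V) :
  linear f -> linear (fun u => g (f u)).
Proof. by move=> lf a x y; rewrite lf linearP. Qed.
Lemma linear_bigsum I (r : seq I) (P : pred I) (f : I -> U -> V) :
  (forall i, linear (f i)) -> linear (fun u => \sum_(i <- r | P i) f i u).
Proof.
move=> lf a x y; rewrite scaler_sumr -big_split /=.
by apply: eq_bigr => i _; rewrite lf.
Qed.
Lemma linear_linear (f : {linear U -> V}) : linear (fun u => f u).
Proof. exact: linearP. Qed.
End Linear.

Section LinearIdentity.
Variables (k : fieldType) (V : lmodType k).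

(** Linear expressions for proof by reflection. Scalars stay unreified elements of k, so the
    resulting goals can still be treated as sign identities. *)
Inductive lexp :=
  | LVar of nat | LZero | LAdd of lexp & lexp | LOpp of lexp | LScale of k & lexp.

Fixpoint leval (env : seq V) (e : lexp) : V :=
  match e with
  | LVar n => nth 0 env n
  | LZero => 0
  | LAdd a b => leval env a + leval env b
  | LOpp a => - leval env a
  | LScale c a => c *: leval env a
  end.

Fixpoint lcoef (e : lexp) (n : nat) : k :=
  match e with
  | LVar m => (if Nat.eqb m n then 1 else 0)
  | LZero => 0
  | LAdd a b => lcoef a n + lcoef b n
  | LOpp a => - lcoef a n
  | LScale c a => c * lcoef a n
  end.

Fixpoint lbound (e : lexp) (n : nat) : bool :=
  match e with
  | LVar m => (m < n)%N
  | LZero => true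
  | LAdd a b => lbound a n && lbound b n
  | LOpp a | LScale _ a => lbound a n
  end.

Lemma levalE env e : lbound e (size env) ->
  leval env e = \sum_(i < size env) lcoef e i *: env`_i.
Proof.
elim: e => [m|_|a IHa b IHb /andP[ha hb]|a IH h|c a IH h] /=.
- move=> h; rewrite (bigD1 (Ordinal h)) //= PeanoNat.Nat.eqb_refl scale1r.
  rewrite big1 ?addr0 // => i; rewrite -val_eqE /= eq_sym => im.
  by case: PeanoNat.Nat.eqb_spec im => [->|_ _]; rewrite ?eqxx // scale0r.
- by rewrite big1 // => i _; rewrite scale0r.
- by rewrite IHa // IHb // -big_split; apply: eq_bigr => i _; rewrite scalerDl.
- by rewrite IH // -sumrN; apply: eq_bigr => i _; rewrite scaleNr.
- by rewrite IH // scaler_sumr; apply: eq_bigr => i _; rewrite scalerA.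
Qed.

(** A computed conjunction, so that splitting produces one goal in k per atom. *)
Fixpoint lcoef_eq (e1 e2 : lexp) (n : nat) : Prop :=
  if n is n'.+1 then lcoef e1 n' = lcoef e2 n' /\ lcoef_eq e1 e2 n' else True.

Lemma leval_eq env e1 e2 : lbound e1 (size env) && lbound e2 (size env) ->
  lcoef_eq e1 e2 (size env) -> leval env e1 = leval env e2.
Proof.
case/andP=> h1 h2 h; rewrite !levalE //; apply: eq_bigr => i _; congr (_ *: _).
have E n m : (m < n)%N -> lcoef_eq e1 e2 n -> lcoef e1 m = lcoef e2 m.
  elim: n => //= n IH; rewrite ltnS leq_eqVlt => /orP[/eqP ->|mn] [] // _.
  exact: IH.
exact: E (ltn_ord i) h.
Qed.
End LinearIdentity.

Ltac lm_same x y := lazymatch y with x => constr:(true) | _ => constr:(false) end.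

Ltac lm_add x env :=
  let rec mem l := lazymatch l with
    | ?y :: ?r => lazymatch lm_same x y with true => constr:(true) | false => mem r end
    | _ => constr:(false)
    end in
  lazymatch mem env with true => env | false => constr:(x :: env) end.

Ltac lm_atoms e env :=
  lazymatch e with
  | ?a + ?b => let env := lm_atoms a env in lm_atoms b env
  | - ?a => lm_atoms a env
  | _ *: ?a => lm_atoms a env
  | 0 => env
  | ?x => lm_add x env
  end.

Ltac lm_index x env :=
  lazymatch env with
  | ?y :: ?r =>
    lazymatch lm_same x y with
    | true => constr:(0%N)
    | false => let n := lm_index x r in constr:(n.+1)
    end
  end.

Ltac lm_quote k e env :=
  lazymatch e with
  | ?a + ?b => let a := lm_quote k a env in let b := lm_quote k b env in
               constr:(LAdd a b)
  | - ?a => let a := lm_quote k a env in constr:(LOpp a)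
  | ?c *: ?a => let a := lm_quote k a env in constr:(LScale c a)
  | 0 => constr:(LZero k)
  | ?x => let n := lm_index x env in constr:(LVar k n)
  end.

(* reduces an identity in a k-module to the identities between the
   coefficients of its atoms *)
Ltac lmod k :=
  lazymatch goal with
  | |- @eq ?T ?x ?y =>
    let env := lm_atoms x (@nil T) in let env := lm_atoms y env in
    let ex := lm_quote k x env in let ey := lm_quote k y env in
    apply: (@leval_eq k _ env ex ey); [by []|rewrite /=; repeat split]
  end.

Section FreeModule.
Variables (k : fieldType) (K : choiceType).
Notation M := {malg k[K]}.

Lemma homog0 (dg : K -> int) i : homog dg i (0 : M).
Proof. by move=> x; rewrite msupp0. Qed.

Lemma homog_lin (dg : K -> int) i a (u v : M) :
  homog dg i u -> homog dg i v -> homog dg i (a *: u + v).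
Proof.
move=> hu hv x /(fsubsetP (msuppD_le _ _)); rewrite in_fsetU => /orP[|/hv //].
by move/(fsubsetP (msuppZ_le _ _))/hu.
Qed.

Lemma homogU (dg : K -> int) x : homog dg (dg x) (<< x >> : M).
Proof. by move=> y /(fsubsetP msuppU_le); rewrite in_fset1 => /eqP ->. Qed.

Lemma homog_ind (dg : K -> int) i (P : M -> Prop) : P 0 ->
  (forall a u v, P u -> P v -> P (a *: u + v)) ->
  (forall x, dg x = i -> P << x >>) -> forall u, homog dg i u -> P u.
Proof.
move=> P0 PD PU u hu; rewrite (monalgE u).
rewrite big_seq; elim/big_ind: _ => // [x y Px Py|x /hu /PU Px].
  by rewrite -[x]scale1r; apply: PD.
suff -> : << u@_x *g x >> = u@_x *: << x >> + 0 :> M by apply: PD.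
rewrite addr0; apply/malgP => y; rewrite mcoeffZ !mcoeffU.
by rewrite mulrnAr mulr1.
Qed.

Lemma malg_ind (P : M -> Prop) : P 0 ->
  (forall a u v, P u -> P v -> P (a *: u + v)) ->
  (forall x, P << x >>) -> forall u, P u.
Proof. by move=> P0 PD PU u; apply: (@homog_ind (fun=> 0) 0). Qed.

Lemma malg_lin_span (V : lmodType k) (S : V -> Prop) (f : M -> V) : linear f ->
  (forall x, span S (f << x >>)) -> forall u, span S (f u).
Proof.
move=> lf h; elim/malg_ind => // [|a u v hu hv]; last first.
  by rewrite lf; apply: spanD => //; apply: spanZ.
have := lf (-1) 0 0; rewrite scaler0 addr0 scaleN1r addNr => ->.
exact: span0.
Qed.

Lemma lext_ext (V : lmodType k) (f g : K -> V) (u : M) :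
  f =1 g -> lext f u = lext g u.
Proof. by move=> h; apply: eq_bigr => x _; rewrite h. Qed.

End FreeModule.

Section Words.
Variables (k : fieldType) (L : choiceType) (dg : L -> int).
Notation F := (frA k L).

Lemma mono0 : mono k [::] = 1 :> F.
Proof.
have -> : (1 : F) = << mone >> by [].
by congr (mkmalgU _ _); apply/eqP; rewrite fmP fm1.
Qed.

Lemma frA_scalerAr c (u v : F) : u * (c *: v) = c *: (u * v).
Proof.
have ez (a b : k) z : a *: << b *g z >> = << a * b *g z >> :> F.
  apply/malgP => y; rewrite mcoeffZ mcoeffU [RHS]mcoeffU mulrnAr; exact: erefl.
elim/malg_ind: v c => [|a v w hv hw|y] c; first by rewrite scaler0 mulr0 scaler0.
  rewrite scalerDr scalerA mulrDr hv hw [in RHS]mulrDr [in RHS]hv [RHS]scalerDr [in RHS]scalerA.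
  exact: erefl.
elim/malg_ind: u => [|a u v hu hv|x]; first by rewrite mul0r mul0r scaler0.
  rewrite mulrDl hv -scalerAl hu [in RHS]mulrDl -[in RHS]scalerAl [RHS]scalerDr.
  rewrite scalerA [in RHS]scalerA mulrC; exact: erefl.
rewrite ez [LHS]fgmulUU [X in _ = _ *: X]fgmulUU ez mulr1 mulr1 mul1r mulr1; exact: erefl.
Qed.

End Words.

(** * Free modules on words *)

(* F : freemod k (seq L) plays the role of k<L> and FF : freemod k (seq L * seq L)
   that of its tensor square, with bases mo and pm, products ** and ten, and
   linear extensions lw and lww.  The interface replaces {malg k[_]}, whose
   elements unfold in conversion tests. *)
Record freemod (k : fieldType) (X : Type) := FreeMod {
  fm_mod :> lmodType k;
  fm_gen : X -> fm_mod;
  fm_ext : forall V : lmodType k, (X -> V) -> fm_mod -> V;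
  fm_ext_linear : forall (V : lmodType k) (f : X -> V), linear (fm_ext f);
  fm_extE : forall (V : lmodType k) (f : X -> V) x, fm_ext f (fm_gen x) = f x;
  fm_span : forall u, span (fun v => exists x, v = fm_gen x) u
}.

Arguments fm_mod : simpl never.
Arguments fm_gen : simpl never.
Arguments fm_ext : simpl never.

Section FreeMod.
Variables (k : fieldType) (X : Type) (F : freemod k X).

HB.instance Definition _ (V : lmodType k) (f : X -> V) :=
  GRing.isLinear.Build k F V _ (@fm_ext k X F V f) (fm_ext_linear f).

Lemma fm_linE (V : lmodType k) (f g : F -> V) : linear f -> linear g ->
  (forall x, f (fm_gen F x) = g (fm_gen F x)) -> f =1 g.
Proof.
move=> lf lg h u; elim: (fm_span u) => [|a _ v [x ->] _ hv].
  have z (j : F -> V) : linear j -> j 0 = 0.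
    by move=> lj; have := lj (-1) 0 0; rewrite scaler0 addr0 scaleN1r addNr.
  by rewrite !z.
by rewrite lf lg hv h.
Qed.

Lemma fm_lin_span (V : lmodType k) (S : V -> Prop) (f : F -> V) : linear f ->
  (forall x, span S (f (fm_gen F x))) -> forall u, span S (f u).
Proof.
move=> lf h u; move: u (fm_span u); apply: span_lin => // _ [x ->]; exact: h.
Qed.

End FreeMod.

Section Ops.
Variables (k : fieldType) (L : choiceType).
Variables (F : freemod k (seq L)) (FF : freemod k (seq L * seq L)).

Definition fmono (w : seq L) : F := fm_gen F w.
Definition fpmono (v w : seq L) : FF := fm_gen FF (v, w).
Notation mo := fmono.
Notation pm := fpmono.
Definition lw (V : lmodType k) (f : seq L -> V) (u : F) : V := fm_ext f u.
Definition lww (V : lmodType k) (f : seq L -> seq L -> V) (p : FF) : V :=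
  fm_ext (fun q => f q.1 q.2) p.
Definition mulF (u v : F) : F := lw (fun x => lw (fun y => mo (x ++ y)) v) u.
Definition ten (u v : F) : FF := lw (fun x => lw (pm x) v) u.
Definition mum (p : FF) : F := lww (fun v w => mo (v ++ w)) p.

HB.instance Definition _ (V : lmodType k) (f : seq L -> V) :=
  GRing.isLinear.Build k F V _ (@lw V f) (fm_ext_linear f).
HB.instance Definition _ (V : lmodType k) (f : seq L -> seq L -> V) :=
  GRing.isLinear.Build k FF V _ (@lww V f) (fm_ext_linear _).
HB.instance Definition _ := GRing.isLinear.Build k FF F _ mum (fm_ext_linear _).

Lemma lwE (V : lmodType k) (f : seq L -> V) w : lw f (mo w) = f w.
Proof. exact: fm_extE. Qed.
Lemma lwwE (V : lmodType k) (f : seq L -> seq L -> V) v w : lww f (pm v w) = f v w.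
Proof. exact: fm_extE. Qed.

Lemma frA_lin (V : lmodType k) (f g : F -> V) : linear f -> linear g ->
  (forall w, f (mo w) = g (mo w)) -> f =1 g.
Proof. exact: fm_linE. Qed.

Lemma frA_lin_span (V : lmodType k) (S : V -> Prop) (f : F -> V) : linear f ->
  (forall w, span S (f (mo w))) -> forall u, span S (f u).
Proof. exact: fm_lin_span. Qed.

Lemma frAA_lin (V : lmodType k) (f g : FF -> V) : linear f -> linear g ->
  (forall v w, f (pm v w) = g (pm v w)) -> f =1 g.
Proof. by move=> lf lg h; apply: fm_linE => // -[v w]; apply: h. Qed.

Lemma frAA_lin_span (V : lmodType k) (S : V -> Prop) (f : FF -> V) : linear f ->
  (forall v w, span S (f (pm v w))) -> forall u, span S (f u).
Proof. by move=> lf h; apply: fm_lin_span => // -[v w]; apply: h. Qed.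

Lemma lw_ext (V : lmodType k) (f g : seq L -> V) : f =1 g -> lw f =1 lw g.
Proof. by move=> h; apply: frA_lin => [||w]; rewrite ?lwE; try exact: linearP. Qed.

Lemma lww_ext (V : lmodType k) (f g : seq L -> seq L -> V) : f =2 g -> lww f =1 lww g.
Proof. by move=> h; apply: frAA_lin => [||v w]; rewrite ?lwwE; try exact: linearP. Qed.

Lemma lw_bil (V : lmodType k) (f : seq L -> seq L -> V) (u : F) :
  linear (fun v => lw (fun x => lw (f x) v) u).
Proof.
move=> a x y; move: u; apply: frA_lin => [||w]; last by rewrite !lwE linearP.
  exact: linearP.
by apply: linear_add; [apply: linear_scale|]; apply: linearP.
Qed.

HB.instance Definition _ u := GRing.isLinear.Build k F F _ (mulF u) (lw_bil _ u).
HB.instance Definition _ u := GRing.isLinear.Build k F FF _ (ten u) (lw_bil _ u).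

Lemma linear_mulF (V : lmodType k) (f : V -> F) u :
  linear f -> linear (fun x => mulF (f x) u).
Proof. by move=> lf a x y; rewrite lf; apply: linearP. Qed.

Lemma linear_ten (V : lmodType k) (f : V -> F) v :
  linear f -> linear (fun u => ten (f u) v).
Proof. by move=> lf a x y; rewrite lf; apply: linearP. Qed.

End Ops.
Arguments fmono : simpl never.
Arguments fpmono : simpl never.
Arguments lw : simpl never.
Arguments lww : simpl never.
Notation "u ** v" := (mulF u v) (at level 40, left associativity) : ring_scope.

Ltac lin :=
  match goal with
  | |- linear (fun x => x) => exact: linear_id
  | |- linear (fun x => 0) => exact: linear_0
  | |- linear (fun x => @?f x + @?g x) =>
    apply: (@linear_add _ _ _ f g); lin
  | |- linear (fun x => - @?f x) => apply: (@linear_opp _ _ _ f); lin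
  | |- linear (fun x => ?c *: @?f x) => apply: (@linear_scale _ _ _ c f); lin
  | |- linear (fun x => @?f x ** ?c) => apply: (@linear_mulF _ _ _ _ f c); lin
  | |- linear (fun x => ten _ (@?f x) ?c) => apply: (@linear_ten _ _ _ _ _ f c); lin
  | |- linear (fun x => \sum_(i <- _ | _) _) => apply: linear_bigsum => ?; lin
  | |- linear (fun x => ?g (@?f x)) =>
    apply: (@linear_comp _ _ _ _ _ f); lin
  | |- _ => exact: linear_linear
  end.

Section Words.
Variables (k : fieldType) (L : choiceType).
Variables (F : freemod k (seq L)) (FF : freemod k (seq L * seq L)).
Notation mo := (@fmono k L F).
Notation pm := (@fpmono k L FF).
Notation ten := (@ten k L F FF).
Notation mum := (@mum k L F FF).

Lemma moM v w : mo v ** mo w = mo (v ++ w).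
Proof. by rewrite /mulF !lwE. Qed.
Lemma mulFDl (u v w : F) : (u + v) ** w = u ** w + v ** w.
Proof. exact: linearD. Qed.
Lemma mulFZl c (u w : F) : (c *: u) ** w = c *: (u ** w).
Proof. exact: linearZ. Qed.
Lemma mulFDr (u v w : F) : w ** (u + v) = w ** u + w ** v.
Proof. exact: linearD. Qed.
Lemma mulFZr c (u w : F) : w ** (c *: u) = c *: (w ** u).
Proof. exact: linearZ. Qed.
Lemma mulFBr (u v w : F) : w ** (u - v) = w ** u - w ** v.
Proof. exact: linearB. Qed.
Lemma mulFBl (u v w : F) : (u - v) ** w = u ** w - v ** w.
Proof. by rewrite mulFDl -scaleN1r mulFZl scaleN1r. Qed.
Lemma mul0F (w : F) : 0 ** w = 0.
Proof. by rewrite -[X in X ** _](scale0r 0) mulFZl scale0r. Qed.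
Lemma mulF0 (w : F) : w ** 0 = 0.
Proof. exact: linear0. Qed.
Lemma mulF_suml I (r : seq I) (P : pred I) (f : I -> F) w :
  (\sum_(i <- r | P i) f i) ** w = \sum_(i <- r | P i) f i ** w.
Proof.
elim/big_ind2: _ => [|x1 x2 y1 y2 <- <-|//]; first exact: mul0F.
by rewrite mulFDl.
Qed.
Lemma mulF_sumr I (r : seq I) (P : pred I) (f : I -> F) w :
  w ** (\sum_(i <- r | P i) f i) = \sum_(i <- r | P i) w ** f i.
Proof. exact: linear_sum. Qed.

Lemma mulFA (u v w : F) : u ** (v ** w) = u ** v ** w.
Proof.
move: u; apply: frA_lin => [||x]; [by lin..|].
move: v; apply: frA_lin => [||y]; [by lin..|].
move: w; apply: frA_lin => [||z]; [by lin..|].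
by rewrite !moM catA.
Qed.
Lemma mul1F (u : F) : mo [::] ** u = u.
Proof. by move: u; apply: frA_lin => [||x]; [by lin..|rewrite moM]. Qed.
Lemma mulF1 (u : F) : u ** mo [::] = u.
Proof. by move: u; apply: frA_lin => [||x]; [by lin..|rewrite moM cats0]. Qed.
Lemma mo_cons (a : L) w : mo (a :: w) = mo [:: a] ** mo w.
Proof. by rewrite moM. Qed.
Lemma ten_mo v w : ten (mo v) (mo w) = pm v w :> FF.
Proof. by rewrite /ten !lwE. Qed.
Lemma tenDl u v w : ten (u + v) w = ten u w + ten v w.
Proof. exact: linearD. Qed.
Lemma tenZl c u w : ten (c *: u) w = c *: ten u w.
Proof. exact: linearZ. Qed.
Lemma tenBl u v w : ten (u - v) w = ten u w - ten v w.
Proof. exact: linearB. Qed.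
Lemma ten0l w : ten 0 w = 0.
Proof. exact: linear0. Qed.
Lemma ten_suml I (r : seq I) (P : pred I) (f : I -> F) w :
  ten (\sum_(i <- r | P i) f i) w = \sum_(i <- r | P i) ten (f i) w.
Proof. exact: linear_sum. Qed.
Lemma tenDr u v w : ten w (u + v) = ten w u + ten w v.
Proof. exact: linearD. Qed.
Lemma tenBr u v w : ten w (u - v) = ten w u - ten w v.
Proof. exact: linearB. Qed.
Lemma tenZr c u w : ten w (c *: u) = c *: ten w u.
Proof. exact: linearZ. Qed.

Lemma mum_pm (v w : seq L) : mum (pm v w) = mo (v ++ w).
Proof. exact: lwwE. Qed.

Lemma mum_ten (u v : F) : mum (ten u v) = u ** v.
Proof.
move: u; apply: frA_lin => [||w]; [by lin..|].
move: v; apply: frA_lin => [||w']; [by lin..|].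
by rewrite ten_mo mum_pm moM.
Qed.

Section Ideal.
Variable S : F -> Prop.

Definition idl : F -> Prop :=
  span (fun u => exists w s w', S s /\ u = mo w ** s ** mo w').

Lemma idl_gen s : S s -> idl s.
Proof.
by move=> Ss; apply: span_gen; exists [::], s, [::]; rewrite mul1F mulF1.
Qed.

Lemma idl_mull v u : idl u -> idl (v ** u).
Proof.
move=> Su; move: v; apply: frA_lin_span => [|v]; first by lin.
move: u Su; apply: span_lin => [|_ [w [s [w' [Ss ->]]]]]; first by lin.
by apply: span_gen; exists (v ++ w), s, w'; rewrite !mulFA moM.
Qed.

Lemma idl_mulr v u : idl u -> idl (u ** v).
Proof.
move=> Su; move: v; apply: frA_lin_span => [|v]; first by lin.
move: u Su; apply: span_lin => [|_ [w [s [w' [Ss ->]]]]]; first by lin.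
by apply: span_gen; exists w, s, (w' ++ v); rewrite -!mulFA moM.
Qed.

Lemma idl_lin (V : lmodType k) (T : V -> Prop) (f : F -> V) : linear f ->
  (forall w s w', S s -> span T (f (mo w ** s ** mo w'))) ->
  forall u, idl u -> span T (f u).
Proof. by move=> lf h; apply: span_lin => // _ [w [s [w' [Ss ->]]]]; apply: h. Qed.

(** With I the ideal generated by S, this is the kernel of F (x) F -> (F/I) (x) (F/I). *)
Definition tidl : FF -> Prop :=
  span (fun p => exists u v, (idl u \/ idl v) /\ p = ten u v).

Lemma tidl_l u v : idl u -> tidl (ten u v).
Proof. by move=> Su; apply: span_gen; exists u, v; split=> //; left. Qed.

Lemma tidl_r u v : idl v -> tidl (ten u v).
Proof. by move=> Su; apply: span_gen; exists u, v; split=> //; right. Qed.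

Lemma tidl_lin (V : lmodType k) (T : V -> Prop) (f : FF -> V) : linear f ->
  (forall u v, idl u -> span T (f (ten u v))) ->
  (forall u v, idl v -> span T (f (ten u v))) ->
  forall p, tidl p -> span T (f p).
Proof.
by move=> lf hl hr; apply: span_lin => // _ [u [v [[uv|uv] ->]]];
  [apply: hl|apply: hr].
Qed.
End Ideal.

Section Degree.
Variable dg : L -> int.
Notation wdeg := (wdeg dg).

Lemma wdeg_nil : wdeg [::] = 0. Proof. exact: big_nil. Qed.
Lemma wdeg_cons a w : wdeg (a :: w) = dg a + wdeg w. Proof. exact: big_cons. Qed.
Lemma wdeg_seq1 a : wdeg [:: a] = dg a. Proof. exact: big_seq1. Qed.
Lemma wdeg_cat v w : wdeg (v ++ w) = wdeg v + wdeg w. Proof. exact: big_cat. Qed.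

Definition isdeg (i : int) : F -> Prop := span (fun u => exists2 w, wdeg w = i & u = mo w).
Definition isdegT (i : int) : FF -> Prop :=
  span (fun p => exists v w, wdeg v + wdeg w = i /\ p = pm v w).

Lemma isdeg_mo w : isdeg (wdeg w) (mo w).
Proof. by apply: span_gen; exists w. Qed.

Lemma isdeg_letter a : isdeg (dg a) (mo [:: a]).
Proof. by rewrite -wdeg_seq1; apply: isdeg_mo. Qed.

Lemma isdegT_pm v w : isdegT (wdeg v + wdeg w) (pm v w).
Proof. by apply: span_gen; exists v, w. Qed.

Lemma isdeg_lin_span i (V : lmodType k) (S : V -> Prop) (f : F -> V) : linear f ->
  (forall w, wdeg w = i -> span S (f (mo w))) ->
  forall u, isdeg i u -> span S (f u).
Proof. by move=> lf h; apply: span_lin => // _ [w wi ->]; apply: h. Qed.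

Lemma isdeg_lin i (V : lmodType k) (f g : F -> V) : linear f -> linear g ->
  (forall w, wdeg w = i -> f (mo w) = g (mo w)) ->
  forall u, isdeg i u -> f u = g u.
Proof.
move=> lf lg h u; elim=> [|a _ v [w wi ->] _ hv]; last by rewrite lf lg hv h.
have z (j : F -> V) : linear j -> j 0 = 0.
  by move=> lj; have := lj (-1) 0 0; rewrite scaler0 addr0 scaleN1r addNr.
by rewrite !z.
Qed.

Lemma isdegT_lin_span i (V : lmodType k) (S : V -> Prop) (f : FF -> V) : linear f ->
  (forall v w, wdeg v + wdeg w = i -> span S (f (pm v w))) ->
  forall p, isdegT i p -> span S (f p).
Proof. by move=> lf h; apply: span_lin => // _ [v [w [vw ->]]]; apply: h. Qed.

Lemma isdegM i j u v : isdeg i u -> isdeg j v -> isdeg (i + j) (u ** v).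
Proof.
move=> hu hv; move: u hu; apply: isdeg_lin_span => [|w <-]; first by lin.
move: v hv; apply: isdeg_lin_span => [|w' <-]; first by lin.
by rewrite moM -wdeg_cat; apply: isdeg_mo.
Qed.

Lemma isdegT_ten i j u v : isdeg i u -> isdeg j v -> isdegT (i + j) (ten u v).
Proof.
move=> hu hv; move: u hu; apply: isdeg_lin_span => [|w <-]; first by lin.
move: v hv; apply: isdeg_lin_span => [|w' <-]; first by lin.
by rewrite ten_mo; apply: isdegT_pm.
Qed.

(** This automorphism absorbs the sign of a derivation of degree c: the rule [gderM] becomes linear
    in both factors and holds without any homogeneity assumption. It preserves an ideal as soon as
    the generators are homogeneous, whence [graded_gen]. *)
Definition sgm (c : int) (u : F) : F := lw (fun w => sg k (c * wdeg w) *: mo w) u.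
HB.instance Definition _ c := GRing.isLinear.Build k F F _ (sgm c) (fm_ext_linear _).

Lemma sgmZ c a u : sgm c (a *: u) = a *: sgm c u. Proof. exact: linearZ. Qed.

Lemma sgm_mo c w : sgm c (mo w) = sg k (c * wdeg w) *: mo w.
Proof. exact: lwE. Qed.

Lemma sgm_isdeg c i u : isdeg i u -> sgm c u = sg k (c * i) *: u.
Proof. by move: u; apply: isdeg_lin => [||w <-]; [by lin..|rewrite sgm_mo]. Qed.

Lemma sgm_letter c a : sgm c (mo [:: a]) = sg k (c * dg a) *: mo [:: a].
Proof. exact: sgm_isdeg (isdeg_letter a). Qed.

Lemma sgmM c u v : sgm c (u ** v) = sgm c u ** sgm c v.
Proof.
move: u; apply: frA_lin => [||w]; [by lin..|].
move: v; apply: frA_lin => [||w']; [by lin..|].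
rewrite moM !sgm_mo mulFZl mulFZr scalerA moM.
by rewrite wdeg_cat; congr (_ *: _); sgring.
Qed.

Definition graded_gen (S : F -> Prop) := forall s, S s -> exists i, isdeg i s.

Lemma sgm_idl (S : F -> Prop) c : graded_gen S ->
  forall u, idl S u -> idl S (sgm c u).
Proof.
move=> hS; apply: idl_lin => [|w s w' Ss]; first by lin.
rewrite !sgmM; apply/idl_mulr/idl_mull.
by case: (hS _ Ss) => i /sgm_isdeg ->; apply/spanZ/idl_gen.
Qed.

Section Derivation.
Variables (e : int) (f : L -> F).

Fixpoint gderw (w : seq L) : F :=
  if w is a :: r then f a ** mo r + sg k (e * dg a) *: (mo [:: a] ** gderw r)
  else 0.

Definition gder (u : F) : F := lw gderw u.
HB.instance Definition _ := GRing.isLinear.Build k F F _ gder (fm_ext_linear _).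

Lemma gder_mo w : gder (mo w) = gderw w.
Proof. exact: lwE. Qed.

Lemma gderD u v : gder (u + v) = gder u + gder v. Proof. exact: linearD. Qed.
Lemma gderN u : gder (- u) = - gder u. Proof. exact: linearN. Qed.
Lemma gderZ c u : gder (c *: u) = c *: gder u. Proof. exact: linearZ. Qed.

Lemma gder1 : gder (mo [::]) = 0.
Proof. by rewrite gder_mo. Qed.

Lemma gder_letter a : gder (mo [:: a]) = f a.
Proof. by rewrite gder_mo /= mulF0 scaler0 addr0 mulF1. Qed.

Lemma gderM u v : gder (u ** v) = gder u ** v + sgm e u ** gder v.
Proof.
move: u; apply: frA_lin => [||w]; [by lin..|].
elim: w => [|a w IH].
  by rewrite gder1 sgm_mo wdeg_nil mulr0 scale1r !mul1F mul0F add0r.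
have E x : gder (mo [:: a] ** x) = f a ** x + sg k (e * dg a) *: (mo [:: a] ** gder x).
  move: x; apply: frA_lin => [||x]; [by lin..|].
  by rewrite moM !gder_mo.
rewrite mo_cons -mulFA !E IH sgmM sgm_letter.
by rewrite mulFDl mulFDr scalerDr !mulFZl !mulFA addrA.
Qed.

Lemma gder_isdeg i u : (forall a, isdeg (e + dg a) (f a)) ->
  isdeg i u -> isdeg (e + i) (gder u).
Proof.
move=> hf; move: u; apply: isdeg_lin_span => [|w <-]; first by lin.
elim: w => [|a w IH]; first by rewrite gder1; apply: span0.
rewrite mo_cons gderM gder_letter sgm_letter mulFZl wdeg_cons.
apply: spanD; first by rewrite addrA; apply: isdegM (isdeg_mo w).
by apply: spanZ; rewrite addrCA; apply: isdegM (isdeg_letter a) IH.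
Qed.

Lemma gder_idl (S : F -> Prop) : graded_gen S ->
  (forall s, S s -> idl S (gder s)) -> forall u, idl S u -> idl S (gder u).
Proof.
move=> hS dS; apply: idl_lin => [|w s w' Ss]; first by lin.
have iS := idl_gen Ss.
rewrite !gderM mulFDl -!addrA; apply: spanD.
  exact/idl_mulr/idl_mull.
apply: spanD; first exact/idl_mulr/idl_mull/dS.
by rewrite sgmM; apply/idl_mulr/idl_mull/sgm_idl.
Qed.

Definition gderT (p : FF) : FF :=
  lww (fun v w => ten (gderw v) (mo w) + sg k (e * wdeg v) *: ten (mo v) (gderw w)) p.
HB.instance Definition _ := GRing.isLinear.Build k FF FF _ gderT (fm_ext_linear _).

Lemma gderTD p q : gderT (p + q) = gderT p + gderT q. Proof. exact: linearD. Qed.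
Lemma gderTN p : gderT (- p) = - gderT p. Proof. exact: linearN. Qed.
Lemma gderTZ c p : gderT (c *: p) = c *: gderT p. Proof. exact: linearZ. Qed.

Lemma gderT_pm v w : gderT (pm v w) =
  ten (gderw v) (mo w) + sg k (e * wdeg v) *: ten (mo v) (gderw w).
Proof. exact: lwwE. Qed.

Lemma gderT_ten u v : gderT (ten u v) = ten (gder u) v + ten (sgm e u) (gder v).
Proof.
move: u; apply: frA_lin => [||w]; [by lin..|].
move: v; apply: frA_lin => [||w']; [by lin..|].
by rewrite ten_mo gderT_pm !gder_mo sgm_mo tenZl.
Qed.

Lemma gderT_tidl (S : F -> Prop) : graded_gen S ->
  (forall s, S s -> idl S (gder s)) -> forall p, tidl S p -> tidl S (gderT p).
Proof.
move=> hS dS; apply: tidl_lin => [|u v h|u v h]; first by lin.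
  rewrite gderT_ten; apply: spanD; first exact/tidl_l/gder_idl.
  exact/tidl_l/sgm_idl.
rewrite gderT_ten; apply: spanD; first exact: tidl_r.
exact/tidl_r/gder_idl.
Qed.

Lemma mum_gderT p : mum (gderT p) = gder (mum p).
Proof.
move: p; apply: frAA_lin => [||v w]; [by lin..|].
by rewrite -ten_mo gderT_ten linearD /= !mum_ten gderM.
Qed.
End Derivation.

Lemma gderwB e f g w : gderw e (fun a => f a - g a) w = gderw e f w - gderw e g w.
Proof.
elim: w => [|a w IH] /=; first by rewrite subrr.
by rewrite IH mulFBr mulFBl scalerBr opprD addrACA.
Qed.

Lemma gder_id e f (S : F -> Prop) u : (forall a, idl S (f a)) -> idl S (gder e f u).
Proof.
move=> hf; move: u; apply: frA_lin_span => [|w]; first by lin.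
rewrite gder_mo; elim: w => [|a w IH]; first exact: span0.
by apply: spanD; [apply: idl_mulr|apply/spanZ/idl_mull].
Qed.

Lemma gder_congr e f g (S : F -> Prop) u : (forall a, idl S (f a - g a)) ->
  idl S (gder e f u - gder e g u).
Proof.
move=> h; suff -> : gder e f u - gder e g u = gder e (fun a => f a - g a) u.
  exact: gder_id.
move: u; apply: frA_lin => [||w]; [by lin..|].
by rewrite !gder_mo gderwB.
Qed.

Lemma gderT_congr e f g (S : F -> Prop) p : (forall a, idl S (f a - g a)) ->
  tidl S (gderT e f p - gderT e g p).
Proof.
move=> h; move: p; apply: frAA_lin_span => [|v w]; first by lin.
rewrite -ten_mo !gderT_ten opprD addrACA; apply: spanD.
  by rewrite -tenBl; apply/tidl_l/gder_congr.
by rewrite -linearB; apply/tidl_r/gder_congr.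
Qed.

Section Commutator.
Variables (e1 e2 : int) (f1 f2 f3 : L -> F) (S : F -> Prop).
Hypothesis h1 : forall a, isdeg (e1 + dg a) (f1 a).
Hypothesis h2 : forall a, isdeg (e2 + dg a) (f2 a).
Hypothesis h : forall a, idl S (gder e1 f1 (f2 a)
  - sg k (e1 * e2) *: gder e2 f2 (f1 a) - f3 a).

(** A graded commutator of derivations is a derivation, so congruence on letters propagates to all
    words. The case of interest is [d] against {v, -}, where [f3] gives {d v, -}. *)
Lemma gder_comm u : idl S (gder e1 f1 (gder e2 f2 u)
  - sg k (e1 * e2) *: gder e2 f2 (gder e1 f1 u) - gder (e1 + e2) f3 u).
Proof.
move: u; apply: frA_lin_span => [|w]; first by lin.
elim: w => [|a w IH]; first by rewrite !gder1 ?linear0 ?scaler0 ?subr0 ?addr0; apply: span0.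
rewrite mo_cons !gderM !gder_letter !sgm_letter !mulFZl !gderD !gderZ !gderM.
rewrite !gder_letter (sgm_isdeg _ (h1 a)) (sgm_isdeg _ (h2 a)) !sgm_letter !mulFZl.
apply: (@span_eq _ _ _ ((gder e1 f1 (f2 a) - sg k (e1 * e2) *: gder e2 f2 (f1 a) - f3 a) ** mo w
  + sg k ((e1 + e2) * dg a) *: (mo [:: a] ** (gder e1 f1 (gder e2 f2 (mo w))
    - sg k (e1 * e2) *: gder e2 f2 (gder e1 f1 (mo w)) - gder (e1 + e2) f3 (mo w))))).
  by rewrite !(mulFBl, mulFBr, mulFZl, mulFZr); lmod k; sgring.
by apply: spanD; [apply/idl_mulr/h|apply/spanZ/idl_mull].
Qed.

Lemma gderT_comm p : tidl S (gderT e1 f1 (gderT e2 f2 p)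
  - sg k (e1 * e2) *: gderT e2 f2 (gderT e1 f1 p) - gderT (e1 + e2) f3 p).
Proof.
move: p; apply: frAA_lin_span => [|v w]; first by lin.
rewrite -ten_mo !gderT_ten !gderTD !gderT_ten.
rewrite !(sgm_isdeg _ (gder_isdeg h1 (isdeg_mo v))) !(sgm_isdeg _ (gder_isdeg h2 (isdeg_mo v))).
rewrite !sgm_mo !tenZl !gderZ !tenZl.
apply: (@span_eq _ _ _ (ten (gder e1 f1 (gder e2 f2 (mo v))
     - sg k (e1 * e2) *: gder e2 f2 (gder e1 f1 (mo v)) - gder (e1 + e2) f3 (mo v)) (mo w)
  + sg k ((e1 + e2) * wdeg v) *: ten (mo v) (gder e1 f1 (gder e2 f2 (mo w))
    - sg k (e1 * e2) *: gder e2 f2 (gder e1 f1 (mo w)) - gder (e1 + e2) f3 (mo w)))).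
  by rewrite !(sgmZ, sgm_mo, tenBl, tenBr, tenZl, tenZr); lmod k; sgring.
by apply: spanD; [apply/tidl_l/gder_comm|apply/spanZ/tidl_r/gder_comm].
Qed.
End Commutator.
End Degree.
End Words.

(** * Families of derivations *)

(* op u x is the bracket {u, x} for which {v, -} is the derivation of degree
   |v| + N with values phi v on letters; opT is its action on the tensor square. *)
Section Operators.
Variables (k : fieldType) (L L' : choiceType) (dg : L -> int) (dg' : L' -> int).
Variables (F : freemod k (seq L)).
Variables (F' : freemod k (seq L')) (FF' : freemod k (seq L' * seq L')).
Variables (N : int) (phi : seq L -> L' -> F').
Notation wdeg := (Defs.wdeg dg).
Notation wdeg' := (Defs.wdeg dg').
Hypothesis phi_hom : forall v a, isdeg dg' (wdeg v + N + dg' a) (phi v a).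

Definition phiF (u : F) (a : L') : F' := lw (phi^~ a) u.
Definition op (u : F) (x : F') : F' :=
  lw (fun v => gder dg' (wdeg v + N) (phi v) x) u.
Definition opT (u : F) (p : FF') : FF' :=
  lw (fun v => gderT dg' (wdeg v + N) (phi v) p) u.

Lemma op_mo v x : op (fmono F v) x = gder dg' (wdeg v + N) (phi v) x.
Proof. exact: lwE. Qed.
Lemma opT_mo v p : opT (fmono F v) p = gderT dg' (wdeg v + N) (phi v) p.
Proof. exact: lwE. Qed.
Lemma phiF_mo v a : phiF (fmono F v) a = phi v a.
Proof. exact: lwE. Qed.

Lemma op_linear u : linear (op u).
Proof.
move=> a x y; move: u; apply: frA_lin => [||w]; [exact: linearP| |].
  by apply: linear_add; [apply: linear_scale|]; apply: linearP.
by rewrite !op_mo linearP.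
Qed.
HB.instance Definition _ u := GRing.isLinear.Build k F' F' _ (op u) (op_linear u).

Lemma opT_linear u : linear (opT u).
Proof.
move=> a x y; move: u; apply: frA_lin => [||w]; [exact: linearP| |].
  by apply: linear_add; [apply: linear_scale|]; apply: linearP.
by rewrite !opT_mo linearP.
Qed.
HB.instance Definition _ u := GRing.isLinear.Build k FF' FF' _ (opT u) (opT_linear u).

Lemma opl_linear x : linear (op^~ x). Proof. exact: linearP. Qed.
Lemma opTl_linear p : linear (opT^~ p). Proof. exact: linearP. Qed.
Lemma phiF_linear a : linear (phiF^~ a). Proof. exact: linearP. Qed.

Lemma phiF0 a : phiF 0 a = 0. Proof. exact: linear0. Qed.
Lemma phiFD u v a : phiF (u + v) a = phiF u a + phiF v a. Proof. exact: linearD. Qed.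
Lemma phiFZ c u a : phiF (c *: u) a = c *: phiF u a. Proof. exact: linearZ. Qed.
Lemma phiF_sum I (r : seq I) (P : pred I) (f : I -> F) a :
  phiF (\sum_(i <- r | P i) f i) a = \sum_(i <- r | P i) phiF (f i) a.
Proof. exact: linear_sum. Qed.
Lemma linear_phiF (V : lmodType k) (g : V -> F) a :
  linear g -> linear (fun x => phiF (g x) a).
Proof. by move=> lg c x y; rewrite lg phiFD phiFZ. Qed.
Lemma linear_op (V : lmodType k) (g : V -> F) x :
  linear g -> linear (fun u => op (g u) x).
Proof. by move=> lg c u v; rewrite lg; apply: opl_linear. Qed.
Lemma linear_opT (V : lmodType k) (g : V -> F) p :
  linear g -> linear (fun u => opT (g u) p).
Proof. by move=> lg c u v; rewrite lg; apply: opTl_linear. Qed.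

Lemma opDl u v x : op (u + v) x = op u x + op v x. Proof. exact: linearD. Qed.
Lemma opZl c u x : op (c *: u) x = c *: op u x. Proof. exact: linearZ. Qed.

Lemma opTZl c u p : opT (c *: u) p = c *: opT u p. Proof. exact: linearZ. Qed.

Lemma gderw_funl e w : linear (fun u => gderw dg' e (phiF u) w).
Proof.
elim: w => [|a w IH] /=; first exact: linear_0.
apply: linear_add; first by apply: linear_mulF; apply: phiF_linear.
by apply: linear_scale; apply: linear_comp.
Qed.

(** For homogeneous [u] all words of [u] contribute derivations of the same degree, and these add up
    to a single derivation. *)
Lemma op_hom i u x : isdeg dg i u -> op u x = gder dg' (i + N) (phiF u) x.
Proof.
move=> hu; move: x; apply: frA_lin => [||w]; [by lin..|].
move: u hu; apply: isdeg_lin => [||v vi].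
- exact: opl_linear.
- by move=> a x y; rewrite !gder_mo gderw_funl.
rewrite op_mo vi !gder_mo; elim: w => //= a w ->; by rewrite phiF_mo.
Qed.

Lemma opT_hom i u p : isdeg dg i u -> opT u p = gderT dg' (i + N) (phiF u) p.
Proof.
move=> hu; move: p; apply: frAA_lin => [||v w]; [by lin..|].
rewrite gderT_pm; have E x : gderw dg' (i + N) (phiF u) x = op u (fmono F' x).
  by rewrite (op_hom _ hu) gder_mo.
rewrite !E; move: u hu {E}; apply: isdeg_lin => [||x xi].
- exact: opTl_linear.
- by apply: linear_add; [apply: linear_ten|apply: linear_scale; apply: linear_comp];
    apply: opl_linear.
by rewrite opT_mo xi gderT_pm !op_mo !gder_mo xi.
Qed.

Lemma phiF_hom i u a : isdeg dg i u -> isdeg dg' (i + N + dg' a) (phiF u a).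
Proof.
move: u; apply: isdeg_lin_span => [|w <-]; first exact: phiF_linear.
rewrite phiF_mo; exact: phi_hom.
Qed.

Lemma op_isdeg i j u x : isdeg dg i u -> isdeg dg' j x -> isdeg dg' (i + j + N) (op u x).
Proof.
move=> hu hx; rewrite (op_hom _ hu) addrAC; apply: gder_isdeg hx => a.
exact: phiF_hom.
Qed.

Lemma opT_isdegT i j u p : isdeg dg i u -> isdegT dg' j p ->
  isdegT dg' (i + j + N) (opT u p).
Proof.
move=> hu; move: p; apply: isdegT_lin_span => [|v w <-]; first exact: opT_linear.
rewrite (opT_hom _ hu) -(ten_mo F') gderT_ten sgm_mo tenZl.
have h x : isdeg dg' (i + N + wdeg' x) (gder dg' (i + N) (phiF u) (fmono F' x)).
  by apply: gder_isdeg (isdeg_mo _ _ x) => a; apply: phiF_hom.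
have -> : i + (wdeg' v + wdeg' w) + N = (i + N + wdeg' v) + wdeg' w by ring.
apply: spanD; first exact: isdegT_ten (h v) (isdeg_mo _ _ w).
have -> : (i + N + wdeg' v) + wdeg' w = wdeg' v + (i + N + wdeg' w) by ring.
apply: spanZ; exact: isdegT_ten (isdeg_mo _ _ v) (h w).
Qed.

Section Ideal.
Variable S : F' -> Prop.
Hypothesis S_graded : graded_gen dg' S.

Lemma op_rel i u x : isdeg dg i u -> (forall a, idl S (phiF u a)) -> idl S (op u x).
Proof. by move=> hu h; rewrite (op_hom _ hu); apply: gder_id. Qed.

Lemma opT_rel i u (p : FF') : isdeg dg i u -> (forall a, idl S (phiF u a)) ->
  tidl S (opT u p).
Proof.
move=> hu h; rewrite (opT_hom _ hu); move: p; apply: frAA_lin_span => [|v w].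
  exact: linearP.
rewrite -(ten_mo F') gderT_ten; apply: spanD; first exact/tidl_l/gder_id.
exact/tidl_r/gder_id.
Qed.

Hypothesis phi_S : forall v s, S s -> idl S (gder dg' (wdeg v + N) (phi v) s).

Lemma op_idl u x : idl S x -> idl S (op u x).
Proof.
move=> hx; move: u; apply: frA_lin_span => [|w]; first exact: opl_linear.
rewrite op_mo; exact: (gder_idl S_graded (phi_S w)).
Qed.

Variables (d : F -> F) (delta : L' -> F').
Hypothesis d_lin : linear d.
Hypothesis d_hom : forall w, isdeg dg (wdeg w - 1) (d (fmono F w)).
Hypothesis delta_hom : forall a, isdeg dg' (-1 + dg' a) (delta a).
Notation d' := (gder dg' (-1) delta).
Notation dT' := (gderT dg' (-1) delta).
Hypothesis phi_d : forall v a,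
  idl S (d' (phi v a) - (phiF (d (fmono F v)) a
    + sg k (wdeg v + N) *: gder dg' (wdeg v + N) (phi v) (delta a))).

(** The Koszul sign for moving the differential past the operator {u, -}, whose degree is |u| + N.
    It is the involution [t] of the passage to homology. *)
Definition twist (u : F) : F := lw (fun w => sg k (wdeg w + N) *: fmono F w) u.
HB.instance Definition _ := GRing.isLinear.Build k F F _ twist (fm_ext_linear _).

Lemma twist_mo w : twist (fmono F w) = sg k (wdeg w + N) *: fmono F w.
Proof. exact: lwE. Qed.

Let comm v a : idl S (gder dg' (-1) delta (phi v a)
  - sg k (-1 * (wdeg v + N)) *: gder dg' (wdeg v + N) (phi v) (delta a)
  - phiF (d (fmono F v)) a).
Proof.
apply: span_eq (phi_d v a); rewrite opprD addrA addrAC; congr (_ - _ *: _ - _).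
by rewrite mulN1r sgN.
Qed.

Lemma op_d u x : idl S (d' (op u x) - (op (d u) x + op (twist u) (d' x))).
Proof.
move: u; apply: frA_lin_span => [|w].
  apply: linear_add; first by apply: linear_comp; apply: opl_linear.
  apply: linear_opp; apply: linear_add => a y z.
    by rewrite d_lin opDl opZl.
  by rewrite linearP opDl opZl.
have := gder_comm delta_hom (phi_hom w) (comm w) x.
apply: span_eq; rewrite op_mo (op_hom _ (d_hom w)) twist_mo opZl op_mo.
have -> : -1 + (wdeg w + N) = wdeg w - 1 + N by ring.
by rewrite mulN1r sgN; lmod k; ring.
Qed.

Lemma opT_d u p : tidl S (dT' (opT u p) - (opT (d u) p + opT (twist u) (dT' p))).
Proof.
move: u; apply: frA_lin_span => [|w].
  apply: linear_add; first by apply: linear_comp; apply: opTl_linear.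
  apply: linear_opp; apply: linear_add => a y z.
    by rewrite d_lin opTl_linear.
  by rewrite linearP opTl_linear.
have := gderT_comm delta_hom (phi_hom w) (comm w) p.
apply: span_eq; rewrite opT_mo (opT_hom _ (d_hom w)) twist_mo.
rewrite opTZl opT_mo.
have -> : -1 + (wdeg w + N) = wdeg w - 1 + N by ring.
by rewrite mulN1r sgN; lmod k; ring.
Qed.
End Ideal.

End Operators.

(** * Sums over the positions of a word *)

Section Splits.
Variables (k : fieldType) (L : choiceType) (V : lmodType k).

(** The sum over all factorisations v = P ++ a :: Q, in a form suited to induction on v, unlike a
    sum over ordinals. *)
Fixpoint splits (v : seq L) (f : seq L -> L -> seq L -> V) : V :=
  if v is a :: r then f [::] a r + splits r (fun P => f (a :: P)) else 0.

Lemma eq_splits v f g : (forall P a Q, v = P ++ a :: Q -> f P a Q = g P a Q) ->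
  splits v f = splits v g.
Proof.
elim: v f g => //= a r IH f g h; rewrite h //; congr (_ + _).
by apply: IH => P b Q e; apply: h; rewrite e.
Qed.

Lemma splits_span (S : V -> Prop) v f :
  (forall P a Q, v = P ++ a :: Q -> span S (f P a Q)) -> span S (splits v f).
Proof.
elim: v f => [|a r IH] f h /=; first exact: span0.
by apply: spanD; [apply: h|apply: IH => P b Q e; apply: h; rewrite e].
Qed.

Lemma splitsD v f g : splits v (fun P a Q => f P a Q + g P a Q) = splits v f + splits v g.
Proof. by elim: v f g => [|a r IH] f g /=; rewrite ?addr0 // IH addrACA. Qed.
Lemma splitsZ v c f : splits v (fun P a Q => c *: f P a Q) = c *: splits v f.
Proof. by elim: v f => [|a r IH] f /=; rewrite ?scaler0 // IH scalerDr. Qed.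

Lemma splits_sum I (s : seq I) v f :
  splits v (fun P a Q => \sum_(i <- s) f i P a Q) = \sum_(i <- s) splits v (f i).
Proof.
elim: v f => [|a r IH] f /=; first by rewrite big1.
by rewrite IH -big_split.
Qed.

End Splits.

Lemma splits_lin (k : fieldType) (L : choiceType) (V W : lmodType k) (h : V -> W)
    (v : seq L) f : linear h ->
  h (splits v f) = splits v (fun P a Q => h (f P a Q)).
Proof.
move=> lh; elim: v f => [|a r IH] f /=.
  by have := lh (-1) 0 0; rewrite scaler0 addr0 scaleN1r addNr.
by have := lh 1 (f [::] a r); rewrite !scale1r => ->; rewrite IH.
Qed.

(** * Outer multiplications on the tensor square and its cyclic closure *)

Section Contract.
Variables (k : fieldType) (L : choiceType) (dg : L -> int).
Variables (F : freemod k (seq L)) (FF : freemod k (seq L * seq L)).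
Notation mo := (@fmono k L F).
Notation pm := (@fpmono k L FF).
Notation ten := (@ten k L F FF).
Notation wdeg := (Defs.wdeg dg).

Definition lml (u : F) (p : FF) : FF := lww (fun v w => ten (u ** mo v) (mo w)) p.
Definition rml (u : F) (p : FF) : FF := lww (fun v w => ten (mo v) (mo w ** u)) p.
HB.instance Definition _ u := GRing.isLinear.Build k FF FF _ (lml u) (fm_ext_linear _).
HB.instance Definition _ u := GRing.isLinear.Build k FF FF _ (rml u) (fm_ext_linear _).

Lemma lml_ten u x y : lml u (ten x y) = ten (u ** x) y.
Proof.
move: x; apply: frA_lin => [||v]; [by lin..|].
move: y; apply: frA_lin => [||w]; [by lin..|].
by rewrite ten_mo /lml lwwE.
Qed.
Lemma rml_ten u x y : rml u (ten x y) = ten x (y ** u).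
Proof.
move: x; apply: frA_lin => [||v]; [by lin..|].
move: y; apply: frA_lin => [||w]; [by lin..|].
by rewrite ten_mo /rml lwwE.
Qed.
Lemma lml_linear p : linear (lml^~ p).
Proof.
move: p => p a x y; move: p; apply: frAA_lin => [||v w]; [by lin..|].
by rewrite -(ten_mo F) !lml_ten mulFDl mulFZl tenDl tenZl.
Qed.
Lemma rml_linear p : linear (rml^~ p).
Proof.
move: p => p a x y; move: p; apply: frAA_lin => [||v w]; [by lin..|].
by rewrite -(ten_mo F) !rml_ten mulFDr mulFZr tenDr tenZr.
Qed.
Lemma lml_pm v x y : lml (mo v) (pm x y) = pm (v ++ x) y.
Proof. by rewrite -(ten_mo F) lml_ten moM ten_mo. Qed.
Lemma rml_pm v x y : rml (mo v) (pm x y) = pm x (y ++ v).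
Proof. by rewrite -(ten_mo F) rml_ten moM ten_mo. Qed.
Lemma lml1 p : lml (mo [::]) p = p.
Proof. by move: p; apply: frAA_lin => [||x y]; [by lin..|rewrite lml_pm]. Qed.
Lemma lmlM u v p : lml (u ** v) p = lml u (lml v p).
Proof.
move: p; apply: frAA_lin => [||x y]; [by lin..|].
by rewrite -(ten_mo F) !lml_ten mulFA.
Qed.
Lemma lml_rml u v p : lml u (rml v p) = rml v (lml u p).
Proof.
move: p; apply: frAA_lin => [||x y]; [by lin..|].
by rewrite -(ten_mo F) !(lml_ten, rml_ten).
Qed.
Lemma lmlD u p q : lml u (p + q) = lml u p + lml u q. Proof. exact: linearD. Qed.
Lemma lmlN u p : lml u (- p) = - lml u p. Proof. exact: linearN. Qed.
Lemma rmlN u p : rml u (- p) = - rml u p. Proof. exact: linearN. Qed.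
Lemma lmlZ c u p : lml u (c *: p) = c *: lml u p. Proof. exact: linearZ. Qed.
Lemma rmlD u p q : rml u (p + q) = rml u p + rml u q. Proof. exact: linearD. Qed.
Lemma rmlZ c u p : rml u (c *: p) = c *: rml u p. Proof. exact: linearZ. Qed.
Lemma lmlZl c u p : lml (c *: u) p = c *: lml u p.
Proof.
have := lml_linear p c u 0; rewrite !addr0 => ->.
by have := lml_linear p (-1) 0 0; rewrite scaler0 addr0 scaleN1r addNr => ->; rewrite addr0.
Qed.
Lemma rmlZl c u p : rml (c *: u) p = c *: rml u p.
Proof.
have := rml_linear p c u 0; rewrite !addr0 => ->.
by have := rml_linear p (-1) 0 0; rewrite scaler0 addr0 scaleN1r addNr => ->; rewrite addr0.
Qed.

Lemma lml_tidl (S : F -> Prop) u p : tidl S p -> tidl S (lml u p).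
Proof.
move: p; apply: tidl_lin => [|x y h|x y h]; first by lin.
  by rewrite lml_ten; apply/tidl_l/idl_mull.
by rewrite lml_ten; apply/tidl_r.
Qed.
Lemma rml_tidl (S : F -> Prop) u p : tidl S p -> tidl S (rml u p).
Proof.
move: p; apply: tidl_lin => [|x y h|x y h]; first by lin.
  by rewrite rml_ten; apply/tidl_l.
by rewrite rml_ten; apply/tidl_r/idl_mulr.
Qed.
Lemma lml_idl (S : F -> Prop) u p : idl S u -> tidl S (lml u p).
Proof.
move=> h; move: p; apply: frAA_lin_span => [|x y]; first by lin.
by rewrite -(ten_mo F) lml_ten; apply/tidl_l/idl_mulr.
Qed.
Lemma rml_idl (S : F -> Prop) u p : idl S u -> tidl S (rml u p).
Proof.
move=> h; move: p; apply: frAA_lin_span => [|x y]; first by lin.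
by rewrite -(ten_mo F) rml_ten; apply/tidl_r/idl_mull.
Qed.

Lemma lml_hom i j u p : isdeg dg i u -> isdegT dg j p -> isdegT dg (i + j) (lml u p).
Proof.
move=> hu; move: p; apply: isdegT_lin_span => [|v w <-]; first by lin.
rewrite -(ten_mo F) lml_ten addrA.
by apply: isdegT_ten; [apply: isdegM (isdeg_mo _ _ v)|apply: isdeg_mo].
Qed.

(* the map beta of the Hochschild complex *)
Definition be (p : FF) : F := lww (fun v w => sg k (wdeg v * wdeg w) *: mo (w ++ v)) p.
HB.instance Definition _ := GRing.isLinear.Build k FF F _ be (fm_ext_linear _).
Lemma beD p q : be (p + q) = be p + be q. Proof. exact: linearD. Qed.
Lemma beN p : be (- p) = - be p. Proof. exact: linearN. Qed.
Lemma beZ c p : be (c *: p) = c *: be p. Proof. exact: linearZ. Qed.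

Lemma be_pm v w : be (pm v w) = sg k (wdeg v * wdeg w) *: mo (w ++ v).
Proof. exact: lwwE. Qed.

Lemma be_ten_mor i u w : isdeg dg i u -> be (ten u (mo w)) = sg k (i * wdeg w) *: (mo w ** u).
Proof.
move: u; apply: isdeg_lin => [||v <-]; [by lin..|].
by rewrite ten_mo be_pm moM.
Qed.

Lemma be_ten_mol j v y : isdeg dg j y -> be (ten (mo v) y) = sg k (wdeg v * j) *: (y ** mo v).
Proof.
move: y; apply: isdeg_lin => [||w <-]; [by lin..|].
by rewrite ten_mo be_pm moM.
Qed.

Lemma be_tidl (S : F -> Prop) p : graded_gen dg S -> tidl S p -> idl S (be p).
Proof.
move=> gS; move: p; apply: tidl_lin => [|x y h|x y h]; first by lin.
  move: y; apply: frA_lin_span => [|w]; first by lin.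
  suff -> : be (ten x (mo w)) = mo w ** sgm dg (wdeg w) x.
    by apply/idl_mull/sgm_idl.
  move: x {h}; apply: frA_lin => [||v]; [by lin..|].
  by rewrite (be_ten_mor _ (isdeg_mo F dg v)) sgm_mo mulFZr mulrC.
move: x; apply: frA_lin_span => [|w]; first by lin.
suff -> : be (ten (mo w) y) = sgm dg (wdeg w) y ** mo w.
  by apply/idl_mulr/sgm_idl.
move: y {h}; apply: frA_lin => [||v]; [by lin..|].
by rewrite (be_ten_mol _ (isdeg_mo F dg v)) sgm_mo mulFZl.
Qed.

(** [be] is the signed flip followed by multiplication, and a derivation is compatible with both; no
    extra sign appears because [be] has degree 0. *)
Lemma be_gderT e f p : (forall a, isdeg dg (e + dg a) (f a)) ->
  be (gderT dg e f p) = gder dg e f (be p).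
Proof.
move=> hf; move: p; apply: frAA_lin => [||v w]; [by lin..|].
rewrite -(ten_mo F) gderT_ten beD sgm_mo tenZl beZ.
rewrite (be_ten_mor _ (gder_isdeg hf (isdeg_mo F dg v))).
rewrite (be_ten_mol _ (gder_isdeg hf (isdeg_mo F dg w))).
rewrite ten_mo be_pm -moM gderZ gderM sgm_mo mulFZl.
by lmod k; sgring.
Qed.

(** In the cyclic word it does not matter at which outer end [w] is attached. This is the source of
    the cyclic invariance of [phi]. *)
Lemma be_rml i w p : isdegT dg i p ->
  be (rml (mo w) p) = sg k (wdeg w * i) *: be (lml (mo w) p).
Proof.
move=> hp; apply/eqP; rewrite -GRing.subr_eq0; apply/eqP.
(* Equality is phrased as membership in the span of 0, so that the induction principle for
   homogeneous elements applies. *)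
suff : span (fun x : F => x = 0) (be (rml (mo w) p) - sg k (wdeg w * i) *: be (lml (mo w) p)).
  by elim=> // a x y -> _ ->; rewrite scaler0 addr0.
move: p hp; apply: isdegT_lin_span => [|x y <-]; first by lin.
rewrite rml_pm lml_pm !be_pm !wdeg_cat catA -catA; apply: span_gen.
by lmod k; sgring.
Qed.

End Contract.

Section LetterPart.
Variables (k : fieldType) (L : choiceType) (F : freemod k (seq L)) (V : lmodType k).

(** Linear extension of a function on letters. Relations of R are combinations of letters, so that
    the pairing respects them means that [lpart] kills them. *)
Definition lpart (f : L -> V) (u : F) : V := lw (fun w => if w is [:: a] then f a else 0) u.
HB.instance Definition _ f := GRing.isLinear.Build k F V _ (lpart f) (fm_ext_linear _).

Lemma lpart_letter f a : lpart f (fmono F [:: a]) = f a.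
Proof. exact: lwE. Qed.
End LetterPart.

(** * The bracket of a cyclic pairing *)

Section CyclicData.
Variables (k : fieldType) (L : choiceType) (dg : L -> int) (N : int).
Variables (F : freemod k (seq L)) (FF : freemod k (seq L * seq L)).
Notation mo := (@fmono k L F).
Notation pm := (@fpmono k L FF).
Notation mum := (@mum k L F FF).
Notation wdeg := (Defs.wdeg dg).
Notation be := (@be k L dg F FF).
Notation lml := (@lml k L F FF).
Notation rml := (@rml k L F FF).

Variables (vp : L -> L -> k) (S : F -> Prop) (d1 : L -> L) (cp : L -> seq (k * L * L)).
Hypothesis vp_deg : forall a b, vp a b != 0 -> dg a + dg b + N = 0.
Hypothesis S_graded : graded_gen dg S.
Hypothesis S_letter : forall s, S s -> span (fun u => exists a, u = mo [:: a]) s.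
Hypothesis S_vpl : forall s b, S s -> lpart (fun a => vp a b : k^o) s = 0.
Hypothesis S_vpr : forall s b, S s -> lpart (fun a => vp b a : k^o) s = 0.

(* the double derivation v |-> sum of <v_i, b> v_< (x) v_>, acting from the right *)
Fixpoint dd (b : L) (w : seq L) : FF :=
  if w is a :: r then
    (sg k (dg a * wdeg r) * vp a b) *: pm [::] r + lml (mo [:: a]) (dd b r)
  else 0.
Definition ddF (b : L) (u : F) : FF := lw (dd b) u.
HB.instance Definition _ b := GRing.isLinear.Build k F FF _ (ddF b) (fm_ext_linear _).

(** The two pieces v_< (x) v_> are closed up to v_> v_<. Keeping [dd] separate lets the
    compatibility with [d] be proved before the cyclic closure. *)
Definition phi (v : seq L) (b : L) : F := be (dd b v).
Notation phiF := (@phiF k L L F F phi).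

Lemma ddF_mo b w : ddF b (mo w) = dd b w. Proof. exact: lwE. Qed.
Lemma ddFD b u v : ddF b (u + v) = ddF b u + ddF b v. Proof. exact: linearD. Qed.
Lemma ddFN b u : ddF b (- u) = - ddF b u. Proof. exact: linearN. Qed.
Lemma ddFZ b c u : ddF b (c *: u) = c *: ddF b u. Proof. exact: linearZ. Qed.

(** A sign identity with factor [vp a b] has to be checked only for the parities that a nonzero
    pairing allows. *)
Lemma vp_parity (P : k -> Prop) a b :
  P 0 -> (par (dg a) = par (dg b) (+) par N -> P (vp a b)) -> P (vp a b).
Proof.
move=> P0 h; have [->//|/vp_deg e] := eqVneq (vp a b) 0; apply: h.
have := congr1 par e; rewrite !parE.
by case: par; case: par; case: par.
Qed.

Lemma dd_letter b a : dd b [:: a] = vp a b *: pm [::] [::].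
Proof. by rewrite /= wdeg_nil mulr0 linear0 addr0 mul1r. Qed.

Lemma dd_splits b v :
  dd b v = splits v (fun P a Q => (sg k (dg a * wdeg Q) * vp a b) *: pm P Q).
Proof.
elim: v => //= a r ->; congr (_ + _).
rewrite (splits_lin (h := lml (mo [:: a]))); last by lin.
by apply: eq_splits => P c Q _; rewrite lmlZ lml_pm.
Qed.

Lemma dd_hom b v : isdegT dg (wdeg v + N + dg b) (dd b v).
Proof.
elim: v => [|a r IH]; first exact: span0.
apply: spanD.
  have [->|/vp_deg e] := eqVneq (vp a b) 0; first by rewrite mulr0 scale0r; apply: span0.
  apply: spanZ; have -> : wdeg (a :: r) + N + dg b = wdeg [::] + wdeg r.
    by rewrite wdeg_nil wdeg_cons add0r -[RHS]addr0 -e; ring.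
  exact: isdegT_pm.
rewrite wdeg_cons -!addrA; apply: lml_hom; first exact: isdeg_letter.
by rewrite addrA.
Qed.

(** The contraction acts from the right with degree |b| + N, so it pays a sign for passing [w] when
    it hits [v]. *)
Lemma dd_cat b v w : dd b (v ++ w) =
  sg k ((dg b + N) * wdeg w) *: rml (mo w) (dd b v) + lml (mo v) (dd b w).
Proof.
elim: v => [|a v IH].
  by rewrite /= linear0 scaler0 add0r lml1.
rewrite /= IH wdeg_cat lmlD lmlZ lml_rml -lmlM moM /=.
rewrite rmlD rmlZ rml_pm.
suff -> : sg k (dg a * (wdeg v + wdeg w)) * vp a b =
          sg k ((dg b + N) * wdeg w) * (sg k (dg a * wdeg v) * vp a b).
  by lmod k; ring.
apply: (@vp_parity (fun c => sg k (dg a * (wdeg v + wdeg w)) * c =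
          sg k ((dg b + N) * wdeg w) * (sg k (dg a * wdeg v) * c))).
  by rewrite !mulr0.
by move=> e; rewrite !sgE !parE e; sgring.
Qed.

Lemma ddFM b u v : ddF b (u ** v) =
  rml (sgm dg (dg b + N) v) (ddF b u) + lml u (ddF b v).
Proof.
move: u; apply: frA_lin => [||x].
- by lin.
- by apply: linear_add; [lin|apply: lml_linear].
move: v; apply: frA_lin => [||y].
- by lin.
- apply: linear_add; last by lin.
  by move=> a y z; rewrite linearP; apply: rml_linear.
by rewrite moM !ddF_mo dd_cat sgm_mo rmlZl.
Qed.

Lemma phi_hom v b : isdeg dg (wdeg v + N + dg b) (phi v b).
Proof.
move: (dd_hom b v); rewrite /phi; move: (dd b v).
apply: isdegT_lin_span => [|x y <-]; first by lin.
by rewrite be_pm addrC; apply/spanZ; rewrite -wdeg_cat; apply: isdeg_mo.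
Qed.

Lemma phi_splits v b : phi v b = splits v (fun P a Q =>
  (sg k (dg a * wdeg Q + wdeg P * wdeg Q) * vp a b) *: mo (Q ++ P)).
Proof.
rewrite /phi dd_splits (splits_lin (h := be)); last by lin.
apply: eq_splits => P a Q _; rewrite beZ be_pm scalerA; congr (_ *: _).
by sgring.
Qed.

(** By [be_rml] the two terms of [dd_cat] change places when v and w are exchanged. Hence [phi]
    kills commutators and the action descends to R_nat. *)
Lemma phi_cyc v w b : phi (v ++ w) b = sg k (wdeg v * wdeg w) *: phi (w ++ v) b.
Proof.
rewrite /phi !dd_cat !beD !beZ !(be_rml F _ (dd_hom _ _)) .
by lmod k; sgring.
Qed.

Lemma phiFE u b : phiF u b = be (ddF b u).
Proof.
move: u; apply: frA_lin => [||w]; [exact: phiF_linear|by lin|].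
by rewrite phiF_mo ddF_mo.
Qed.

Lemma ddF_S b s : S s -> ddF b s = 0.
Proof.
move=> Ss; have := S_vpl b Ss; have := S_letter Ss; move: s {Ss} => s.
suff E : span (fun u => exists a, u = mo [:: a]) s ->
    ddF b s = (lpart (fun a => vp a b : k^o) s : k) *: pm [::] [::].
  by move=> /E -> ->; rewrite scale0r.
elim=> [|c _ y [a ->] _ IH]; first by rewrite !linear0 scale0r.
by rewrite !linearP /= lpart_letter IH ddF_mo dd_letter scalerDl scalerA.
Qed.

Lemma ddF_idl b u : idl S u -> tidl S (ddF b u).
Proof.
move: u; apply: idl_lin => [|v s w Ss]; first by lin.
rewrite !ddFM (ddF_S b Ss) linear0 addr0 lmlM.
apply: spanD; first by apply/rml_tidl/rml_idl/sgm_idl => //; apply: idl_gen.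
exact/lml_tidl/lml_idl/idl_gen.
Qed.

Lemma phiF_idl b u : idl S u -> idl S (phiF u b).
Proof. by move=> h; rewrite phiFE; apply/be_tidl/ddF_idl. Qed.

Lemma phiF_comm b v w :
  phiF (mo (v ++ w) - sg k (wdeg v * wdeg w) *: mo (w ++ v)) b = 0.
Proof.
rewrite !phiFE linearB linearZ /= !ddF_mo linearB linearZ /=.
by rewrite -!/(phi _ _) phi_cyc subrr.
Qed.

Lemma phiF_unit b : phiF (mo [::]) b = 0.
Proof. by rewrite phiFE ddF_mo linear0. Qed.

(** The letter b enters [phi v b] only through the pairing, so the derivation kills a relation on
    the nose and not just modulo the ideal. *)
Lemma phi_S v s : S s -> idl S (gder dg (wdeg v + N) (phi v) s).
Proof.
move=> Ss; suff -> : gder dg (wdeg v + N) (phi v) s = 0 by apply: span0.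
have E u : span (fun u => exists a, u = mo [:: a]) u ->
    gder dg (wdeg v + N) (phi v) u = be (lpart (fun b => dd b v) u).
  elim=> [|c _ y [a ->] _ IH]; first by rewrite !linear0.
  by rewrite !linearP /= lpart_letter gder_letter IH.
rewrite E; last exact: S_letter.
suff -> : lpart (dd^~ v) s = 0 by rewrite linear0.
elim: v {E} => [|a v IH].
  move: s {Ss}; apply: frA_lin => [||[|a [|b r]]]; [by lin..| | |];
    by rewrite /lpart lwE.
have E u : lpart (dd^~ (a :: v)) u = (sg k (dg a * wdeg v) *
    (lpart (fun b => vp a b : k^o) u : k)) *: pm [::] v + lml (mo [:: a]) (lpart (dd^~ v) u).
  move: u; apply: frA_lin => [||[|c [|b r]]].
  - by lin.
  - apply: linear_add; last by lin.
    by move=> c x y; rewrite linearP /= mulrDr scalerDl scalerA mulrCA.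
  - by rewrite /lpart !lwE mulr0 scale0r linear0 addr0.
  - by rewrite /lpart !lwE.
  - by rewrite /lpart !lwE mulr0 scale0r linear0 addr0.
by rewrite E (S_vpr a Ss) IH mulr0 scale0r linear0 addr0.
Qed.

Hypothesis d1_deg : forall a, dg (d1 a) = dg a - 1.
Hypothesis cp_deg : forall a t, t \in cp a -> dg t.1.2 + dg t.2 = dg a - 1.
Hypothesis vp_d : forall a b, vp (d1 a) b = - sg k (dg a + N) * vp a (d1 b).
Hypothesis cp_cycl : forall a b,
  idl S (\sum_(t <- cp a) (t.1.1 * vp t.1.2 b) *: mo [:: t.2]
    + sg k (dg a + N + N * dg b + dg a * N) *:
      \sum_(t <- cp b) (t.1.1 * vp a t.2) *: mo [:: t.1.2]).
Hypothesis cp_cycr : forall a b,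
  idl S (\sum_(t <- cp a) (t.1.1 * vp t.2 b) *: mo [:: t.1.2]
    + sg k (dg a + N) *: \sum_(t <- cp b) (t.1.1 * vp a t.1.2) *: mo [:: t.2]).

(** The cobar differential on letters, with linear part [d1] and with the coproduct as a finite list
    [cp] of weighted pairs of letters, over which contractions become explicit sums. *)
Definition delta (a : L) : F :=
  - mo [:: d1 a] + \sum_(t <- cp a) t.1.1 *: mo [:: t.1.2; t.2].

Lemma delta_hom a : isdeg dg (-1 + dg a) (delta a).
Proof.
rewrite addrC; apply: spanD.
  by apply: spanN; rewrite -d1_deg; apply: isdeg_letter.
rewrite big_seq; apply: span_sum => t ta; apply: spanZ; rewrite -(cp_deg ta).
have -> : dg t.1.2 + dg t.2 = wdeg [:: t.1.2; t.2].
  by rewrite !wdeg_cons wdeg_nil addr0.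
exact: isdeg_mo.
Qed.

Lemma gderT_lml e f u p :
  gderT dg e f (lml u p) = lml (gder dg e f u) p + lml (sgm dg e u) (gderT dg e f p).
Proof.
move: p; apply: frAA_lin => [||x y]; [by lin..|].
rewrite -(ten_mo F) lml_ten !gderT_ten lmlD !lml_ten gderM sgmM tenDl.
by lmod k; ring.
Qed.

(** Terms in which the differential and the contraction hit different letters cancel. What survives
    at each letter a is the contraction of [delta a] with b. *)
Lemma dd_d b v :
  gderT dg (-1) delta (dd b v) - ddF b (gderw dg (-1) delta v)
  = - splits v (fun P a Q => sg k (wdeg P + (dg b + N) * wdeg Q) *:
        lml (mo P) (rml (mo Q) (ddF b (delta a)))).
Proof.
elim: v => [|a r IH]; first by rewrite /= [gderT _ _ _ _]linear0 [ddF _ _]linear0 subr0 oppr0.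
have hr := gder_isdeg delta_hom (isdeg_mo F dg r); rewrite gder_mo in hr.
have E : splits r (fun P c Q => sg k (wdeg (a :: P) + (dg b + N) * wdeg Q) *:
          lml (mo (a :: P)) (rml (mo Q) (ddF b (delta c))))
  = sg k (dg a) *: lml (mo [:: a]) (splits r (fun P c Q =>
      sg k (wdeg P + (dg b + N) * wdeg Q) *: lml (mo P) (rml (mo Q) (ddF b (delta c))))).
  rewrite (splits_lin (h := lml (mo [:: a]))); last by lin.
  rewrite -splitsZ; apply: eq_splits => P c Q _.
  rewrite lmlZ -lmlM moM wdeg_cons scalerA; congr (_ *: _); by sgring.
rewrite [splits (a :: r) _]/= {}E.
have -> : splits r (fun P c Q =>
      sg k (wdeg P + (dg b + N) * wdeg Q) *: lml (mo P) (rml (mo Q) (ddF b (delta c))))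
  = - (gderT dg (-1) delta (dd b r) - ddF b (gderw dg (-1) delta r)) by rewrite IH opprK.
rewrite /= gderTD gderTZ gderT_pm gderT_lml gder_letter sgm_letter lmlZl.
rewrite ddFD ddFZ !ddFM sgm_mo ddF_mo rmlZl ddF_mo dd_letter rmlZ.
rewrite (sgm_isdeg _ hr) rmlZl -(ten_mo F FF [::] [::]) rml_ten mul1F.
rewrite /= ten0l add0r wdeg_nil.
rewrite lml1 lmlN lmlD lmlN.
(* The signs match only for the parities compatible with a nonzero pairing of a and b. *)
have [->|/vp_deg e] := eqVneq (vp a b) 0; first by lmod k; sgring.
have {}e : par (dg a) = par (dg b) (+) par N.
  by have := congr1 par e; rewrite !parE; case: par; case: par; case: par.
by lmod k; rewrite ?sgE ?parE ?e; sgring.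
Qed.

Lemma cp_parity a t : t \in cp a -> par (dg t.2) = ~~ (par (dg a) (+) par (dg t.1.2)).
Proof.
by move/cp_deg/(congr1 par); rewrite !parE; case: par; case: par; case: par.
Qed.

(** Contracting the first factor of the coproduct of a leaves the second at the left end of
    [Q ++ P]; contracting the second leaves the first at the right end. These two shapes correspond
    to [cp_cycl] and [cp_cycr]. *)
Lemma ddF_delta b a P Q : be (lml (mo P) (rml (mo Q) (ddF b (delta a)))) =
  - ((vp (d1 a) b * sg k (wdeg P * wdeg Q)) *: mo (Q ++ P))
  + sg k ((dg b + N) * (dg a - 1 + dg b + N) + wdeg P * (dg a - 1 + dg b + N + wdeg Q))
    *: ((\sum_(t <- cp a) (t.1.1 * vp t.1.2 b) *: mo [:: t.2]) ** mo (Q ++ P))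
  + sg k ((wdeg P + dg a - 1 + dg b + N) * wdeg Q)
    *: (mo (Q ++ P) ** (\sum_(t <- cp a) (t.1.1 * vp t.2 b) *: mo [:: t.1.2])).
Proof.
rewrite /delta ddFD rmlD lmlD beD -addrA; congr (_ + _).
  by rewrite ddFN ddF_mo dd_letter rmlN lmlN beN rmlZ lmlZ rml_pm lml_pm beZ be_pm
     cats0 /= scalerA.
rewrite !linear_sum /= mulF_suml !scaler_sumr -big_split /=.
apply: eq_big_seq => t ta; have d := cp_parity ta.
rewrite ddFZ rmlZ lmlZ beZ ddF_mo [dd _ _]/= -/(dd b [:: t.2]) dd_letter.
rewrite wdeg_seq1 rmlD lmlD beD !(lmlZ, rmlZ, beZ) !(lml_pm, rml_pm) !be_pm.
rewrite !wdeg_cat !wdeg_seq1 !cats0 /= mulFZl mulFZr !moM /=.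
rewrite !wdeg_nil !add0r !addr0 -catA.
have [z1|] := eqVneq (vp t.1.2 b) 0; have [z2|] := eqVneq (vp t.2 b) 0.
- by rewrite z1 z2; lmod k; ring.
- move/vp_deg/(congr1 par); rewrite z1 !parE d => e2.
  by lmod k; move: e2; rewrite ?sgE ?parE ?d; sgring.
- move=> /vp_deg/(congr1 par); rewrite z2 !parE => e1.
  by lmod k; move: e1; rewrite ?sgE ?parE ?d; sgring.
move=> /vp_deg/(congr1 par); rewrite !parE d => e2.
move=> /vp_deg/(congr1 par); rewrite !parE => e1.
by lmod k; move: e1 e2; rewrite ?sgE ?parE ?d; sgring.
Qed.

(** The quadratic part of {v, delta b} at the letter a of v, sorted by the same two shapes: the
    other factor of the coproduct of b stands to the right or to the left of [Q ++ P]. *)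
Lemma phi_delta a b e P Q :
  let f c := (sg k (dg a * wdeg Q + wdeg P * wdeg Q) * vp a c) *: mo (Q ++ P) in
  \sum_(t <- cp b) t.1.1 *: (f t.1.2 ** mo [:: t.2]
      + sg k (e * dg t.1.2) *: (mo [:: t.1.2] ** f t.2)) =
  sg k (dg a * wdeg Q + wdeg P * wdeg Q) *:
    (mo (Q ++ P) ** (\sum_(t <- cp b) (t.1.1 * vp a t.1.2) *: mo [:: t.2]))
  + sg k (e * (dg b - 1 + dg a + N) + dg a * wdeg Q + wdeg P * wdeg Q) *:
    ((\sum_(t <- cp b) (t.1.1 * vp a t.2) *: mo [:: t.1.2]) ** mo (Q ++ P)).
Proof.
move=> f; rewrite !linear_sum /= mulF_suml !scaler_sumr -big_split /=.
apply: eq_big_seq => t tb; have d := cp_parity tb.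
rewrite /f mulFZl !mulFZr mulFZl !moM /= -catA.
have [z|/vp_deg/(congr1 par)] := eqVneq (vp a t.2) 0.
  by rewrite z; lmod k; sgring.
by rewrite !parE d => h; lmod k; move: h; rewrite ?sgE ?parE; sgring.
Qed.

(** All terms are compared at one letter a of v. The linear ones cancel by [vp_d], those with a
    letter at the left end of [Q ++ P] by [cp_cycl], those with a letter at the right end by
    [cp_cycr]. *)
Lemma phi_d v b : idl S (gder dg (-1) delta (phi v b)
  - (phiF (gder dg (-1) delta (mo v)) b
     + sg k (wdeg v + N) *: gder dg (wdeg v + N) (phi v) (delta b))).
Proof.
have -> : gder dg (-1) delta (phi v b) = phiF (gder dg (-1) delta (mo v)) b
   - be (splits v (fun P a Q => sg k (wdeg P + (dg b + N) * wdeg Q) *: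
        lml (mo P) (rml (mo Q) (ddF b (delta a))))).
  rewrite /phi -(be_gderT _ delta_hom) phiFE -beN -dd_d -beD gder_mo.
  by rewrite addrC subrK.
have -> : gder dg (wdeg v + N) (phi v) (delta b) = splits v (fun P a Q =>
    let f c := (sg k (dg a * wdeg Q + wdeg P * wdeg Q) * vp a c) *: mo (Q ++ P) in
    - f (d1 b) + \sum_(t <- cp b) t.1.1 *: (f t.1.2 ** mo [:: t.2]
      + sg k ((wdeg v + N) * dg t.1.2) *: (mo [:: t.1.2] ** f t.2))).
  rewrite /delta gderD -scaleN1r gderZ scaleN1r gder_letter.
  rewrite linear_sum splitsD /=; congr (_ + _).
    by rewrite phi_splits -scaleN1r -splitsZ; apply: eq_splits => P a Q _; rewrite scaleN1r.
  rewrite splits_sum; apply: eq_bigr => t _; rewrite splitsZ gderZ; congr (_ *: _).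
  rewrite mo_cons gderM !gder_letter sgm_letter mulFZl !phi_splits splitsD splitsZ.
  rewrite (splits_lin (h := fun x => x ** _)); last by lin.
  by rewrite (splits_lin (h := mulF _)); last by lin.
rewrite (splits_lin (h := be)); last by lin.
have comb (X : F) c f g : X - splits v f - (X + c *: splits v g)
    = - splits v (fun P a Q => f P a Q + c *: g P a Q).
  by rewrite splitsD splitsZ; lmod k; ring.
rewrite comb; apply/spanN/splits_span.
move=> P a Q vE /=; rewrite phi_delta beZ ddF_delta vp_d vE wdeg_cat wdeg_cons.
set X := mo (Q ++ P).
(* [cL] and [cR] are the sign of [dd_d] times the signs of the left and right terms of
   [ddF_delta]. *)
pose cL := sg k (wdeg P + (dg b + N) * wdeg Q + (dg b + N) * (dg a - 1 + dg b + N)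
  + wdeg P * (dg a - 1 + dg b + N + wdeg Q)).
pose cR := sg k (wdeg P + (dg b + N) * wdeg Q + (wdeg P + dg a - 1 + dg b + N) * wdeg Q).
have := spanD (spanZ cL (idl_mulr X (cp_cycl a b))) (spanZ cR (idl_mull X (cp_cycr a b))).
apply: span_eq; rewrite mulFDl mulFDr mulFZl mulFZr /cL /cR.
have [z|/vp_deg/(congr1 par)] := eqVneq (vp a (d1 b)) 0.
  by rewrite z; lmod k; sgring.
by rewrite d1_deg !parE => h; lmod k; move: h; rewrite ?sgE ?parE; sgring.
Qed.

Notation opp_ := (@op k L L dg dg F F N phi).
Notation oppT_ := (@opT k L L dg dg F F FF N phi).

Lemma be_opT u p : be (oppT_ u p) = opp_ u (be p).
Proof.
move: u; apply: frA_lin => [||v].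
- by apply: linear_comp; apply: opTl_linear.
- exact: opl_linear.
by rewrite opT_mo op_mo (be_gderT _ (phi_hom v)).
Qed.

Lemma mum_opT u p : mum (oppT_ u p) = opp_ u (mum p).
Proof.
move: u; apply: frA_lin => [||v].
- by apply: linear_comp; apply: opTl_linear.
- exact: opl_linear.
by rewrite opT_mo op_mo mum_gderT.
Qed.

Definition au (u : F) : k^o := lw (fun w => if w is [::] then 1 else 0 : k^o) u.
HB.instance Definition _ := GRing.isLinear.Build k F k^o _ au (fm_ext_linear _).

Lemma auM u v : au (u ** v) = au u * au v.
Proof.
move: u; apply: (@frA_lin _ _ _ k^o) => [||x]; [by lin| |].
  by move=> a x y; rewrite linearP mulrDl scalerAl.
move: v; apply: (@frA_lin _ _ _ k^o) => [||y]; [by lin| |].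
  by move=> a y z; rewrite linearP mulrDr scalerAr.
by rewrite moM /au !lwE; case: x => [|a x]; case: y => [|b y]; rewrite ?mulr1 ?mulr0.
Qed.

Lemma au_idl u : idl S u -> au u = 0.
Proof.
move=> h; suff : span (fun x : k^o => x = 0) (au u).
  by elim=> // a x y -> _ ->; rewrite scaler0 addr0.
move: u h; apply: idl_lin => [|v s w Ss]; first by lin.
apply: span_gen; rewrite !auM; suff -> : au s = 0 by rewrite mulr0 mul0r.
elim: (S_letter Ss) => [|c x y [a ->] _ IH]; first exact: linear0.
by rewrite linearP /= IH /au lwE addr0 scaler0.
Qed.

Lemma au_op_mo v w : au (opp_ (mo v) (mo w)) = if w is [:: a] then au (phi v a) else 0.
Proof.
rewrite op_mo gder_mo; case: w => [|a [|b r]] /=; first exact: linear0.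
  by rewrite mulF0 scaler0 addr0 mulF1.
rewrite linearD linearZ /= !auM [au (mo [:: a])]lwE [au (mo (b :: r))]lwE.
by rewrite mulr0 mul0r scaler0 addr0.
Qed.

(** A derivation produces constants only from words of one letter, and a word of one letter does not
    change under rotation. So {z, be p} has the same constant term as {z, mum p}, which lies in an
    ideal without constant terms. This makes the projected action on the cone compatible with
    beta. *)
Lemma au_op_be z p : idl S (mum p) -> au (opp_ z (be p)) = 0.
Proof.
move=> h; have : au (opp_ z (mum p)) = 0.
  apply: au_idl; apply: op_idl => //; exact: phi_S.
move=> <-; move: z; apply: (@frA_lin _ _ _ k^o) => [||v].
- by apply: linear_comp; apply: opl_linear.
- by apply: linear_comp; apply: opl_linear.
move: p {h}; apply: (@frAA_lin _ _ _ k^o) => [||x y]; [by lin..|].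
rewrite mum_pm be_pm [opp_ _ (_ *: _)]linearZ linearZ /= !au_op_mo.
case: x y => [|a [|b x]] [|c [|d y]] //=; rewrite ?wdeg_nil ?mul0r ?mulr0 ?scale1r ?scaler0 //.
all: by case: (y ++ _) => [|? [|? ?]]; rewrite ?scaler0.
Qed.

End CyclicData.

(** * Representations and traces *)

Section Representation.
Variables (k : fieldType) (L : choiceType) (dg : L -> int) (n : nat).
Notation Ln := ('I_n * 'I_n * L)%type.
Variables (F : freemod k (seq L)) (FF : freemod k (seq L * seq L)).
Variables (Fn : freemod k (seq Ln)) (FFn : freemod k (seq Ln * seq Ln)).
Notation mon := (@fmono k _ Fn).
Notation tenn := (@ten k _ Fn FFn).
Definition ndg (c : Ln) : int := dg c.2.
Notation mo := (@fmono k L F).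
Notation ten := (@ten k L F FF).
Notation wdeg := (Defs.wdeg dg).
Notation wdegn := (Defs.wdeg ndg).
Variable S : F -> Prop.

Fixpoint pw (w : seq L) (i j : 'I_n) : Fn :=
  if w is a :: r then \sum_l mon [:: (i, l, a)] ** pw r l j
  else if i == j then mon [::] else 0.
Definition pn (i j : 'I_n) (u : F) : Fn := lw (fun w => pw w i j) u.
HB.instance Definition _ i j := GRing.isLinear.Build k F Fn _ (pn i j) (fm_ext_linear _).

Lemma pn_mo w i j : pn i j (mo w) = pw w i j. Proof. exact: lwE. Qed.
Lemma pnD i j u v : pn i j (u + v) = pn i j u + pn i j v. Proof. exact: linearD. Qed.
Lemma pnZ i j c u : pn i j (c *: u) = c *: pn i j u. Proof. exact: linearZ. Qed.
Lemma pnB i j u v : pn i j (u - v) = pn i j u - pn i j v. Proof. exact: linearB. Qed.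

Lemma pn_letter i j a : pn i j (mo [:: a]) = mon [:: (i, j, a)].
Proof.
rewrite pn_mo /= (bigD1 j) //= eqxx mulF1 big1 ?addr0 // => l /negPf lj.
by rewrite lj mulF0.
Qed.

Lemma pw_cat v w i j : pw (v ++ w) i j = \sum_l pw v i l ** pw w l j.
Proof.
elim: v i => [|a v IH] i /=.
  rewrite (bigD1 i) //= eqxx mul1F big1 ?addr0 // => l /negPf li.
  by rewrite eq_sym li mul0F.
rewrite (eq_bigr (fun l => \sum_m mon [:: (i, l, a)] ** (pw v l m ** pw w m j))); last first.
  by move=> l _; rewrite IH mulF_sumr.
rewrite exchange_big; apply: eq_bigr => m _ /=; rewrite mulF_suml.
by apply: eq_bigr => l _; rewrite mulFA.
Qed.

Lemma pnM i j u v : pn i j (u ** v) = \sum_l pn i l u ** pn l j v.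
Proof.
move: u; apply: frA_lin => [||x].
- by lin.
- by apply: linear_bigsum => l; lin.
move: v; apply: frA_lin => [||y].
- by lin.
- by apply: linear_bigsum => l; lin.
rewrite moM pn_mo pw_cat; by apply: eq_bigr => l _; rewrite !pn_mo.
Qed.

Lemma pw_hom w i j : isdeg ndg (wdeg w) (pw w i j).
Proof.
elim: w i => [|a w IH] i /=.
  case: eqP => _; last exact: span0.
  by rewrite wdeg_nil -(wdeg_nil ndg); apply: isdeg_mo.
apply: span_sum => l _; rewrite wdeg_cons; apply: isdegM (IH l).
exact: (isdeg_letter Fn ndg (i, l, a)).
Qed.

Lemma pn_hom d u i j : isdeg dg d u -> isdeg ndg d (pn i j u).
Proof.
move: u; apply: isdeg_lin_span => [|w <-]; first by lin.
by rewrite pn_mo; apply: pw_hom.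
Qed.

Lemma pn_sgm c u i j : pn i j (sgm dg c u) = sgm ndg c (pn i j u).
Proof.
move: u; apply: frA_lin => [||w]; [by lin..|].
by rewrite sgm_mo pnZ pn_mo (sgm_isdeg _ (pw_hom w i j)).
Qed.

(** The values on generators of the derivation of R_n induced by a derivation of R. *)
Definition onletters (f : L -> F) (c : Ln) : Fn := pn c.1.1 c.1.2 (f c.2).

(** Matrix entries of a word have the degree of the word and multiply as matrices do, so both sides
    obey the same Leibniz rule and agree on letters. *)
Lemma pn_gder e f i j u :
  gder ndg e (onletters f) (pn i j u) = pn i j (gder dg e f u).
Proof.
move: u; apply: frA_lin => [||w]; [by lin..|].
rewrite pn_mo; elim: w i => [|a w IH] i.
  by rewrite gder1 linear0 /=; case: eqP; rewrite ?gder1 ?linear0.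
rewrite /= linear_sum mo_cons gderM pnD !pnM sgm_letter.
rewrite -big_split; apply: eq_bigr => l _ /=.
rewrite gderM gder_letter /= IH gder_letter !pn_mo pnZ mulFZl pn_letter.
by rewrite (sgm_letter Fn ndg e (i, l, a)) mulFZl.
Qed.

(** Linear relations enter as matrix entries of those of R, so that [pn_gder] transfers stability
    under derivations from [S]. Commutativity is imposed on letters and extended to words by
    [comm_words]. *)
Inductive rep_rel : Fn -> Prop :=
  | Sn_pn i j s of S s : rep_rel (pn i j s)
  | Sn_comm a b : rep_rel (mon [:: a; b] - sg k (ndg a * ndg b) *: mon [:: b; a]).
Notation Sn := rep_rel.

Lemma pn_idl i j u : idl S u -> idl Sn (pn i j u).
Proof.
move: u; apply: idl_lin => [|v s w Ss]; first by lin.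
rewrite pnM; apply: span_sum => l _; apply: idl_mulr.
rewrite pnM; apply: span_sum => m _; apply: idl_mull.
by apply: idl_gen; apply: Sn_pn.
Qed.

Hypothesis S_graded : graded_gen dg S.

Lemma Sn_graded : graded_gen ndg Sn.
Proof.
move=> _ [i j s /S_graded[d hd]|a b]; first by exists d; apply: pn_hom.
exists (ndg a + ndg b); apply: spanB.
  by rewrite -[ndg b]addr0 -(wdeg_nil ndg) -!wdeg_cons; apply: isdeg_mo.
by apply: spanZ; rewrite addrC -[ndg a]addr0 -(wdeg_nil ndg) -!wdeg_cons; apply: isdeg_mo.
Qed.

Lemma comm_words v w : idl Sn (mon v ** mon w - sg k (wdegn v * wdegn w) *: (mon w ** mon v)).
Proof.
have letter a r : idl Sn (mon [:: a] ** mon r - sg k (ndg a * wdegn r) *: (mon r ** mon [:: a])).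
  elim: r => [|b r IH].
    by rewrite mulF1 mul1F wdeg_nil mulr0 scale1r subrr; apply: span0.
  have h := idl_mulr (mon r) (idl_gen (Sn_comm a b)).
  have := spanD h (spanZ (sg k (ndg a * ndg b)) (idl_mull (mon [:: b]) IH)).
  apply: span_eq; rewrite !(mulFBl, mulFBr, mulFZl, mulFZr, moM) /= ?wdeg_cons -?catA /=.
  by lmod k; sgring.
elim: v => [|a v IH].
  by rewrite mulF1 mul1F wdeg_nil mul0r scale1r subrr; apply: span0.
have := spanD (idl_mull (mon [:: a]) IH)
  (spanZ (sg k (wdegn v * wdegn w)) (idl_mulr (mon v) (letter a w))).
apply: span_eq; rewrite !(mulFBl, mulFBr, mulFZl, mulFZr, moM) /= ?wdeg_cons -?catA /=.
by lmod k; sgring.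
Qed.

Lemma comm_hom d e x y : isdeg ndg d x -> isdeg ndg e y ->
  idl Sn (x ** y - sg k (d * e) *: (y ** x)).
Proof.
move=> hx hy; move: x hx; apply: isdeg_lin_span => [|v <-]; first by lin.
move: y hy; apply: isdeg_lin_span => [|w <-]; first by lin.
exact: comm_words.
Qed.

Lemma comm_pw v w i j i' j' :
  idl Sn (pw v i j ** pw w i' j' - sg k (wdeg v * wdeg w) *: (pw w i' j' ** pw v i j)).
Proof. by apply: comm_hom; apply: pw_hom. Qed.

(** A homogeneous derivation sends a graded commutator to a sum of graded commutators; only the
    entries of relations of R have to be checked. *)
Lemma gder_Sn e f : (forall a, isdeg ndg (e + ndg a) (f a)) ->
  (forall i j s, S s -> idl Sn (gder ndg e f (pn i j s))) ->
  forall s, Sn s -> idl Sn (gder ndg e f s).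
Proof.
move=> hf h _ [i j s Ss|a b]; first exact: h.
have h1 := comm_hom (hf a) (isdeg_letter Fn ndg b).
have h2 := comm_hom (isdeg_letter Fn ndg a) (hf b).
have := spanD h1 (spanZ (sg k (e * ndg a)) h2).
apply: span_eq; rewrite -(moM _ [:: a] [:: b]) -(moM _ [:: b] [:: a]).
rewrite gderD gderN gderZ !gderM !gder_letter !sgm_letter !mulFZl.
by lmod k; sgring.
Qed.

Lemma isdeg_onletters e f : (forall a, isdeg dg (e + dg a) (f a)) ->
  forall c, isdeg ndg (e + ndg c) (onletters f c).
Proof. by move=> h c; apply: pn_hom; apply: h. Qed.

Lemma gder_onletters_Sn e f : (forall a, isdeg dg (e + dg a) (f a)) ->
  (forall s, S s -> idl S (gder dg e f s)) ->
  forall s, Sn s -> idl Sn (gder ndg e (onletters f) s).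
Proof.
move=> hf h; apply: gder_Sn; first exact: isdeg_onletters.
by move=> i j s Ss; rewrite pn_gder; apply/pn_idl/h.
Qed.

(* sends a (x) b to - Tr (a d(b)) *)
Definition TO (p : FF) : FFn :=
  lww (fun v w => - \sum_i \sum_l tenn (pw v i l) (pw w l i)) p.
HB.instance Definition _ := GRing.isLinear.Build k FF FFn _ TO (fm_ext_linear _).

Lemma TO_ten u v : TO (ten u v) = - \sum_i \sum_l tenn (pn i l u) (pn l i v).
Proof.
move: u; apply: frA_lin => [||x].
- by lin.
- by apply: linear_opp; apply: linear_bigsum => i; apply: linear_bigsum => l; lin.
move: v; apply: frA_lin => [||y].
- by lin.
- by apply: linear_opp; apply: linear_bigsum => i; apply: linear_bigsum => l; lin.
rewrite ten_mo [TO _]lwwE; congr (- _); apply: eq_bigr => i _; apply: eq_bigr => l _.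
by rewrite !pn_mo.
Qed.

Lemma TO_gderT e f p :
  gderT ndg e (onletters f) (TO p) = TO (gderT dg e f p).
Proof.
move: p; apply: frAA_lin => [||v w]; [by lin..|].
rewrite -(ten_mo F) gderT_ten [TO (_ + _)]linearD /= !TO_ten linearN -opprD; congr (- _).
rewrite linear_sum -big_split; apply: eq_bigr => i _ /=.
rewrite linear_sum -big_split; apply: eq_bigr => l _ /=.
by rewrite gderT_ten !pn_gder pn_sgm.
Qed.

Lemma TO_tidl p : tidl S p -> tidl Sn (TO p).
Proof.
move: p; apply: tidl_lin => [|u v h|u v h]; first by lin.
  rewrite TO_ten; apply: spanN; apply: span_sum => i _; apply: span_sum => l _.
  exact/tidl_l/pn_idl.
rewrite TO_ten; apply: spanN; apply: span_sum => i _; apply: span_sum => l _.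
exact/tidl_r/pn_idl.
Qed.

End Representation.

Section Lift.
Variables (k : fieldType) (L : choiceType) (dg : L -> int) (n : nat).
Notation Ln := ('I_n * 'I_n * L)%type.
Variables (F : freemod k (seq L)) (FF : freemod k (seq L * seq L)).
Variables (Fn : freemod k (seq Ln)) (FFn : freemod k (seq Ln * seq Ln)).
Notation ndg := (@ndg L dg n).
Notation mo := (@fmono k L F).
Notation wdeg := (Defs.wdeg dg).
Notation pn := (@pn k L n F Fn).
Variables (S : F -> Prop) (S_graded : graded_gen dg S).
Notation Sn := (@rep_rel k L dg n F Fn S).
Variables (N : int) (phi : seq L -> L -> F).
Hypothesis phi_hom : forall v b, isdeg dg (wdeg v + N + dg b) (phi v b).

Definition phin (v : seq L) : Ln -> Fn := onletters Fn (phi v).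
Notation opl := (@op k L L dg dg F F N phi).
Notation opTl := (@opT k L L dg dg F F FF N phi).
Notation opn := (@op k L Ln dg ndg F Fn N phin).
Notation opTn := (@opT k L Ln dg ndg F Fn FFn N phin).

Lemma phin_hom v c : isdeg ndg (wdeg v + N + ndg c) (phin v c).
Proof. exact: pn_hom (phi_hom v c.2). Qed.

Lemma phiF_phin (u : F) c : phiF phin u c = onletters Fn (phiF phi u) c.
Proof.
move: u; apply: frA_lin => [||v]; first exact: phiF_linear.
  by apply: linear_comp; apply: phiF_linear.
by rewrite /onletters !phiF_mo.
Qed.

Lemma opn_pn u i j x : opn u (pn i j x) = pn i j (opl u x).
Proof.
move: u; apply: frA_lin => [||v]; first exact: opl_linear.
  by apply: linear_comp; apply: opl_linear.
by rewrite !op_mo pn_gder.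
Qed.

Lemma opTn_TO u p : opTn u (TO Fn FFn p) = TO Fn FFn (opTl u p).
Proof.
move: u; apply: frA_lin => [||v]; first exact: opTl_linear.
  by apply: linear_comp; apply: opTl_linear.
by rewrite !opT_mo TO_gderT.
Qed.

Lemma phiF_phin_idl (u : F) c : (forall b, idl S (phiF phi u b)) -> idl Sn (phiF phin u c).
Proof. by move=> h; rewrite phiF_phin; apply/pn_idl/h. Qed.

Hypothesis phi_S : forall v s, S s -> idl S (gder dg (wdeg v + N) (phi v) s).

Lemma phin_Sn v s : Sn s -> idl Sn (gder ndg (wdeg v + N) (phin v) s).
Proof. by apply: gder_onletters_Sn => // t Ss; apply: phi_S. Qed.

Variable delta : L -> F.
Hypothesis phi_d : forall v b, idl S (gder dg (-1) delta (phi v b)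
  - (phiF phi (gder dg (-1) delta (mo v)) b
     + sg k (wdeg v + N) *: gder dg (wdeg v + N) (phi v) (delta b))).

Lemma phin_d v c : idl Sn (gder ndg (-1) (onletters Fn delta) (phin v c)
  - (phiF phin (gder dg (-1) delta (mo v)) c
     + sg k (wdeg v + N) *: gder ndg (wdeg v + N) (phin v) (onletters Fn delta c))).
Proof.
by rewrite phiF_phin /phin /onletters !pn_gder -pnZ -pnD -pnB; apply: pn_idl.
Qed.

End Lift.

(** * The Poisson bracket on the representation algebra *)

Section Poisson.
Variables (k : fieldType) (L : choiceType) (dg : L -> int) (n : nat).
Notation Ln := ('I_n * 'I_n * L)%type.
Variables (F : freemod k (seq L)) (FF : freemod k (seq L * seq L)).
Variables (Fn : freemod k (seq Ln)) (FFn : freemod k (seq Ln * seq Ln)).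
Notation mon := (@fmono k _ Fn).
Notation ndg := (@ndg L dg n).
Notation mo := (@fmono k L F).
Notation wdeg := (Defs.wdeg dg).
Notation wdegn := (Defs.wdeg ndg).
Notation pn := (@pn k L n F Fn).
Notation pw := (@pw k L n Fn).
Variables (S : F -> Prop) (N : int) (vp : L -> L -> k).
Notation Sn := (@rep_rel k L dg n F Fn S).
Hypothesis vp_deg : forall a b, vp a b != 0 -> dg a + dg b + N = 0.
Hypothesis S_graded : graded_gen dg S.
Notation dd := (@dd k L dg F FF vp).
Notation phi := (@phi k L dg F FF vp).
Notation phin := (phin Fn phi).

Definition np (a b : Ln) : k := ((a.1.1 == b.1.2) && (a.1.2 == b.1.1))%:R * vp a.2 b.2.

Lemma np_deg a b : np a b != 0 -> ndg a + ndg b + N = 0.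
Proof. by rewrite mulf_eq0 negb_or => /andP[_]; apply: vp_deg. Qed.

(** The commutative counterpart of [phi]: the contracted letter is removed and the two remaining
    pieces are joined without rotation. *)
Fixpoint psl (V : seq Ln) (c : Ln) : Fn :=
  if V is a :: r then
    (sg k (ndg a * wdegn r) * np a c) *: mon r + mon [:: a] ** psl r c
  else 0.
Notation pslF := (@phiF k Ln Ln Fn Fn psl).

Lemma pslF_cons a d u c : isdeg ndg d u ->
  pslF (mon [:: a] ** u) c = (sg k (ndg a * d) * np a c) *: u + mon [:: a] ** pslF u c.
Proof.
move: u; apply: isdeg_lin => [||w <-].
- by apply: linear_phiF; lin.
- apply: linear_add; first by lin.
  by apply: linear_comp; apply: phiF_linear.
by rewrite moM !phiF_mo.
Qed.

(** The Kronecker symbols of [np] force the contracted letter to carry the indices (j, i). They cut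
    the matrix product at this letter, and the cut is the double derivation [dd] written in matrix
    entries. *)
Lemma pslF_pw p q i j b v : pslF (pw v p q) (i, j, b) =
  lww (fun x y => pw x p j ** pw y i q) (dd b v).
Proof.
elim: v p => [|a r IH] p.
  by rewrite [RHS]linear0 /=; case: eqP => _; rewrite ?phiF_mo ?phiF0.
rewrite /= phiF_sum linearD linearZ /= lwwE.
under eq_bigr => l _ do rewrite (pslF_cons _ _ (pw_hom _ _ _ _ _)) IH.
rewrite big_split /=; congr (_ + _).
  rewrite (bigD1 i) //= big1 ?addr0 => [|l li].
    rewrite /np /= eqxx andbT; case: eqP => [->|_]; first by rewrite mul1F mul1r.
    by rewrite mul0F scaler0 mul0r mulr0 scale0r.
  by rewrite /np /= (negPf li) andbF mul0r mulr0 scale0r.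
move: (dd b r); apply: frAA_lin => [||x y].
- by apply: linear_bigsum => l; lin.
- by lin.
rewrite lml_pm lwwE /= mulF_suml.
by apply: eq_bigr => l _; rewrite lwwE mulFA.
Qed.

Definition trn (u : F) : Fn := \sum_i pn i i u.
HB.instance Definition _ := GRing.isLinear.Build k F Fn _ trn
  (linear_bigsum _ _ (fun i => linearP (pn i i))).

Lemma trn_hom d u : isdeg dg d u -> isdeg ndg d (trn u).
Proof. by move=> h; apply: span_sum => i _; apply: pn_hom. Qed.

(** For p = q the two pieces of [pslF_pw] can be multiplied in the opposite order at the cost of a
    graded commutator; the sum over p is then the matrix product which gives the entry of the
    rotated word. *)
Lemma pslF_trn v c : idl Sn (pslF (trn (mo v)) c - phin v c).
Proof.
case: c => [[i j] b]; rewrite /trn phiF_sum.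
under eq_bigr => p _ do rewrite pn_mo pslF_pw.
rewrite /phin /onletters /= /phi.
move: (dd b v); apply: frAA_lin_span => [|x y].
  apply: linear_add; last by lin.
  by apply: linear_bigsum => p; lin.
under eq_bigr => p _ do rewrite lwwE.
rewrite be_pm pnZ pn_mo pw_cat scaler_sumr -sumrB; apply: span_sum => p _.
have := comm_pw dg Fn S x y p j i p.
by [].
Qed.

Notation opn := (@op k L Ln dg ndg F Fn N phin).
Notation opTn := (@opT k L Ln dg ndg F Fn FFn N phin).
Notation pois := (@op k Ln Ln ndg ndg Fn Fn N psl).
Notation poisT := (@opT k Ln Ln ndg ndg Fn Fn FFn N psl).

Lemma pois_trn u x : idl Sn (pois (trn u) x - opn u x).
Proof.
move: u; apply: frA_lin_span => [|v].
  by apply: linear_add; [|apply: linear_opp]; apply: linear_op; lin.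
rewrite op_mo (op_hom _ _ _ _ (trn_hom (isdeg_mo F dg v))).
by apply: gder_congr => c; apply: pslF_trn.
Qed.

Lemma poisT_trn u p : tidl Sn (poisT (trn u) p - opTn u p).
Proof.
move: u; apply: frA_lin_span => [|v].
  by apply: linear_add; [|apply: linear_opp]; apply: linear_opT; lin.
rewrite opT_mo (opT_hom _ _ _ _ (trn_hom (isdeg_mo F dg v))).
by apply: gderT_congr => c; apply: pslF_trn.
Qed.

End Poisson.

(** * Differential forms *)

Section Omega.
Variables (k : fieldType) (L : choiceType) (dg : L -> int).
Variables (F : freemod k (seq L)) (FF : freemod k (seq L * seq L)).
Notation mo := (@fmono k L F).
Notation pm := (@fpmono k L FF).
Notation ten := (@ten k L F FF).
Notation mum := (@mum k L F FF).
Notation wdeg := (Defs.wdeg dg).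
Variable S : F -> Prop.

Definition bic (x : seq L) (p : FF) : FF :=
  lww (fun v w => pm (x ++ v) w - sg k (wdeg x * (wdeg v + wdeg w)) *: pm v (w ++ x)) p.
HB.instance Definition _ x := GRing.isLinear.Build k FF FF _ (bic x) (fm_ext_linear _).
Definition bicF (u : F) (p : FF) : FF := lw (fun x => bic x p) u.

Lemma bic_pm x v w : bic x (pm v w) =
  pm (x ++ v) w - sg k (wdeg x * (wdeg v + wdeg w)) *: pm v (w ++ x).
Proof. exact: lwwE. Qed.

Lemma bicD x p q : bic x (p + q) = bic x p + bic x q. Proof. exact: linearD. Qed.
Lemma bicB x p q : bic x (p - q) = bic x p - bic x q. Proof. exact: linearB. Qed.
Lemma bicZ x c p : bic x (c *: p) = c *: bic x p. Proof. exact: linearZ. Qed.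

Lemma bicF_linear u : linear (bicF u).
Proof.
move=> a p q; move: u; apply: frA_lin => [||x].
- exact: linearP.
- by apply: linear_add; [apply: linear_scale|]; apply: linearP.
by rewrite /bicF !lwE linearP.
Qed.
HB.instance Definition _ u := GRing.isLinear.Build k FF FF _ (bicF u) (bicF_linear u).

Lemma bicF_hom d u v w : isdeg dg d u ->
  bicF u (pm v w) = ten (u ** mo v) (mo w)
    - sg k (d * (wdeg v + wdeg w)) *: ten (mo v) (mo w ** u).
Proof.
move: u; apply: isdeg_lin => [||z <-].
- exact: linearP.
- by lin.
by rewrite /bicF lwE bic_pm !moM !ten_mo.
Qed.

Lemma bic_ten x i j u v : isdeg dg i u -> isdeg dg j v ->
  bic x (ten u v) = ten (mo x ** u) v - sg k (wdeg x * (i + j)) *: ten u (v ** mo x).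
Proof.
move=> hu hv; move: u hu; apply: isdeg_lin => [||y <-]; [by lin..|].
move: v hv; apply: isdeg_lin => [||z <-]; [by lin..|].
by rewrite ten_mo bic_pm !moM !ten_mo.
Qed.

Definition om1 (p : FF) : Prop :=
  (exists u v, (idl S u \/ idl S v) /\ p = ten u v) \/
  exists x q, idl S (mum q) /\ p = bic x q.

Lemma om1_tidl p : tidl S p -> span om1 p.
Proof. by apply: span_sub => q Sq; apply: span_gen; left. Qed.

Lemma om1_bic u q : idl S (mum q) -> span om1 (bicF u q).
Proof.
move=> h; move: u; apply: frA_lin_span => [|x]; first exact: linearP.
by rewrite /bicF lwE; apply: span_gen; right; exists x, q.
Qed.

Section Der.
Variables (e : int) (f : L -> F).
Hypothesis fh : forall a, isdeg dg (e + dg a) (f a).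

Lemma gderT_bic x q : gderT dg e f (bic x q) =
  bicF (gder dg e f (mo x)) q + sg k (e * wdeg x) *: bic x (gderT dg e f q).
Proof.
move: q; apply: frAA_lin => [||v w]; [by lin..|].
have hv := gder_isdeg fh (isdeg_mo F dg v); have hw := gder_isdeg fh (isdeg_mo F dg w).
have hx := gder_isdeg fh (isdeg_mo F dg x).
rewrite (bicF_hom _ _ hx) bic_pm -!(ten_mo F) -!moM gderTD gderTN gderTZ !gderT_ten.
rewrite bicD sgm_mo !tenZl bicZ.
rewrite (bic_ten _ hv (isdeg_mo F dg w)) (bic_ten _ (isdeg_mo F dg v) hw).
rewrite !gderM !sgmM !sgm_mo !(mulFZl, mulFZr, tenDl, tenDr, tenZl, tenZr).
by lmod k; sgring.
Qed.
End Der.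

Definition dn (u : F) : FF := lw (fun w => pm w [::] - pm [::] w) u.
HB.instance Definition _ := GRing.isLinear.Build k F FF _ dn (fm_ext_linear _).

Lemma dnE u : dn u = ten u (mo [::]) - ten (mo [::]) u.
Proof.
move: u; apply: frA_lin => [||w]; [by lin..|].
by rewrite !ten_mo; apply: lwE.
Qed.

Lemma mum_dn u : mum (dn u) = 0.
Proof. by rewrite dnE linearB /= !mum_ten mul1F mulF1 subrr. Qed.

Lemma be_dn u : be dg F (dn u) = 0.
Proof.
move: u; apply: frA_lin => [||w]; [by lin|exact: linear_0|].
rewrite dnE linearB /= !ten_mo !be_pm !cats0 /= wdeg_nil mulr0 mul0r.
by rewrite subrr.
Qed.

Lemma gderT_dn e f u : gderT dg e f (dn u) = dn (gder dg e f u).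
Proof.
rewrite !dnE gderTD gderTN !gderT_ten gder1 [ten _ 0]linear0 ten0l.
have -> : sgm dg e (mo [::]) = mo [::] by rewrite sgm_mo wdeg_nil mulr0 scale1r.
by rewrite addr0 add0r.
Qed.

Lemma dn_idl u : idl S u -> tidl S (dn u).
Proof. by move=> h; rewrite dnE; apply: spanB; [apply: tidl_l|apply: tidl_r]. Qed.

(** With s the Koszul sign, dn (vw - s wv) equals bic v (dn w) - s bic w (dn v), and [dn] takes
    values in Omega^1. So the universal derivation passes to commutator quotients. *)
Lemma dn_comm v w : span om1 (dn (mo (v ++ w) - sg k (wdeg v * wdeg w) *: mo (w ++ v))).
Proof.
have h x : idl S (mum (dn x)) by rewrite mum_dn; apply: span0.
have h1 := span_gen (or_intror (ex_intro _ v (ex_intro _ _ (conj (h (mo w)) erefl)))) : span om1 (bic v (dn (mo w))).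
have h2 := span_gen (or_intror (ex_intro _ w (ex_intro _ _ (conj (h (mo v)) erefl)))) : span om1 (bic w (dn (mo v))).
have := spanB h1 (spanZ (sg k (wdeg v * wdeg w)) h2).
apply: span_eq; rewrite linearB linearZ /= !dnE !ten_mo !bicB !bic_pm !wdeg_nil !cats0 /=.
rewrite tenZl tenZr !ten_mo.
by lmod k; sgring.
Qed.

End Omega.

Section Kaehler.
Variables (k : fieldType) (L : choiceType) (dg : L -> int).
Variables (F : freemod k (seq L)) (FF : freemod k (seq L * seq L)).
Notation mo := (@fmono k L F).
Notation ten := (@ten k L F FF).
Notation wdeg := (Defs.wdeg dg).
Variable S : F -> Prop.

(* u d(xy) - (u x) dy - (-1)^{|x||y|} (u y) dx *)
Definition leib (i j : int) (u x y : F) : FF :=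
  ten u (x ** y) - ten (u ** x) y - sg k (i * j) *: ten (u ** y) x.

Definition omrel (p : FF) : Prop :=
  (exists u v, (idl S u \/ idl S v) /\ p = ten u v) \/
  exists b c c', p = leib (wdeg c) (wdeg c') (mo b) (mo c) (mo c').

Lemma omrel_tidl p : tidl S p -> span omrel p.
Proof. by apply: span_sub => q Sq; apply: span_gen; left. Qed.

Lemma leib_hom i j u x y : isdeg dg i x -> isdeg dg j y -> span omrel (leib i j u x y).
Proof.
move=> hx hy; move: u; apply: frA_lin_span => [|b]; first by rewrite /leib; lin.
move: x hx; apply: isdeg_lin_span => [|c ci]; first by rewrite /leib; lin.
move: y hy; apply: isdeg_lin_span => [|c' ci']; first by rewrite /leib; lin.
by rewrite -ci -ci'; apply: span_gen; right; exists b, c, c'.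
Qed.

(** The Leibniz relation for the product 1 * 1 reduces to - u d(1). *)
Lemma leib1 u : span omrel (ten u (mo [::])).
Proof.
have h1 : isdeg dg 0 (mo [::]) by rewrite -(wdeg_nil dg); apply: isdeg_mo.
have := spanN (leib_hom u h1 h1); apply: span_eq.
by rewrite /leib !mulF1; lmod k; sgring.
Qed.

Section Der.
Variables (e : int) (f : L -> F).
Hypothesis fh : forall a, isdeg dg (e + dg a) (f a).
Hypothesis S_graded : graded_gen dg S.
Hypothesis f_S : forall s, S s -> idl S (gder dg e f s).

Lemma gderT_omrel p : omrel p -> span omrel (gderT dg e f p).
Proof.
case=> [h|[b [c [c' ->]]]].
  by apply/omrel_tidl/gderT_tidl => //; apply: span_gen.
have hc := gder_isdeg fh (isdeg_mo F dg c); have hc' := gder_isdeg fh (isdeg_mo F dg c').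
have h0 := leib_hom (gder dg e f (mo b)) (isdeg_mo F dg c) (isdeg_mo F dg c').
have h1 := leib_hom (mo b) hc (isdeg_mo F dg c').
have h2 := leib_hom (mo b) (isdeg_mo F dg c) hc'.
have := spanD h0 (spanD (spanZ (sg k (e * wdeg b)) h1)
                        (spanZ (sg k (e * (wdeg b + wdeg c))) h2)).
apply: span_eq; rewrite /leib !gderTD !gderTN !gderTZ !gderT_ten.
rewrite !gderM !sgmM !sgm_mo !(mulFZl, mulFZr, mulFDl, mulFDr, tenDl, tenDr, tenZl, tenZr).
by lmod k; sgring.
Qed.
End Der.
End Kaehler.

Section TraceOmega.
Variables (k : fieldType) (L : choiceType) (dg : L -> int) (n : nat).
Notation Ln := ('I_n * 'I_n * L)%type.
Variables (F : freemod k (seq L)) (FF : freemod k (seq L * seq L)).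
Variables (Fn : freemod k (seq Ln)) (FFn : freemod k (seq Ln * seq Ln)).
Notation tenn := (@ten k _ Fn FFn).
Notation ndg := (@ndg L dg n).
Notation mo := (@fmono k L F).
Notation pm := (@fpmono k L FF).
Notation mum := (@mum k L F FF).
Notation wdeg := (Defs.wdeg dg).
Notation pn := (@pn k L n F Fn).
Notation pw := (@pw k L n Fn).
Variables (S : F -> Prop) (S_graded : graded_gen dg S).
Notation Sn := (@rep_rel k L dg n F Fn S).
Notation omn := (@omrel k Ln ndg Fn FFn Sn).
Notation TO := (@TO k L n FF Fn FFn).

(** In Tr (v d(w x)) the Leibniz rule produces a term with dw, which cancels Tr (x v dw) once
    entries commute, and the term Tr (v w dx). The remainder thus depends only on the product v w,
    and it disappears when the multiplication map sends the tensor into the ideal. *)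
Lemma TO_bic_pm x v w : span omn (TO (bic dg x (pm v w))
  - \sum_i \sum_l tenn (pn i l (sgm dg (wdeg x) (mum (pm v w)))) (pw x l i)).
Proof.
(* The three traces are reindexed by the entries x_ab, v_bc, w_ca, so that the relation can be
   verified for each triple (a, b, c). *)
have E1 : \sum_i \sum_l tenn (pw (x ++ v) i l) (pw w l i)
    = \sum_a \sum_b \sum_c tenn (pw x a b ** pw v b c) (pw w c a).
  apply: eq_bigr => a _; rewrite exchange_big; apply: eq_bigr => c _ /=.
  by rewrite pw_cat ten_suml.
have E2 : \sum_i \sum_l tenn (pw v i l) (pw (w ++ x) l i)
    = \sum_a \sum_b \sum_c tenn (pw v b c) (pw w c a ** pw x a b).
  rewrite [RHS]exchange_big; apply: eq_bigr => b _ /=.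
  rewrite [RHS]exchange_big; apply: eq_bigr => c _ /=.
  by rewrite pw_cat linear_sum.
have E3 : \sum_i \sum_l tenn (pn i l (mo (v ++ w))) (pw x l i)
    = \sum_a \sum_b \sum_c tenn (pw v b c ** pw w c a) (pw x a b).
  rewrite exchange_big; apply: eq_bigr => a _ /=; apply: eq_bigr => b _.
  by rewrite pn_mo pw_cat ten_suml.
rewrite bic_pm linearB linearZ /= ![TO _]lwwE mum_pm sgm_mo wdeg_cat.
under [X in _ - X]eq_bigr => i _ do under eq_bigr => l _ do rewrite pnZ tenZl.
under [X in _ - X]eq_bigr => i _ do rewrite -scaler_sumr.
rewrite -scaler_sumr E1 E2 E3 scalerN opprK [- _ + _]addrC -addrA -opprD.
rewrite !scaler_sumr -big_split -sumrB; apply: span_sum => a _ /=.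
rewrite !scaler_sumr -big_split -sumrB; apply: span_sum => b _ /=.
rewrite !scaler_sumr -big_split -sumrB; apply: span_sum => c _ /=.
have h := leib_hom FFn Sn (pw v b c) (pw_hom dg Fn w c a) (pw_hom dg Fn x a b).
have h' := omrel_tidl ndg (tidl_l FFn (pw w c a) (comm_pw dg Fn S x v a b b c)).
have := spanB (spanZ (sg k (wdeg x * (wdeg v + wdeg w))) h) h'.
apply: span_eq; rewrite /leib tenBl tenZl.
by lmod k; sgring.
Qed.

Lemma TO_bic x q : idl S (mum q) -> span omn (TO (bic dg x q)).
Proof.
move=> h; set r := \sum_i \sum_l tenn (pn i l (sgm dg (wdeg x) (mum q))) (pw x l i).
apply: (@span_cong _ _ _ _ r); last first.
  apply: span_sum => i _; apply: span_sum => l _; apply/omrel_tidl/tidl_l/pn_idl.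
  exact: sgm_idl.
rewrite /r; move: q {h r}; apply: frAA_lin_span => [|v w]; last exact: TO_bic_pm.
by lin.
Qed.

Lemma TO_om1 p : om1 dg S p -> span omn (TO p).
Proof.
case=> [h|[x [q [h ->]]]]; last exact: TO_bic.
by apply/omrel_tidl/TO_tidl; apply: span_gen.
Qed.

End TraceOmega.

(** * The definitions of the statement in terms of free modules *)

(* locked so that conversion tests do not unfold elements of {malg k[_]} *)
HB.lock Definition malg_word (k : fieldType) (L : choiceType) (w : seq L) : frA k L :=
  mono k w.
HB.lock Definition malg_pair (k : fieldType) (L : choiceType) (q : seq L * seq L) :
  frAA k L := pmono k q.1 q.2.
HB.lock Definition malg_ext (k : fieldType) (L : choiceType) (V : lmodType k)
  (f : seq L -> V) (u : frA k L) : V := lext (fun w : {fmonom L} => f w) u.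
HB.lock Definition malg_ext2 (k : fieldType) (L : choiceType) (V : lmodType k)
  (f : seq L * seq L -> V) (p : frAA k L) : V := lext f p.

Section Concrete.
Variables (k : fieldType) (L : choiceType).

Fact malg_ext_linear (V : lmodType k) (f : seq L -> V) : linear (@malg_ext k L V f).
Proof. by rewrite malg_ext.unlock; apply: linearP. Qed.
Fact malg_ext2_linear (V : lmodType k) (f : seq L * seq L -> V) :
  linear (@malg_ext2 k L V f).
Proof. by rewrite malg_ext2.unlock; apply: linearP. Qed.
Fact malg_extE (V : lmodType k) (f : seq L -> V) w : malg_ext f (malg_word k w) = f w.
Proof. by rewrite malg_ext.unlock malg_word.unlock; apply: lextU. Qed.
Fact malg_ext2E (V : lmodType k) (f : seq L * seq L -> V) q :
  malg_ext2 f (malg_pair k q) = f q.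
Proof. by rewrite malg_ext2.unlock malg_pair.unlock; case: q => v w; apply: lextU. Qed.

Fact malg_word_span (u : frA k L) : span (fun v => exists w, v = malg_word k w) u.
Proof.
rewrite malg_word.unlock; move: u; apply: (@malg_lin_span _ _ _ _ id) => // -[w].
by apply: span_gen; exists w.
Qed.
Fact malg_pair_span (u : frAA k L) : span (fun v => exists q, v = malg_pair k q) u.
Proof.
rewrite malg_pair.unlock; move: u; apply: (@malg_lin_span _ _ _ _ id) => // q.
by apply: span_gen; exists q; case: q.
Qed.

Definition fr : freemod k (seq L) :=
  FreeMod malg_ext_linear malg_extE malg_word_span.
Definition frr : freemod k (seq L * seq L) :=
  FreeMod malg_ext2_linear malg_ext2E malg_pair_span.

Notation F := (frA k L).
Notation FF := (frAA k L).

Lemma monoE w : mono k w = fmono fr w :> F.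
Proof. by rewrite /fmono /fm_gen /= malg_word.unlock. Qed.
Lemma pmonoE v w : pmono k v w = fpmono frr v w :> FF.
Proof. by rewrite /fpmono /fm_gen /= malg_pair.unlock. Qed.
Notation mo := (fmono fr).
Lemma oneE : (1 : F) = mo [::].
Proof. by rewrite -monoE mono0. Qed.

Lemma lextE (V : lmodType k) (f : seq L -> V) (u : F) :
  lext (fun w : {fmonom L} => f w) u = lw (F := fr) f u.
Proof. by rewrite /lw /fm_ext /= malg_ext.unlock. Qed.
Lemma lextE2 (V : lmodType k) (f : seq L * seq L -> V) (p : FF) :
  lext f p = lww (FF := frr) (fun v w => f (v, w)) p.
Proof.
rewrite /lww /fm_ext /= malg_ext2.unlock; by apply: lext_ext => -[].
Qed.

Lemma mulE (u v : F) : u * v = mulF (F := fr) u v.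
Proof.
move: u; apply: (@frA_lin _ _ fr) => [a x y||x]; first by rewrite mulrDl scalerAl.
  by lin.
move: v; apply: (@frA_lin _ _ fr) => [a z y||y]; first by rewrite mulrDr frA_scalerAr.
  by lin.
by rewrite moM -!monoE monoM.
Qed.

Lemma tensE (u v : F) : tens u v = ten frr (F := fr) u v.
Proof.
rewrite /tens /lext2 (lextE (fun w => lext (fun w' : {fmonom L} => pmono k w w') v)).
apply: lw_ext => w; rewrite (lextE (fun w' => pmono k w w')).
by apply: lw_ext => w'; rewrite pmonoE.
Qed.

Lemma mulmE (p : FF) : mulm p = mum fr (FF := frr) p.
Proof. by rewrite /mulm lextE2; apply: lww_ext => v w; rewrite monoE. Qed.

Lemma augE (u : F) : aug u = au (F := fr) u.
Proof.
move: u; apply: (@frA_lin _ _ fr k^o) => [a x y||w]; [|by lin|].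
  by rewrite /aug mcoeffD mcoeffZ.
rewrite /au lwE -monoE /aug mcoeffU; case: w => [|a w]; first by rewrite eqxx.
by rewrite -val_eqE.
Qed.

Lemma augIE (u : F) : augI u = u - au (F := fr) u *: mo [::].
Proof. by rewrite /augI augE oneE. Qed.

Lemma idealE (S : F -> Prop) u : ideal S u <-> idl (F := fr) S u.
Proof.
by split; apply: span_sub => _ [w [s [w' [Ss ->]]]]; apply: span_gen;
  exists w, s, w'; split=> //; rewrite !mulE !monoE.
Qed.

Lemma trelE (S : F -> Prop) p : trel (ideal S) p <->
  exists u v, (idl (F := fr) S u \/ idl (F := fr) S v) /\ p = ten frr (F := fr) u v.
Proof.
by split=> -[u [v [uv ->]]]; exists u, v; rewrite tensE; split=> //;
  case: uv => /idealE; [left|right|left|right].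
Qed.

Lemma malg_homog (K : choiceType) (d : K -> int) i (u : {malg k[K]}) :
  span (fun v => exists2 x, d x = i & v = << x >>) u <-> homog d i u.
Proof.
split=> [|h]; first elim=> [|a x y [z dz ->] _ hy].
- exact: homog0.
- by apply: homog_lin => //; rewrite -dz; apply: homogU.
move: u h; apply: homog_ind => [|a u v hu hv|x dx]; first exact: span0.
  by apply: spanD => //; apply: spanZ.
by apply: span_gen; exists x.
Qed.

Section Degree.
Variable dg : L -> int.

Lemma homFE i (u : F) : homF dg i u <-> isdeg (F := fr) dg i u.
Proof.
rewrite -[homF dg i u]malg_homog; split; apply: span_sub => v.
  by case=> -[w] wi ->; apply: span_gen; exists w => //; rewrite -monoE.
by case=> w wi ->; apply: span_gen; exists (FMonom w) => //; rewrite -monoE.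
Qed.

Lemma homFFE i (p : FF) : homFF dg i p <-> isdegT (FF := frr) dg i p.
Proof.
rewrite -[homFF dg i p]malg_homog; split; apply: span_sub => q.
  by case=> -[v w] wi ->; apply: span_gen; exists v, w; rewrite -pmonoE.
by case=> v [w [wi ->]]; apply: span_gen; exists (v, w) => //; rewrite -pmonoE.
Qed.

Lemma derwE d w : derw dg d w = gderw (F := fr) dg (-1) d w.
Proof.
elim: w => [|a w IH]; first exact: erefl.
have e1 : d a * mono k w = mulF (F := fr) (d a) (mo w) by rewrite mulE monoE.
have e2 : mono k [:: a] * derw dg d w = mulF (F := fr) (mo [:: a]) (gderw (F := fr) dg (-1) d w).
  by rewrite mulE monoE IH.
have e3 : sg k (dg a) = sg k (-1 * dg a) by rewrite mulN1r sgN.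
(* One side is written with the operations of [frA k L], the other with those of [fr k L]. The
   explicit congruence leaves their identification to conversion. *)
exact: (eq_trans (f_equal2 (fun x y : F => x + sg k (dg a) *: y) e1 e2)
  (f_equal (fun c => mulF (F := fr) (d a) (mo w) + c *: mulF (F := fr) (mo [:: a]) (gderw (F := fr) dg (-1) d w)) e3)).
Qed.

Lemma derE d (u : F) : der dg d u = gder (F := fr) dg (-1) d u.
Proof. by rewrite /der lextE; apply: lw_ext => w; rewrite derwE. Qed.

Lemma derTE d (p : FF) : derT dg d p = gderT (F := fr) (FF := frr) dg (-1) d p.
Proof.
rewrite /derT lextE2; apply: lww_ext => v w /=.
by rewrite !tensE !derwE !monoE mulN1r sgN.
Qed.

Lemma actTE (N : int) (b : seq L -> seq L -> F) (phi : seq L -> L -> F) (u : F) (p : FF) :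
  (forall v w, b v w = gderw (F := fr) dg (Defs.wdeg dg v + N) (phi v) w) ->
  actT dg N b u p = opT (F := fr) (F' := fr) (FF' := frr) dg dg N phi u p.
Proof.
move=> h; rewrite /actT /lext2 (lextE (fun x => lext (fun q : seq L * seq L =>
    tens (b x q.1) (mono k q.2)
    + sg k ((Defs.wdeg dg x + N) * Defs.wdeg dg q.1) *: tens (mono k q.1) (b x q.2)) p)).
apply: lw_ext => v; rewrite lextE2; apply: lww_ext => x y /=.
by rewrite !tensE !h !monoE.
Qed.

Lemma bilE (N : int) (b : seq L -> seq L -> F) (phi : seq L -> L -> F) (u v : F) :
  (forall v w, b v w = gderw (F := fr) dg (Defs.wdeg dg v + N) (phi v) w) ->
  lext2 (fun s t : {fmonom L} => b s t) u v = op (F := fr) (F' := fr) dg dg N phi u v.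
Proof.
move=> h; rewrite /lext2 (lextE (fun s => lext (fun t : {fmonom L} => b s t) v)).
by apply: lw_ext => x; rewrite (lextE (b x)); apply: lw_ext => y; rewrite h.
Qed.
End Degree.
End Concrete.

(** * The cobar construction: homogeneous representatives and relations *)

Section CobarData.
Variables (k : fieldType) (C : dgcoalg k).
Notation L := (hletter C).
Notation F := (frA k L).
Notation fL := (fr k L).
Notation mo := (fmono fL).
Notation dg := (@vdeg k C).
Notation S := (@Rgen k C).

Lemma genE i (x : C i) : gen x = mo [:: hl x].
Proof. exact: monoE. Qed.

Lemma isdeg_gen i (x : C i) : isdeg dg (i - 1) (mo [:: hl x]).
Proof. exact: (isdeg_letter fL dg (hl x)). Qed.

Lemma Rgen_graded : graded_gen (F := fL) dg S.
Proof.
move=> s [[i [a [x [y ->]]]]|->]; last first.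
  by exists (0 - 1); rewrite genE; apply: isdeg_gen.
exists (i - 1); rewrite !genE.
by apply: spanB; [apply: spanB; [|apply: spanZ]|]; apply: isdeg_gen.
Qed.

Lemma Rgen_letter s : S s -> span (fun u => exists a, u = mo [:: a]) s.
Proof.
have h i (x : C i) : span (fun u => exists a, u = mo [:: a]) (mo [:: hl x]).
  by apply: span_gen; exists (hl x).
move=> [[i [a [x [y ->]]]]|->]; last by rewrite genE.
by rewrite !genE; apply: spanB; [apply: spanB; [|apply: spanZ]|].
Qed.

Lemma Rgen_lpart (V : lmodType k) (f : L -> V) s :
  (forall i, linear (fun x : C i => f (hl x))) -> f (hl (coone C)) = 0 ->
  S s -> lpart (F := fL) f s = 0.
Proof.
move=> lf f1 [[i [a [x [y ->]]]]|->]; last by rewrite genE lpart_letter.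
rewrite !genE !linearB linearZ /= !lpart_letter lf.
by rewrite [X in X - _]addrAC subrr add0r subrr.
Qed.

Lemma Rrel_idl u : Rrel u <-> idl (F := fL) S u.
Proof. exact: idealE. Qed.

Section Quadratic.
(** The chosen lift of a coproduct may contain words of any length. Multilinearity preserves length,
    so the class is read off from the words of length two. *)
Definition qpart (V : lmodType k) (f : L -> L -> V) (u : F) : V :=
  lw (F := fL) (fun w => if w is [:: b; c] then f b c else 0) u.
HB.instance Definition _ (V : lmodType k) (f : L -> L -> V) := GRing.isLinear.Build k F V _ (@qpart V f)
  (@fm_ext_linear k _ fL _ _).

Lemma qpart_mo (V : lmodType k) (f : L -> L -> V) b c : @qpart V f (mo [:: b; c]) = f b c.
Proof. exact: lwE. Qed.

(** A multiple of a multilinearity relation has length two only if one letter is added, on the left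
    or on the right. Hence linearity of [f] modulo [T] in each argument suffices. *)
Lemma qpart_multilin (V : lmodType k) (f : L -> L -> V) (T : V -> Prop) :
  (forall i a (x y : C i) c,
     span T (f (hl (a *: x + y)) c - a *: f (hl x) c - f (hl y) c)) ->
  (forall i a (x y : C i) b,
     span T (f b (hl (a *: x + y)) - a *: f b (hl x) - f b (hl y))) ->
  forall u, ideal (@multilin k C) u -> span T (qpart f u).
Proof.
move=> hl1 hl2 u /idealE; move: u; apply: (@idl_lin _ _ fL).
  exact: linearP.
move=> v s w [i [a [x [y ->]]]]; rewrite !genE !(mulFBl, mulFBr, mulFZl, mulFZr) !moM.
rewrite !linearB !linearZ /=.
have z : span T 0 by exact: span0.
case: v => [|b [|b' v]]; case: w => [|c [|c' w]]; rewrite /= /qpart !lwE ?scaler0 ?subr0 //.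
all: rewrite ?oppr0 ?scaler0 ?addr0 ?scalerN //.
all: try by [apply: hl1|apply: hl2].
all: by case: v => [|? ?] /=; rewrite ?scaler0 ?subr0 ?oppr0 ?addr0.
Qed.
End Quadratic.

Lemma dgenE a : dgen a = - mo [:: hl (cd _ (tagged a))]
  + qpart (fun b c => sg k (hdeg b) *: mo [:: b; c]) (copr (tagged a)).
Proof.
rewrite /dgen genE; congr (_ + _).
rewrite /qpart -(lextE (fun w => if w is [:: b; c] then sg k (hdeg b) *: mo [:: b; c] else 0)).
apply: lext_ext => -[w] /=; case: w => [|b [|c [|? ?]]].
- exact: erefl.
- exact: erefl.
- by rewrite monoE.
- exact: erefl.
Qed.

Lemma qpart_quad (V : lmodType k) (f : L -> L -> V) i u :
  span (fun v => exists a b, hdeg a + hdeg b = i /\ v = mono k [:: a; b]) u ->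
  exists2 s : seq (k * L * L), (forall t, t \in s -> hdeg t.1.2 + hdeg t.2 = i)
    & u = \sum_(t <- s) t.1.1 *: mo [:: t.1.2; t.2].
Proof.
elim=> [|c _ v [a [b [ab ->]]] _ [s sP ->]]; first by exists [::]; rewrite ?big_nil.
exists ((c, a, b) :: s); last by rewrite big_cons monoE.
by move=> t; rewrite inE => /orP[/eqP ->|/sP].
Qed.

(** The lift [copr] need be neither quadratic nor homogeneous; [coprod_deg] supplies a
    representative that is both and is congruent to it. *)
Lemma coprod_quad (a : L) : exists2 s : seq (k * L * L),
  (forall t, t \in s -> hdeg t.1.2 + hdeg t.2 = hdeg a)
  & ideal (@multilin k C) (copr (tagged a) - \sum_(t <- s) t.1.1 *: mo [:: t.1.2; t.2]).
Proof.
case: a => i x /=; have [u eu /(qpart_quad (fun _ _ => (0 : k^o)))[s sP us]] := coprod_deg x.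
exists s; rewrite -?us //.
suff h : span (ideal (@multilin k C)) (copr x - u) by move: h; apply: span_sub.
by apply/qclsP; rewrite -[RHS]eu; apply: qrepK.
Qed.

(* a homogeneous representative of the coproduct modulo multilinearity *)
Definition cop (a : L) : seq (k * L * L) := projT1 (cid2 (coprod_quad a)).

Lemma cop_deg a t : t \in cop a -> hdeg t.1.2 + hdeg t.2 = hdeg a.
Proof. by rewrite /cop; case: cid2 => /= s sP _ /sP. Qed.

Lemma copE a : ideal (@multilin k C)
  (copr (tagged a) - \sum_(t <- cop a) t.1.1 *: mo [:: t.1.2; t.2]).
Proof. by rewrite /cop; case: cid2. Qed.

Lemma qpart_cop (V : lmodType k) (f : L -> L -> V) (T : V -> Prop) a :
  (forall i a (x y : C i) c,
     span T (f (hl (a *: x + y)) c - a *: f (hl x) c - f (hl y) c)) ->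
  (forall i a (x y : C i) b,
     span T (f b (hl (a *: x + y)) - a *: f b (hl x) - f b (hl y))) ->
  span T (qpart f (copr (tagged a)) - \sum_(t <- cop a) t.1.1 *: f t.1.2 t.2).
Proof.
move=> f1 f2; have := qpart_multilin f1 f2 (copE a).
rewrite linearB linear_sum /=; apply: span_eq; congr (_ - _).
by apply: eq_bigr => t _; rewrite linearZ /= qpart_mo.
Qed.

(** The desuspension sign of the cobar differential is absorbed into the coefficients. *)
Definition cpd (a : L) : seq (k * L * L) :=
  [seq (t.1.1 * sg k (hdeg t.1.2), t.1.2, t.2) | t <- cop a].
Definition d1 (a : L) : L := hl (cd _ (tagged a)).
Notation dl := (delta fL d1 cpd).

Lemma d1_deg a : dg (d1 a) = dg a - 1.
Proof. by []. Qed.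

Lemma cpd_deg a t : t \in cpd a -> dg t.1.2 + dg t.2 = dg a - 1.
Proof.
case/mapP=> u /cop_deg ua -> /=; rewrite /vdeg -ua; by ring.
Qed.

Let quad_lin1 i (a : k) (x y : C i) c : idl (F := fL) S
  (sg k (hdeg (hl (a *: x + y))) *: mo [:: hl (a *: x + y); c]
   - a *: (sg k (hdeg (hl x)) *: mo [:: hl x; c]) - sg k (hdeg (hl y)) *: mo [:: hl y; c]).
Proof.
have h : S (gen (a *: x + y) - a *: gen x - gen y) by left; exists i, a, x, y.
have := spanZ (sg k i) (idl_mulr (mo [:: c]) (idl_gen (F := fL) h)).
apply: span_eq; rewrite !genE !(mulFBl, mulFZl) !moM /hdeg /=.
by lmod k; ring.
Qed.

Let quad_lin2 i (a : k) (x y : C i) b : idl (F := fL) S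
  (sg k (hdeg b) *: mo [:: b; hl (a *: x + y)]
   - a *: (sg k (hdeg b) *: mo [:: b; hl x]) - sg k (hdeg b) *: mo [:: b; hl y]).
Proof.
have h : S (gen (a *: x + y) - a *: gen x - gen y) by left; exists i, a, x, y.
have := spanZ (sg k (hdeg b)) (idl_mull (mo [:: b]) (idl_gen (F := fL) h)).
apply: span_eq; rewrite !genE !(mulFBr, mulFZr) !moM /=.
by lmod k; ring.
Qed.

Lemma dgen_delta a : idl (F := fL) S (dgen a - dl a).
Proof.
have := @qpart_cop fL (fun b c => sg k (hdeg b) *: mo [:: b; c]) _ a quad_lin1 quad_lin2.
apply: span_eq; rewrite dgenE /delta -/(d1 a) big_map opprD addrACA subrr add0r.
congr (_ - _); apply: eq_bigr => t _ /=; by rewrite scalerA.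
Qed.

Lemma copr_multilin i (a : k) (x y : C i) :
  ideal (@multilin k C) (copr (a *: x + y) - a *: copr x - copr y).
Proof.
suff h : span (ideal (@multilin k C)) (copr (a *: x + y) - (a *: copr x + copr y)).
  by move: h; rewrite opprD addrA; apply: span_sub.
apply/qclsP; rewrite [RHS]linearP /= /copr /trep !qrepK.
exact: linearP.
Qed.

Lemma copr_coone : ideal (@multilin k C) (copr (coone C) - mo [:: hl (coone C); hl (coone C)]).
Proof.
suff h : span (ideal (@multilin k C)) (copr (coone C) - mo [:: hl (coone C); hl (coone C)]).
  by move: h; apply: span_sub.
by rewrite -monoE; apply/qclsP; rewrite /copr /trep qrepK; apply: coprod_one.
Qed.

Lemma gen_idl i (a : k) (x y : C i) :
  idl (F := fL) S (mo [:: hl (a *: x + y)] - a *: mo [:: hl x] - mo [:: hl y]).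
Proof. by rewrite -!genE; apply: (@idl_gen _ _ fL); left; exists i, a, x, y. Qed.

(** The letter 0 is a nonzero word; it is the relation of multilinearity for 1 *: 0 + 0, up to
    sign. *)
Lemma gen0_idl i (z : C i) : z = 0 -> idl (F := fL) S (mo [:: hl z]).
Proof.
move=> ->.
have e : 1 *: (0 : C i) + (0 : C i) = (0 : C i) by rewrite scaler0 addr0.
have := spanN (gen_idl 1 (0 : C i) (0 : C i)); rewrite e.
by apply: span_eq; lmod k; ring.
Qed.

Lemma dgen_multilin i (a : k) (x y : C i) :
  idl (F := fL) S (dgen (hl (a *: x + y)) - a *: dgen (hl x) - dgen (hl y)).
Proof.
have h := @qpart_multilin fL (fun b c => sg k (hdeg b) *: mo [:: b; c]) _
  quad_lin1 quad_lin2 _ (copr_multilin a x y).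
have := spanB h (gen_idl a (cd i x) (cd i y)).
apply: span_eq; rewrite !dgenE /= !linearB linearZ /=.
rewrite (_ : cd i (a *: x + y) = a *: cd i x + cd i y); last exact: linearP.
by lmod k; ring.
Qed.

(** The linear part vanishes because the coaugmentation is a cycle, and the quadratic part is a
    multiple of the letter 1, since 1 is grouplike. *)
Lemma dgen_coone : idl (F := fL) S (dgen (hl (coone C))).
Proof.
have h := @qpart_multilin fL (fun b c => sg k (hdeg b) *: mo [:: b; c]) _
  quad_lin1 quad_lin2 _ copr_coone.
have h1 : idl (F := fL) S (mo [:: hl (coone C)]).
  by rewrite -genE; apply: (@idl_gen _ _ fL); right.
have := spanB (spanD h (idl_mulr (mo [:: hl (coone C)]) h1)) (gen0_idl (cd_one C)).
apply: span_eq; rewrite dgenE /= moM linearB /= qpart_mo [hdeg _]/= scale1r.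
by lmod k; ring.
Qed.

Lemma delta_Rgen s : S s -> idl (F := fL) S (gder dg (-1) dl s).
Proof.
have E a b : idl (F := fL) S (dgen a - b) -> idl (F := fL) S (dl a - b).
  by apply: span_trans; apply/spanBC/dgen_delta.
case=> [[i [a [x [y ->]]]]|->]; last first.
  rewrite genE gder_letter -[dl _]subr0; apply: E; rewrite subr0; exact: dgen_coone.
rewrite !genE !gderD !gderN gderZ !gder_letter -addrA -opprD; apply: E.
have := spanD (dgen_multilin a x y)
  (spanD (spanZ a (dgen_delta (hl x))) (dgen_delta (hl y))).
by apply: span_eq; lmod k; ring.
Qed.

Variables (m : int) (P : cyclic_pairing C m).
Notation vp := (vpair P).

Lemma vpair_deg a b : vp a b != 0 -> dg a + dg b + (m + 2) = 0.
Proof.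
move=> h; have -> : dg a + dg b + (m + 2) = hdeg a + hdeg b + m by rewrite /vdeg; ring.
apply/eqP; apply: contraNT h => h.
by rewrite /vpair (cpair_deg P) ?mulr0.
Qed.

Lemma cpair_oner j (y : C j) : cpair P y (coone C) = 0.
Proof. by rewrite cpair_sym cpair_one mulr0. Qed.

Lemma vpair_Rgenl s b : S s -> lpart (F := fL) (fun a => vp a b : k^o) s = 0.
Proof.
apply: Rgen_lpart => [i c x y|]; last by rewrite /vpair /= cpair_one mulr0.
by rewrite /vpair /= (cpair_linl P) mulrDr scalerAr.
Qed.

Lemma vpair_Rgenr s b : S s -> lpart (F := fL) (fun a => vp b a : k^o) s = 0.
Proof.
apply: Rgen_lpart => [i c x y|]; last by rewrite /vpair /= cpair_oner mulr0.
by rewrite /vpair /= (cpair_linr P) mulrDr scalerAr.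
Qed.

Lemma vpair_d a b : vp (d1 a) b = - sg k (dg a + (m + 2)) * vp a (d1 b).
Proof.
rewrite /vpair /d1 /vdeg /=; have := cpair_cd P (tagged a) (tagged b).
move/eqP; rewrite addr_eq0 => /eqP ->; rewrite /hdeg.
by sgring.
Qed.

Lemma cpairDl i j c (x y : C i) (z : C j) :
  cpair P (c *: x + y) z = c * cpair P x z + cpair P y z.
Proof. exact: cpair_linl. Qed.

Lemma cpairDr i j c (x y : C i) (z : C j) :
  cpair P z (c *: x + y) = c * cpair P z x + cpair P z y.
Proof. exact: cpair_linr. Qed.

End CobarData.

(** * Cyclicity of the pairing in terms of desuspended letters *)

Section CyclicInvariance.
Variables (k : fieldType) (C : dgcoalg k).
Notation L := (hletter C).
Notation fL := (fr k L).
Notation mo := (fmono fL).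
Notation dg := (@vdeg k C).
Notation S := (@Rgen k C).
Variables (m : int) (P : cyclic_pairing C m).
Notation vp := (vpair P).

Section Contraction.
Variables (V : lmodType k) (T : V -> Prop) (e : L -> V).
Hypothesis e_lin : forall i c (x y : C i),
  span T (e (hl (c *: x + y)) - c *: e (hl x) - e (hl y)).

Lemma qpart_contrl a b : span T
  (qpart (fun v' v'' => (sg k (hdeg v'' * hdeg b) * cpair P (tagged v') (tagged b)) *: e v'')
     (copr (tagged a))
   - \sum_(t <- cop a) (t.1.1 * (sg k (hdeg t.2 * hdeg b) * cpair P (tagged t.1.2) (tagged b)))
     *: e t.2).
Proof.
have h := @qpart_cop k C V (fun v' v'' =>
  (sg k (hdeg v'' * hdeg b) * cpair P (tagged v') (tagged b)) *: e v'') T a.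
have h1 := h _ _; apply: span_eq (h1 _ _).
- by congr (_ - _); apply: eq_bigr => t _; rewrite scalerA.
- move=> i c x y v; apply: span_eq (span0 _); rewrite cpairDl /hdeg /=.
  by lmod k; ring.
move=> i c x y v.
have := spanZ (sg k (i * hdeg b) * cpair P (tagged v) (tagged b)) (e_lin c x y).
by apply: span_eq; rewrite /hdeg /=; lmod k; ring.
Qed.

Lemma qpart_contrr a b : span T
  (qpart (fun w' w'' => (sg k (hdeg a * hdeg w') * cpair P (tagged a) (tagged w'')) *: e w')
     (copr (tagged b))
   - \sum_(t <- cop b) (t.1.1 * (sg k (hdeg a * hdeg t.1.2) * cpair P (tagged a) (tagged t.2)))
     *: e t.1.2).
Proof.
have h := @qpart_cop k C V (fun w' w'' =>
  (sg k (hdeg a * hdeg w') * cpair P (tagged a) (tagged w'')) *: e w') T b.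
have h1 := h _ _; apply: span_eq (h1 _ _).
- by congr (_ - _); apply: eq_bigr => t _; rewrite scalerA.
- move=> i c x y v.
  have := spanZ (sg k (hdeg a * i) * cpair P (tagged a) (tagged v)) (e_lin c x y).
  by apply: span_eq; rewrite /hdeg /=; lmod k; ring.
move=> i c x y v; apply: span_eq (span0 _); rewrite cpairDr /hdeg /=.
by lmod k; ring.
Qed.
End Contraction.

Lemma qpartE (f g : L -> L -> fL) (u : frA k L) : (forall b c, f b c = g b c) ->
  lext (fun w : {fmonom L} => if (w : seq L) is [:: b; c] then f b c else 0) u = qpart g u.
Proof.
move=> fg; rewrite /qpart -(lextE (fun w => if w is [:: b; c] then g b c else 0)).
apply: lext_ext => -[w] /=; case: w => [|b [|c [|? ?]]].
- exact: erefl.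
- exact: erefl.
- exact: fg.
- exact: erefl.
Qed.

Lemma cop_cyc (a b : L) : idl (F := fL) S
  (\sum_(t <- cop a) (t.1.1 * (sg k (hdeg t.2 * hdeg b) * cpair P (tagged t.1.2) (tagged b)))
     *: mo [:: t.2]
   - \sum_(t <- cop b) (t.1.1 * (sg k (hdeg a * hdeg t.1.2) * cpair P (tagged a) (tagged t.2)))
     *: mo [:: t.1.2]).
Proof.
have h1 := @qpart_contrl fL _ (fun c => mo [:: c]) (@gen_idl k C) a b.
have h2 := @qpart_contrr fL _ (fun c => mo [:: c]) (@gen_idl k C) a b.
have /Rrel_idl h3 := cpair_cyc P (tagged a) (tagged b).
pose c1 (v' v'' : L) := sg k (hdeg v'' * hdeg b) * cpair P (tagged v') (tagged b).
pose c2 (w' w'' : L) := sg k (hdeg a * hdeg w') * cpair P (tagged a) (tagged w'').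
have e1 := @qpartE (fun v' v'' => c1 v' v'' *: mono k [:: v''])
  (fun v' v'' => c1 v' v'' *: mo [:: v'']) (copr (tagged a))
  (fun _ _ => f_equal _ (monoE k _)).
have e2 := @qpartE (fun w' w'' => c2 w' w'' *: mono k [:: w'])
  (fun w' w'' => c2 w' w'' *: mo [:: w']) (copr (tagged b))
  (fun _ _ => f_equal _ (monoE k _)).
have h4 := span_eq (f_equal2 (fun x y : fL => x - y) e1 e2) h3.
apply: span_eq (spanD (spanB h4 h1) h2).
by rewrite /c1 /c2; lmod k; ring.
Qed.

(** Turns the difference in the cyclicity axiom, with a Koszul sign in each term, into a sum with
    one global sign. *)
Lemma span_rescale (V : lmodType k) (T : V -> Prop) (X : eqType) (s s' : seq X) (c d c' d' : X -> k)
    (e e' : X -> V) x y :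
  {in s, forall t, c' t = x * c t} -> {in s', forall t, y * d' t = - x * d t} ->
  span T (\sum_(t <- s) c t *: e t - \sum_(t <- s') d t *: e' t) ->
  span T (\sum_(t <- s) c' t *: e t + y *: \sum_(t <- s') d' t *: e' t).
Proof.
move=> h1 h2 /(spanZ x); apply: span_eq; rewrite scalerBr -scaleNr !scaler_sumr.
by congr (_ + _); apply: eq_big_seq => t ts; rewrite ?scalerA ?h1 ?h2.
Qed.

Lemma cp_cycl (a b : L) : idl (F := fL) S
  (\sum_(t <- cpd a) (t.1.1 * vp t.1.2 b) *: mo [:: t.2]
   + sg k (dg a + (m + 2) + (m + 2) * dg b + dg a * (m + 2))
     *: \sum_(t <- cpd b) (t.1.1 * vp a t.2) *: mo [:: t.1.2]).
Proof.
rewrite /cpd !big_map.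
(* A nonzero pairing forces the surviving letter to have degree |a| + |b| + m, so the Koszul sign is
   the same for all terms and can be taken out. The desuspension signs of [cpd] and [vpair] cancel
   in the first sum. *)
apply: (span_rescale (x := sg k ((hdeg a + hdeg b + m) * hdeg b))) (cop_cyc a b)
  => -[[c v] w] /cop_deg /= ta; rewrite /vpair /vdeg.
  have [->|h] := eqVneq (cpair P (tagged v) (tagged b)) 0; first by rewrite !mulr0.
  have {}h : hdeg v + hdeg b + m = 0.
    by apply/eqP; apply: contraNT h => /(cpair_deg P) ->.
  have -> : hdeg w = hdeg a + hdeg b + m by rewrite -ta -[LHS]addr0 -h; ring.
  by sgring.
have [->|h] := eqVneq (cpair P (tagged a) (tagged w)) 0; first by rewrite !mulr0.
have {}h : hdeg a + hdeg w + m = 0.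
  by apply/eqP; apply: contraNT h => /(cpair_deg P) ->.
have -> : hdeg v = hdeg a + hdeg b + m by rewrite -ta -[LHS]addr0 -h; ring.
by sgring.
Qed.

Lemma cpair_symL a b : cpair P (tagged a) (tagged b)
  = sg k (hdeg a * hdeg b) * cpair P (tagged b) (tagged a).
Proof. exact: cpair_sym. Qed.

(** This is cyclicity for the exchanged pair (b, a), rewritten by the symmetry of the pairing. *)
Lemma cp_cycr (a b : L) : idl (F := fL) S
  (\sum_(t <- cpd a) (t.1.1 * vp t.2 b) *: mo [:: t.1.2]
   + sg k (dg a + (m + 2)) *: \sum_(t <- cpd b) (t.1.1 * vp a t.1.2) *: mo [:: t.2]).
Proof.
have := spanN (cop_cyc b a); rewrite opprB /cpd !big_map.
apply: (span_rescale (x := sg k (hdeg a + hdeg a * hdeg b)))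
  => -[[c v] w] /cop_deg /= ta; rewrite /vpair /vdeg ?(cpair_symL w b) ?(cpair_symL a v).
  have [->|h] := eqVneq (cpair P (tagged b) (tagged w)) 0; first by rewrite !mulr0.
  have {}h : hdeg b + hdeg w + m = 0.
    by apply/eqP; apply: contraNT h => /(cpair_deg P) ->.
  have -> : hdeg v = hdeg a + hdeg b + m by rewrite -ta -[LHS]addr0 -h; ring.
  have -> : hdeg w = - (hdeg b + m) by rewrite -[RHS]addr0 -h; ring.
  rewrite /hdeg; by sgring.
have [->|h] := eqVneq (cpair P (tagged v) (tagged a)) 0; first by rewrite !mulr0.
have {}h : hdeg v + hdeg a + m = 0.
  by apply/eqP; apply: contraNT h => /(cpair_deg P) ->.
have -> : hdeg w = hdeg a + hdeg b + m by rewrite -ta -[LHS]addr0 -h; ring.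
have -> : hdeg v = - (hdeg a + m) by rewrite -[RHS]addr0 -h; ring.
rewrite /hdeg; by sgring.
Qed.
End CyclicInvariance.

(** * The bracket formulas of the statement as sums over splittings *)

Lemma ord_splits (k : fieldType) (L : choiceType) (V : lmodType k) (v : seq L)
    (f : seq L -> L -> seq L -> V) :
  \sum_(i < size v) f (take i v) (tnth (in_tuple v) i) (drop i.+1 v) = splits v f.
Proof.
elim: v f => [|a r IH] f /=; first by rewrite big_ord0.
rewrite big_ord_recl /= drop0 (tnth_nth a) /=; congr (_ + _).
by rewrite -IH; apply: eq_bigr => i _; rewrite !(tnth_nth a).
Qed.

Lemma splits0 (k : fieldType) (L : choiceType) (V : lmodType k) (v : seq L) :
  splits v (fun _ _ _ => 0 : V) = 0.
Proof. by elim: v => //= a r ->; rewrite addr0. Qed.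

Lemma splitsB (k : fieldType) (L : choiceType) (V : lmodType k) (v : seq L)
    (f g : seq L -> L -> seq L -> V) :
  splits v (fun P a Q => f P a Q - g P a Q) = splits v f - splits v g.
Proof.
by rewrite splitsD -scaleN1r -splitsZ; congr (_ + _); apply: eq_splits => P a Q _; rewrite scaleN1r.
Qed.

Lemma splits_exchange (k : fieldType) (L L' : choiceType) (V : lmodType k) (v : seq L)
    (w : seq L') (f : seq L -> L -> seq L -> seq L' -> L' -> seq L' -> V) :
  splits v (fun P a Q => splits w (f P a Q))
  = splits w (fun P' a' Q' => splits v (fun P a Q => f P a Q P' a' Q')).
Proof.
elim: v f => [|a r IH] f /=; first by rewrite splits0.
by rewrite splitsD -IH; congr (_ + _); apply: eq_splits.
Qed.

Lemma gderw_splits (k : fieldType) (L : choiceType) (dg : L -> int) (F : freemod k (seq L))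
    e (f : L -> F) w :
  gderw dg e f w = splits w (fun D y E => sg k (e * Defs.wdeg dg D) *: (fmono F D ** f y ** fmono F E)).
Proof.
elim: w => //= a r ->; rewrite wdeg_nil mulr0 scale1r mul1F; congr (_ + _).
rewrite (splits_lin (h := fun u => sg k (e * dg a) *: (fmono F [:: a] ** u))); last by lin.
apply: eq_splits => D y E _; rewrite mulFZr scalerA -sgD -mulrDr wdeg_cons.
by rewrite !mulFA moM.
Qed.

Section SplitForms.
Variables (k : fieldType) (L : choiceType) (dg : L -> int) (N : int).
Variables (F : freemod k (seq L)) (FF : freemod k (seq L * seq L)) (vp : L -> L -> k).
Notation mo := (fmono F).
Notation pm := (fpmono FF).
Notation wdeg := (Defs.wdeg dg).

Lemma gderw_phi_splits (vp_deg : forall a b, vp a b != 0 -> dg a + dg b + N = 0) v w :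
  gderw dg (wdeg v + N) (phi dg F FF vp v) w =
  splits v (fun A x B => splits w (fun D y E =>
    (sg k (wdeg A * wdeg B + wdeg B * dg x + wdeg D * (wdeg A + wdeg B + dg y)) * vp x y)
      *: mo (D ++ B ++ A ++ E))).
Proof.
rewrite gderw_splits splits_exchange; apply: eq_splits => D y E _.
rewrite /phi dd_splits.
rewrite (splits_lin (h := fun p => sg k ((wdeg v + N) * wdeg D) *: (mo D ** be dg F p ** mo E)));
  last by lin.
apply: eq_splits => A x B ->; rewrite beZ be_pm !(mulFZl, mulFZr) !moM -!catA !scalerA.
have [->|/vp_deg e] := eqVneq (vp x y) 0; first by rewrite !(mulr0, mul0r) !scale0r.
congr (_ *: _); rewrite wdeg_cat wdeg_cons.
have -> : N = - (dg x + dg y) by rewrite -[RHS]addr0 -e; ring.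
by sgring.
Qed.

(** For a fixed letter y of w, the contraction with all letters of v places [phi v y] in the
    position of y. When the pairing is nonzero, N = - (|x| + |y|) converts the sign of the
    derivation into that of the double bracket. *)
Lemma mum_double_bracket (vp_deg : forall a b, vp a b != 0 -> dg a + dg b + N = 0) v w :
  mum F (\sum_(i < size v) \sum_(j < size w)
    (sg k (wdeg (take i v) * wdeg (drop i.+1 v) + wdeg (drop i.+1 v) * dg (tnth (in_tuple v) i)
      + wdeg (take j w) * (wdeg (take i v) + wdeg (drop i.+1 v) + dg (tnth (in_tuple w) j)))
      * vp (tnth (in_tuple v) i) (tnth (in_tuple w) j))
    *: pm (take j w ++ drop i.+1 v) (take i v ++ drop j.+1 w))
  = gderw dg (wdeg v + N) (phi dg F FF vp v) w.
Proof.
rewrite gderw_phi_splits // -ord_splits linear_sum; apply: eq_bigr => i _.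
rewrite -ord_splits linear_sum; apply: eq_bigr => j _.
by rewrite linearZ /= mum_pm -catA.
Qed.

Section Entries.
Variable n : nat.
Notation Ln := ('I_n * 'I_n * L)%type.
Variable Fn : freemod k (seq Ln).
Notation ndg := (@ndg L dg n).
Notation wdegn := (Defs.wdeg ndg).
Notation mon := (fmono Fn).

Lemma psl_splits V c : psl dg Fn vp V c
  = splits V (fun A x B => (sg k (ndg x * wdegn B) * np vp x c) *: mon (A ++ B)).
Proof.
elim: V => //= a r ->; congr (_ + _).
rewrite (splits_lin (h := fun u => mon [:: a] ** u)); last by lin.
by apply: eq_splits => A x B _; rewrite mulFZr moM.
Qed.

(** The word formula puts [A ++ B] before [D], the derivation puts it after [D]. They agree only
    after a graded commutation, so this word formula is a derivation just modulo relations. *)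
Lemma gderw_psl_splits (S : F -> Prop)
    (vp_deg : forall a b, vp a b != 0 -> dg a + dg b + N = 0) V W :
  idl (rep_rel dg (F := F) (Fn := Fn) S) (splits V (fun A x B => splits W (fun D y E =>
      (sg k (ndg x * wdegn B + wdegn D * ndg y) * np vp x y) *: mon (A ++ B ++ D ++ E)))
    - gderw ndg (wdegn V + N) (psl dg Fn vp V) W).
Proof.
rewrite gderw_splits splits_exchange -splitsB; apply: splits_span => D y E _.
rewrite psl_splits.
rewrite (splits_lin (h := fun p => sg k ((wdegn V + N) * wdegn D) *: (mon D ** p ** mon E)));
  last by lin.
rewrite -splitsB; apply: splits_span => A x B ->.
rewrite !(mulFZl, mulFZr) !moM.
have [->|/(np_deg vp_deg) e] := eqVneq (np vp x y) 0.
  by rewrite !(mulr0, mul0r) !scale0r scaler0 subrr; apply: span0.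
have h := idl_mulr (mon E) (comm_words dg Fn S (A ++ B) D).
have := spanZ (sg k (ndg x * wdegn B + wdegn D * ndg y) * np vp x y) h.
apply: span_eq; rewrite !(mulFBl, mulFZl, moM) -!catA wdeg_cat wdeg_cat wdeg_cons.
have -> : N = - (ndg x + ndg y) by rewrite -[RHS]addr0 -e; ring.
by lmod k; sgring.
Qed.

Lemma isdeg_pois_splits (vp_deg : forall a b, vp a b != 0 -> dg a + dg b + N = 0) V W :
  isdeg ndg (wdegn V + wdegn W + N) (splits V (fun A x B => splits W (fun D y E =>
      (sg k (ndg x * wdegn B + wdegn D * ndg y) * np vp x y) *: mon (A ++ B ++ D ++ E)))).
Proof.
apply: splits_span => A x B ->; apply: splits_span => D y E ->.
have [->|/(np_deg vp_deg) e] := eqVneq (np vp x y) 0; first by rewrite mulr0 scale0r; apply: span0.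
apply: spanZ.
have -> : wdegn (A ++ x :: B) + wdegn (D ++ y :: E) + N = wdegn (A ++ B ++ D ++ E).
  by rewrite !wdeg_cat !wdeg_cons -[RHS]addr0 -e; ring.
exact: isdeg_mo.
Qed.
End Entries.
End SplitForms.

Lemma mono_mulE (k : fieldType) (L : choiceType) (v w : seq L) :
  mono k v * mono k w = mulF (F := fr k L) (fmono (fr k L) v) (fmono (fr k L) w).
Proof.
exact: eq_trans (mulE _ _) (f_equal2 (mulF (F := fr k L)) (monoE k v) (monoE k w)).
Qed.

Lemma commE (k : fieldType) (L : choiceType) (c : k) (v w : seq L) :
  mono k v * mono k w - c *: (mono k w * mono k v)
  = mulF (F := fr k L) (fmono (fr k L) v) (fmono (fr k L) w)
    - c *: mulF (F := fr k L) (fmono (fr k L) w) (fmono (fr k L) v).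
Proof.
exact: (f_equal2 (fun x y : fr k L => x - c *: y) (mono_mulE k v w) (mono_mulE k w v)).
Qed.

Section Translation.
Variables (k : fieldType) (C : dgcoalg k).
Notation L := (hletter C).
Notation F := (frA k L).
Notation FF := (frAA k L).
Notation fL := (fr k L).
Notation fLL := (frr k L).
Notation mo := (fmono fL).
Notation dg := (@vdeg k C).
Notation wdeg := (Defs.wdeg dg).
Notation S := (@Rgen k C).
Variables (m : int) (P : cyclic_pairing C m).
Notation vp := (vpair P).
Notation N := (m + 2).
Notation ph := (phi dg fL fLL vp).

Lemma brwE v w : brw P v w = gderw (F := fL) dg (wdeg v + N) (ph v) w.
Proof.
rewrite /brw mulmE -(mum_double_bracket fL fLL (@vpair_deg k C m P)); apply: (f_equal (mum fL (FF := fLL))).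
apply: eq_bigr => i _; apply: eq_bigr => j _.
exact: (f_equal (fun p : fLL => _ *: p) (pmonoE _ _ _)).
Qed.

Lemma brE u v : br P u v = op (F := fL) (F' := fL) dg dg N ph u v.
Proof. exact: (bilE u v brwE). Qed.

Lemma actFFE u p : actFF P u p = opT (F := fL) (F' := fL) (FF' := fLL) dg dg N ph u p.
Proof. exact: (actTE u p brwE). Qed.

Lemma betaE p : beta p = be dg (FF := fLL) fL p.
Proof.
rewrite /beta lextE2; apply: lww_ext => v w /=.
exact: (f_equal (fun p : fL => _ *: p) (monoE _ _)).
Qed.

Lemma dncE u : dnc u = dn (F := fL) fLL u.
Proof.
rewrite /dnc (lextE (fun w => pmono k w [::] - pmono k [::] w)).
apply: lw_ext => w.
exact: (f_equal2 (fun p q : fLL => p - q) (pmonoE _ _ _) (pmonoE _ _ _)).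
Qed.

Lemma bicommE x p : bicomm x p = bic dg (FF := fLL) x p.
Proof.
rewrite /bicomm lextE2; apply: lww_ext => v w /=.
exact: (f_equal2 (fun p q : fLL => p - _ *: q) (pmonoE _ _ _) (pmonoE _ _ _)).
Qed.

Lemma Omega1E p : Omega1 p <-> idl (F := fL) S (mum fL (FF := fLL) p).
Proof. by rewrite -mulmE; apply: Rrel_idl. Qed.

Lemma Omega1natrelE p : Omega1natrel p <-> om1 dg (F := fL) (FF := fLL) S p.
Proof.
split=> [[/trelE h|[x [q [/Omega1E h ->]]]]|[h|[x [q [h ->]]]]].
- by left.
- by right; exists x, q; rewrite bicommE.
- by left; apply/trelE.
- by right; exists x, q; rewrite -bicommE; split=> //; apply/Omega1E.
Qed.

Lemma natrelE u : natrel u <-> [\/ idl (F := fL) S u, u = mo [::]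
  | exists v w, u = mulF (F := fL) (mo v) (mo w)
      - sg k (wdeg v * wdeg w) *: mulF (F := fL) (mo w) (mo v)].
Proof.
split=> -[h|h|[v [w h]]].
- by constructor 1; apply/Rrel_idl.
- by constructor 2; rewrite h oneE.
- constructor 3; exists v, w; exact: (eq_trans h (commE _ v w)).
- by constructor 1; apply/Rrel_idl.
- by constructor 2; rewrite h oneE.
- constructor 3; exists v, w; exact: (eq_trans h (esym (commE _ v w))).
Qed.
End Translation.

Lemma lww_opp_sum (k : fieldType) (L : choiceType) (FF : freemod k (seq L * seq L))
    (V : lmodType k) (I : finType) (f : I -> seq L -> seq L -> V) (p : FF) :
  \sum_i lww (fun v w => - f i v w) p = lww (fun v w => - \sum_i f i v w) p.
Proof.
move: p; apply: frAA_lin => [||v w].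
- by apply: linear_bigsum => i; apply: linearP.
- exact: linearP.
by under eq_bigr => i _ do rewrite lwwE; rewrite lwwE sumrN.
Qed.

Lemma idl_sub (k : fieldType) (L : choiceType) (F : freemod k (seq L)) (S T : F -> Prop) :
  (forall s, S s -> idl T s) -> forall u, idl S u -> idl T u.
Proof.
move=> h; apply: span_sub => _ [v [s [w [Ss ->]]]].
by apply: idl_mulr; apply: idl_mull; apply: h.
Qed.

Section Relative.
Variables (k : fieldType) (L : choiceType) (F : freemod k (seq L)) (FF : freemod k (seq L * seq L)).

Lemma lw_span (V : lmodType k) (T : V -> Prop) (f g : seq L -> V) (u : F) :
  (forall w, span T (f w - g w)) -> span T (lw f u - lw g u).
Proof.
move=> h; move: u; apply: frA_lin_span => [|w]; last by rewrite !lwE.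
by apply: linear_add; [|apply: linear_opp]; apply: linearP.
Qed.

Lemma lww_span (V : lmodType k) (T : V -> Prop) (f g : seq L -> seq L -> V) (p : FF) :
  (forall v w, span T (f v w - g v w)) -> span T (lww f p - lww g p).
Proof.
move=> h; move: p; apply: frAA_lin_span => [|v w]; last by rewrite !lwwE.
by apply: linear_add; [|apply: linear_opp]; apply: linearP.
Qed.

Lemma lww_bil (V : lmodType k) (f : seq L -> seq L -> seq L -> V) (u : F) :
  linear (fun p : FF => lw (fun x => lww (f x) p) u).
Proof.
move=> a x y; move: u; apply: frA_lin => [||w]; last by rewrite !lwE linearP.
  exact: linearP.
by apply: linear_add; [apply: linear_scale|]; apply: linearP.
Qed.

Lemma tidl_ten2 (S : F -> Prop) c (u u' v v' x y : F) : idl S (u - u') -> idl S (v - v') ->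
  tidl S (ten FF u y + c *: ten FF x v - (ten FF u' y + c *: ten FF x v')).
Proof.
move=> hu hv; have := spanD (tidl_l FF y hu) (spanZ c (tidl_r FF x hv)).
by apply: span_eq; rewrite tenBl tenBr; lmod k; ring.
Qed.

Lemma eq_gderw (dg : L -> int) e (f g : L -> F) w : f =1 g -> gderw dg e f w = gderw dg e g w.
Proof. by move=> fg; elim: w => //= a r ->; rewrite fg. Qed.
End Relative.

Section RepTranslation.
Variables (k : fieldType) (C : dgcoalg k) (n : nat).
Notation L := (hletter C).
Notation F := (frA k L).
Notation FF := (frAA k L).
Notation fL := (fr k L).
Notation fLL := (frr k L).
Notation Ln := ('I_n * 'I_n * L)%type.
Notation fn := (fr k Ln).
Notation fnn := (frr k Ln).
Notation mon := (fmono fn).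
Notation dg := (@vdeg k C).
Notation wdeg := (Defs.wdeg dg).
Notation ndg := (@ndg L dg n).
Notation wdegn := (Defs.wdeg ndg).
Notation S := (@Rgen k C).
Notation Sn := (rep_rel dg (n := n) (F := fL) (Fn := fn) S).

Lemma gennE i j (a : L) : genn i j a = mon [:: (i, j, a)].
Proof. exact: monoE. Qed.

Lemma piwE (w : seq L) i j : piw n w i j = pw fn w i j.
Proof.
elim: w i => [|a w IH] i.
  rewrite /= mxE; case: eqP => _; last exact: erefl.
  exact: oneE.
rewrite /= mxE; apply: eq_bigr => l _; rewrite mxE.
exact: (eq_trans (mulE _ _) (f_equal2 (mulF (F := fn)) (gennE _ _ _) (IH l))).
Qed.

Lemma pinE (u : F) i j : pin n u i j = pn (F := fL) fn i j u.
Proof.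
rewrite /pin mxE (lextE (fun w => piw n w i j)); apply: lw_ext => w; exact: piwE.
Qed.

Lemma dngenE (a : Ln) : dngen a = onletters (F := fL) fn (@dgen k C) a.
Proof. exact: pinE. Qed.

Lemma TrnE (u : F) : Trn n u = trn (F := fL) fn (augI u).
Proof. by apply: eq_bigr => i _; apply: pinE. Qed.

Lemma TrOmegaE (p : FF) : TrOmega n p = TO (FF := fLL) fn fnn p.
Proof.
rewrite /TrOmega /mxtrace /TO -lww_opp_sum; apply: eq_bigr => i _.
rewrite mxE lextE2; apply: lww_ext => v w /=.
apply: (f_equal (fun x : fnn => - x)); apply: eq_bigr => l _; rewrite tensE.
exact: (f_equal2 (ten fnn (F := fn)) (piwE _ _ _) (piwE _ _ _)).
Qed.

Lemma Rngen_Sn u : Rngen u -> idl (F := fn) Sn u.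
Proof.
case=> [[i [j [d [a [x [y ->]]]]]]|[i [j ->]]|[a [b ->]]].
- apply: (@idl_gen _ _ fn).
  have h : S (gen (a *: x + y) - a *: gen x - gen y) by left; exists d, a, x, y.
  have := Sn_pn dg (n := n) (F := fL) fn i j h.
  rewrite !genE !pnB pnZ !pn_letter !gennE; exact.
- apply: (@idl_gen _ _ fn).
  have h : S (gen (coone C)) by right.
  have := Sn_pn dg (n := n) (F := fL) fn i j h.
  by rewrite genE pn_letter gennE.
apply: (@idl_gen _ _ fn).
have := Sn_comm dg (F := fL) fn S a b.
rewrite -(moM fn [:: a] [:: b]) -(moM fn [:: b] [:: a]) => h.
rewrite (commE _ [:: a] [:: b]).
exact: h.
Qed.

Lemma Sn_Rngen u : Sn u -> idl (F := fn) (@Rngen k C n) u.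
Proof.
case=> [i j _ [[d [a [x [y ->]]]]|->]|a b].
- apply: (@idl_gen _ _ fn); constructor 1; exists i, j, d, a, x, y.
  rewrite !genE !pnB pnZ !pn_letter !gennE; exact: erefl.
- apply: (@idl_gen _ _ fn); constructor 2; exists i, j.
  by rewrite genE pn_letter gennE.
apply: (@idl_gen _ _ fn); constructor 3; exists a, b.
rewrite (commE _ [:: a] [:: b]) !moM; exact: erefl.
Qed.

Lemma Rnrel_idl u : Rnrel u <-> idl (F := fn) Sn u.
Proof.
apply: (iff_trans (idealE (@Rngen k C n) u)).
split; apply: (@idl_sub k _ fn) => s; [exact: Rngen_Sn|exact: Sn_Rngen].
Qed.

Lemma trelSnE p : trel (@Rnrel k C n) p <->
  exists u v, (idl (F := fn) Sn u \/ idl (F := fn) Sn v) /\ p = ten fnn (F := fn) u v.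
Proof.
by split=> -[u [v [uv ->]]]; exists u, v; rewrite tensE; split=> //;
  case: uv => /Rnrel_idl; [left|right|left|right].
Qed.

Lemma leibE (b c c' : seq Ln) :
  pmono k b (c ++ c') - pmono k (b ++ c) c'
    - sg k (wdegn c * wdegn c') *: pmono k (b ++ c') c
  = leib fnn (wdegn c) (wdegn c') (mon b) (mon c) (mon c').
Proof.
rewrite /leib !moM !ten_mo.
exact: (f_equal3 (fun x y z : fnn => x - y - _ *: z) (pmonoE k _ _) (pmonoE k _ _) (pmonoE k _ _)).
Qed.

Lemma OmnrelE p : Omnrel p <-> omrel ndg (F := fn) (FF := fnn) Sn p.
Proof.
split=> [[/trelSnE h|[b [c [c' ->]]]]|[h|[b [c [c' ->]]]]].
- by left.
- right; exists b, c, c'; exact: leibE.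
- by left; apply/trelSnE.
- right; exists b, c, c'; rewrite -leibE; exact: erefl.
Qed.

Lemma dRnE u : dRn u = gder (F := fn) ndg (-1) (onletters (F := fL) fn (@dgen k C)) u.
Proof.
rewrite /dRn; apply: (eq_trans (derE _ _ _)).
by apply: lw_ext => w; exact: (@eq_gderw k Ln fn ndg (-1) _ _ w dngenE).
Qed.

Lemma derTnE p : derT (@ndeg k C n) (@dngen k C n) p
  = gderT (F := fn) (FF := fnn) ndg (-1) (onletters (F := fL) fn (@dgen k C)) p.
Proof.
apply: (eq_trans (derTE _ _ _)).
apply: lww_ext => v w.
have h x : gderw ndg (-1) (@dngen k C n : Ln -> fn) x = _ := @eq_gderw k Ln fn ndg (-1) _ _ x dngenE.
exact: (f_equal2 (fun x y : fn => ten fnn x (mon w) + _ *: ten fnn (mon v) y) (h v) (h w)).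
Qed.

Variables (m : int) (P : cyclic_pairing C m).
Notation vp := (vpair P).
Notation N := (m + 2).

Lemma poiswE V W : poisw P V W = splits V (fun A x B => splits W (fun D y E =>
  (sg k (ndg x * wdegn B + wdegn D * ndg y) * np vp x y) *: mon (A ++ B ++ D ++ E))).
Proof.
rewrite -ord_splits; apply: eq_bigr => i _; rewrite -ord_splits; apply: eq_bigr => j _.
exact: (f_equal (fun x : fn => _ *: x) (monoE k _)).
Qed.

Lemma poisw_psl V W : idl (F := fn) Sn
  (poisw P V W - gderw (F := fn) ndg (wdegn V + N) (psl dg fn vp V) W).
Proof.
rewrite poiswE; exact: (gderw_psl_splits (F := fL) fn S (@vpair_deg k C m P) V W).
Qed.

(** Homogeneity of a representative is not inherited through a congruence modulo [Sn], so it is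
    verified on the word formula itself. *)
Lemma isdeg_poisw V W : isdeg (F := fn) ndg (wdegn V + wdegn W + N) (poisw P V W).
Proof.
rewrite poiswE; exact: (isdeg_pois_splits fn (@vpair_deg k C m P) V W).
Qed.

Lemma pois_lw u v :
  pois P u v = lw (F := fn) (fun x => lw (F := fn) (fun y => poisw P x y) v) u.
Proof.
rewrite /pois /lext2 (lextE (fun s => lext (fun t : {fmonom _} => poisw P s t) v)).
by apply: lw_ext => x; rewrite (lextE (poisw P x)).
Qed.

Lemma actOm_lw u p : actT ndg N (@poisw k C m P n) u p =
  lw (F := fn) (fun x => lww (FF := fnn) (fun v w => ten fnn (F := fn) (poisw P x v) (mon w)
    + sg k ((wdegn x + N) * wdegn v) *: ten fnn (F := fn) (mon v) (poisw P x w)) p) u.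
Proof.
rewrite /actT /lext2 (lextE (fun x => lext (fun q : seq Ln * seq Ln =>
  tens (poisw P x q.1) (mono k q.2)
  + sg k ((wdegn x + N) * wdegn q.1) *: tens (mono k q.1) (poisw P x q.2)) p)).
apply: lw_ext => x; rewrite lextE2; apply: lww_ext => v w /=.
by rewrite !tensE !monoE.
Qed.

Lemma poisE u v : idl (F := fn) Sn
  (pois P u v - op (F := fn) (F' := fn) ndg ndg N (psl dg fn vp) u v).
Proof. by rewrite pois_lw; apply: lw_span => x; apply: lw_span => y; apply: poisw_psl. Qed.

Lemma actOmE u p : tidl (F := fn) (FF := fnn) Sn
  (actT ndg N (@poisw k C m P n) u p
   - opT (F := fn) (F' := fn) (FF' := fnn) ndg ndg N (psl dg fn vp) u p).
Proof.
rewrite actOm_lw; apply: lw_span => x; apply: lww_span => v w.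
by apply: tidl_ten2; apply: poisw_psl.
Qed.

Lemma isdeg_pois i j u v : isdeg (F := fn) ndg i u -> isdeg (F := fn) ndg j v ->
  isdeg (F := fn) ndg (i + j + N) (pois P u v).
Proof.
move=> hu hv; rewrite pois_lw; move: u hu; apply: isdeg_lin_span => [|x <-].
  exact: linearP.
rewrite lwE; move: v hv; apply: isdeg_lin_span => [|y <-]; first exact: linearP.
by rewrite lwE; apply: isdeg_poisw.
Qed.

Lemma isdeg_actOm i j u p : isdeg (F := fn) ndg i u -> isdegT (FF := fnn) ndg j p ->
  isdegT (FF := fnn) ndg (i + j + N) (actT ndg N (@poisw k C m P n) u p).
Proof.
move=> hu hp; rewrite actOm_lw; move: u hu; apply: isdeg_lin_span => [|x <-].
  exact: linearP.
rewrite lwE; move: p hp; apply: isdegT_lin_span => [|v w <-]; first exact: linearP.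
rewrite lwwE; apply: spanD; [|apply: spanZ].
  have -> : wdegn x + (wdegn v + wdegn w) + N = (wdegn x + wdegn v + N) + wdegn w by ring.
  by apply: isdegT_ten; [apply: isdeg_poisw|apply: isdeg_mo].
have -> : wdegn x + (wdegn v + wdegn w) + N = wdegn v + (wdegn x + wdegn w + N) by ring.
by apply: isdegT_ten; [apply: isdeg_mo|apply: isdeg_poisw].
Qed.

Lemma pois_linearr u : linear (fun v : fn => pois P u v : fn).
Proof. by move=> a x y; rewrite !pois_lw; apply: lw_bil. Qed.
Lemma pois_linearl v : linear (fun u : fn => pois P u v : fn).
Proof. by move=> a x y; rewrite !pois_lw; apply: linearP. Qed.
Lemma actOm_linearl p : linear (fun u : fn => actT ndg N (@poisw k C m P n) u p : fnn).
Proof. by move=> a x y; rewrite !actOm_lw; apply: linearP. Qed.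
Lemma actOm_linearr u : linear (fun p : fnn => actT ndg N (@poisw k C m P n) u p : fnn).
Proof.
by move=> a p q; rewrite !actOm_lw; apply: lww_bil.
Qed.
End RepTranslation.

Lemma twist_isdeg (k : fieldType) (L : choiceType) (dg : L -> int) (F : freemod k (seq L)) N d (u : F) :
  isdeg dg d u -> twist dg N u = sg k (d + N) *: u.
Proof.
move: u; apply: isdeg_lin => [||w <-]; [exact: linearP|by lin|exact: twist_mo].
Qed.

(** * The diagram *)

Section Commutators.
Variables (k : fieldType) (L : choiceType) (dg : L -> int) (N : int).
Variables (F : freemod k (seq L)) (FF : freemod k (seq L * seq L)).
Notation mo := (fmono F).
Notation wdeg := (Defs.wdeg dg).
Variable S : F -> Prop.
Hypothesis S_graded : graded_gen dg S.

Definition nat_rel (u : F) : Prop :=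
  [\/ idl S u, u = mo [::]
    | exists v w, u = mo v ** mo w - sg k (wdeg v * wdeg w) *: (mo w ** mo v)].

Lemma nat_comm i j u v : isdeg dg i u -> isdeg dg j v ->
  span nat_rel (u ** v - sg k (i * j) *: (v ** u)).
Proof.
move=> hu hv; move: u hu; apply: isdeg_lin_span => [|x <-]; first by lin.
move: v hv; apply: isdeg_lin_span => [|y <-]; first by lin.
by apply: span_gen; constructor 3; exists x, y.
Qed.

Lemma nat_idl u : idl S u -> span nat_rel u.
Proof. by move=> h; apply: span_gen; constructor 1. Qed.

Lemma idl_homog u : idl S u -> span (fun v => idl S v /\ exists d, isdeg dg d v) u.
Proof.
move: u; apply: idl_lin => [|v s w Ss]; first by lin.
have [d hd] := S_graded Ss; apply: span_gen; split.
  by apply/idl_mulr/idl_mull/idl_gen.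
exists (wdeg v + d + wdeg w).
by apply: isdegM (isdeg_mo _ _ _); apply: isdegM hd; apply: isdeg_mo.
Qed.

(** The sign in [op u] varies with the degrees of the words of u. A relation is therefore decomposed
    into homogeneous relations, each of which acts by a single derivation. *)
Lemma nat_homog u : nat_rel u -> span (fun v => nat_rel v /\ exists d, isdeg dg d v) u.
Proof.
case=> [h|->|[v [w ->]]].
- apply: span_sub (idl_homog h) => x [hx dx]; apply: span_gen; split=> //.
  by constructor 1.
- apply: span_gen; split; first by constructor 2.
  by exists (wdeg [::]); apply: isdeg_mo.
apply: span_gen; split; first by constructor 3; exists v, w.
exists (wdeg v + wdeg w); apply: spanB.
  exact: isdegM (isdeg_mo _ _ _) (isdeg_mo _ _ _).
rewrite addrC; apply: spanZ; exact: isdegM (isdeg_mo _ _ _) (isdeg_mo _ _ _).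
Qed.

Lemma gder_nat e f u : (forall a, isdeg dg (e + dg a) (f a)) ->
  (forall s, S s -> idl S (gder dg e f s)) ->
  nat_rel u -> span nat_rel (gder dg e f u).
Proof.
move=> fh fS [h|->|[v [w ->]]].
- exact/nat_idl/gder_idl.
- by rewrite gder1; apply: span0.
have hv := gder_isdeg fh (isdeg_mo F dg v); have hw := gder_isdeg fh (isdeg_mo F dg w).
have h1 := nat_comm hv (isdeg_mo F dg w).
have h2 := nat_comm (isdeg_mo F dg v) hw.
have := spanD h1 (spanZ (sg k (e * wdeg v)) h2).
apply: span_eq; rewrite gderD gderN gderZ !gderM !sgm_mo !mulFZl.
by lmod k; sgring.
Qed.

Section Action.
Variable ph : seq L -> L -> F.
Hypothesis ph_hom : forall v b, isdeg dg (wdeg v + N + dg b) (ph v b).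
Hypothesis ph_S : forall v s, S s -> idl S (gder dg (wdeg v + N) (ph v) s).
Hypothesis ph_idl : forall b u, idl S u -> idl S (phiF ph u b).
Hypothesis ph_comm : forall b v w,
  phiF ph (mo (v ++ w) - sg k (wdeg v * wdeg w) *: mo (w ++ v)) b = 0.
Hypothesis ph_unit : forall b, phiF ph (mo [::]) b = 0.
Notation op_ := (op dg dg (F := F) (F' := F) N ph).
Notation opT_ := (opT dg dg (F := F) (F' := F) (FF' := FF) N ph).

Lemma nat_phiF u b : nat_rel u -> idl S (phiF ph u b).
Proof.
case=> [|->|[v [w ->]]]; first exact: ph_idl.
  by rewrite ph_unit; apply: span0.
by rewrite !moM ph_comm; apply: span0.
Qed.

Lemma op_nat u x : nat_rel u -> idl S (op_ u x).
Proof.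
move/nat_homog; move: u; apply: span_lin => [|u [hu [d hd]]]; first exact: opl_linear.
by apply: (op_rel _ _ _ hd) => a; apply: nat_phiF.
Qed.

Lemma opT_nat u p : nat_rel u -> tidl S (opT_ u p).
Proof.
move/nat_homog; move: u; apply: span_lin => [|u [hu [d hd]]]; first exact: opTl_linear.
by apply: (opT_rel _ _ _ hd) => a; apply: nat_phiF.
Qed.

Lemma nat_op u x : nat_rel x -> span nat_rel (op_ u x).
Proof.
move=> hx; move: u; apply: frA_lin_span => [|v]; first exact: opl_linear.
by rewrite op_mo; apply: gder_nat => // s; apply: ph_S.
Qed.

Lemma om1_opT u p : om1 dg S p -> span (om1 dg S) (opT_ u p).
Proof.
move=> hp; move: u; apply: frA_lin_span => [|v]; first exact: opTl_linear.
rewrite opT_mo; case: hp => [h|[x [q [hq ->]]]].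
  apply/om1_tidl/(gderT_tidl S_graded); first exact: ph_S.
  exact: span_gen.
rewrite (gderT_bic (ph_hom v)); apply: spanD; first exact: om1_bic.
apply: spanZ; apply: span_gen; right; exists x, (gderT dg (wdeg v + N) (ph v) q); split=> //.
by rewrite mum_gderT; apply: (gder_idl S_graded) => // s; apply: ph_S.
Qed.

Lemma nat_twist u : nat_rel u -> span nat_rel (twist dg N u).
Proof.
move/nat_homog; move: u; apply: span_lin => [|u [hu [d hd]]]; first exact: linearP.
by rewrite (twist_isdeg N hd); apply: spanZ; apply: span_gen.
Qed.

Variable n : nat.
Notation Ln := ('I_n * 'I_n * L)%type.
Variables (Fn : freemod k (seq Ln)) (FFn : freemod k (seq Ln * seq Ln)).
Notation ndg := (@ndg L dg n).
Notation Sn := (rep_rel dg (n := n) (F := F) (Fn := Fn) S).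
Notation opn := (op dg ndg (F := F) (F' := Fn) N (phin Fn ph)).
Notation opTn := (opT dg ndg (F := F) (F' := Fn) (FF' := FFn) N (phin Fn ph)).

Lemma opn_nat u x : nat_rel u -> idl Sn (opn u x).
Proof.
move/nat_homog; move: u; apply: span_lin => [|u [hu [d hd]]]; first exact: opl_linear.
by apply: (op_rel _ _ _ hd) => a; apply: phiF_phin_idl => b; apply: nat_phiF.
Qed.

Lemma opTn_nat u p : nat_rel u -> tidl Sn (opTn u p).
Proof.
move/nat_homog; move: u; apply: span_lin => [|u [hu [d hd]]]; first exact: opTl_linear.
by apply: (opT_rel _ _ _ hd) => a; apply: phiF_phin_idl => b; apply: nat_phiF.
Qed.

Lemma omrel_opTn u p : omrel ndg Sn p -> span (omrel ndg Sn) (opTn u p).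
Proof.
move=> hp; move: u; apply: frA_lin_span => [|v]; first exact: opTl_linear.
rewrite opT_mo; apply: gderT_omrel hp.
- exact: phin_hom.
- exact: Sn_graded.
by move=> s; apply: phin_Sn.
Qed.
End Action.

Variable n : nat.
Notation Ln := ('I_n * 'I_n * L)%type.
Variable (Fn : freemod k (seq Ln)).
Notation Sn := (rep_rel dg (n := n) (F := F) (Fn := Fn) S).

Lemma trn_comm v w :
  idl Sn (trn Fn (mo v ** mo w - sg k (wdeg v * wdeg w) *: (mo w ** mo v))).
Proof.
rewrite linearB linearZ /= /trn.
under eq_bigr => i _ do rewrite pnM.
under [X in _ *: X]eq_bigr => i _ do rewrite pnM.
rewrite exchange_big scaler_sumr -sumrB; apply: span_sum => i _.
rewrite scaler_sumr -sumrB; apply: span_sum => l _.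
rewrite !pn_mo; exact: comm_pw.
Qed.

Lemma trn_idl u : idl S u -> idl Sn (trn Fn u).
Proof. by move=> h; apply: span_sum => i _; apply: pn_idl. Qed.
End Commutators.

Lemma linear_pair (k : fieldType) (U V W : lmodType k) (f : U -> V) (g : U -> W) :
  linear f -> linear g -> linear (fun x => (f x, g x)).
Proof. by move=> lf lg a x y; rewrite lf lg. Qed.

Lemma span_pair (k : fieldType) (U V : lmodType k) (A : U -> Prop) (B : V -> Prop)
    (T : U * V -> Prop) x y :
  (forall a, A a -> T (a, 0)) -> (forall b, B b -> T (0, b)) ->
  span A x -> span B y -> span T (x, y).
Proof.
move=> hA hB hx hy; rewrite -[x]addr0 -[y]add0r.
apply: (@spanD _ _ _ (x, 0) (0, y)).
  move: x hx; apply: (span_lin (f := fun x => (x, 0 : V))) => [|a Aa].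
    by apply: linear_pair; [lin|exact: linear_0].
  exact/span_gen/hA.
move: y hy; apply: (span_lin (f := fun y => (0 : U, y))) => [|b Bb].
  by apply: linear_pair; [exact: linear_0|lin].
exact/span_gen/hB.
Qed.

Section Classes.
Variable k : fieldType.

Lemma cls_scale (X : subq k) (lX : linear_subq X) c x : cyc x -> cls (c *: x) = c *: @cls k X x.
Proof.
move=> cx; rewrite -[c *: x in LHS](subrK x) -{2}[x]scale1r -scalerBl (cls_lin lX) //.
by rewrite scalerBl scale1r subrK.
Qed.

Lemma cls_rel (X : subq k) x y : cyc x -> cyc y -> span (@rel k X) (x - y) -> cls x = cls y.
Proof.
move=> cx cy h; apply/(clsP cx cy); apply: span_sub h => z rz.
by apply: span_gen; left.
Qed.

Lemma graded_map_of (X Y : subq k) e (f : amb X -> amb Y) F : induces f F ->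
  (forall i x, hdg i x -> hdg (i + e) (f x)) -> graded_map e F.
Proof. by move=> I h i _ [x [cx dx ->]]; have [cf ->] := I x cx; exists (f x); split; auto. Qed.

Lemma graded_op_of (X Y Z : subq k) e (f : amb X -> amb Y -> amb Z) F : induces2 f F ->
  (forall i j x y, hdg i x -> hdg j y -> hdg (i + j + e) (f x y)) -> graded_op e F.
Proof.
move=> I h i j _ _ [x [cx dx ->]] [y [cy dy ->]]; have [cf ->] := I x y cx cy.
by exists (f x y); split; auto.
Qed.

Lemma lie_mod_hom_of (X M M' : subq k) N e
    (a : amb X -> amb M -> amb M) (a' : amb X -> amb M' -> amb M') (f : amb M -> amb M') A A' F :
  linear_subq M -> linear_subq M' ->
  induces2 a A -> induces2 a' A' -> induces f F ->
  (forall i x, hdg i x -> hdg (i + e) (f x)) ->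
  (forall i x y, hdg i x ->
     span (@rel k M') (f (a x y) - sg k (e * (i + N)) *: a' x (f y))) ->
  lie_mod_hom N e A A' F.
Proof.
move=> lM lM' hA hA' hF hd h; split; first exact: graded_map_of hF hd.
move=> i _ y [x [cx dx ->]]; have [z cz ->] := cls_surj lM y.
have [c1 ->] := hA x z cx cz; have [c2 ->] := hF _ c1.
have [c3 ->] := hF z cz; have [c4 ->] := hA' x _ cx c3.
rewrite -(cls_scale lM') //; apply: cls_rel => //; last exact: h.
have := cyc_lin lM' (sg k (e * (i + N)) - 1) c4 c4.
by rewrite scalerBl scale1r subrK.
Qed.
End Classes.

(* The conclusion of the theorem for arbitrary complexes X, Y, Z, W in the
   places of HC, HH, HR and HO; c r s is the defect of equivariance of T. *)
Definition diagram_prop (k : fieldType) (N : int) (X Y Z W : subq k)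
    (br : amb X -> amb X -> amb X) (aY : amb X -> amb Y -> amb Y)
    (aZ : amb X -> amb Z -> amb Z) (aW : amb X -> amb W -> amb W)
    (co : amb X -> amb Y) (tr : amb X -> amb Z) (tc : amb Y -> amb W) (dd : amb Z -> amb W)
    (c : amb X -> amb X -> k) (one : amb Z) : Prop :=
  exists
    (bHC : homology X -> homology X -> homology X)
    (aHH : homology X -> homology Y -> homology Y)
    (aHR : homology X -> homology Z -> homology Z)
    (aHO : homology X -> homology W -> homology W)
    (B : {linear homology X -> homology Y})
    (T : {linear homology X -> homology Z})
    (T' : {linear homology Y -> homology W})
    (d : {linear homology Z -> homology W}),
  [/\ induces2 br bHC, induces2 aY aHH, induces2 aZ aHR & induces2 aW aHO] /\
  [/\ graded_op N bHC, graded_op N aHH, graded_op N aHR & graded_op N aHO] /\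
  [/\ induces co B, induces tr T, induces tc T' & induces dd d] /\
  [/\ lie_mod_hom N 1 bHC aHH B,
      graded_map 0 T /\
      forall r s : amb X, cyc r -> cyc s ->
        aHR (cls r) (T (cls s)) = T (bHC (cls r) (cls s)) + c r s *: cls one,
      lie_mod_hom N (-1) aHH aHO T'
    & lie_mod_hom N 0 aHR aHO d] /\
  forall x, d (T x) = T' (B x).

Section Twist.
Variables (k : fieldType) (L : choiceType) (dg : L -> int) (N : int).
Variable F : freemod k (seq L).
Notation tw := (twist dg (F := F) N).
Variable delta : L -> F.
Hypothesis delta_hom : forall a, isdeg dg (-1 + dg a) (delta a).

Lemma twK u : tw (tw u) = u.
Proof.
move: u; apply: frA_lin => [||w]; [by lin..|].
by rewrite twist_mo linearZ /= twist_mo scalerA sgK scale1r.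
Qed.

Lemma tw_d u : tw (gder dg (-1) delta u) = - gder dg (-1) delta (tw u).
Proof.
move: u; apply: frA_lin => [||w]; [by lin..|].
rewrite (twist_isdeg N (gder_isdeg delta_hom (isdeg_mo F dg w))) twist_mo gderZ.
by lmod k; sgring.
Qed.
End Twist.

(** * The four complexes, the actions on them, and the maps between them *)

Section Main.
Variables (k : fieldType) (L : choiceType) (dg : L -> int) (N : int).
Variables (F : freemod k (seq L)) (FF : freemod k (seq L * seq L)).
Variables (S : F -> Prop) (ph : seq L -> L -> F) (delta dgen : L -> F).
Variable n : nat.
Notation Ln := ('I_n * 'I_n * L)%type.
Variables (Fn : freemod k (seq Ln)) (FFn : freemod k (seq Ln * seq Ln)).
Notation mo := (fmono F).
Notation mon := (fmono Fn).
Notation wdeg := (Defs.wdeg dg).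
Notation ndg := (@ndg L dg n).
Notation Sn := (rep_rel dg (n := n) (F := F) (Fn := Fn) S).
Notation op_ := (op dg dg (F := F) (F' := F) N ph).
Notation opT_ := (opT dg dg (F := F) (F' := F) (FF' := FF) N ph).
Notation opn := (op dg ndg (F := F) (F' := Fn) N (phin Fn ph)).
Notation opTn := (opT dg ndg (F := F) (F' := Fn) (FF' := FFn) N (phin Fn ph)).
Notation be := (be dg (FF := FF) F).
Notation mum := (mum F (FF := FF)).
Notation tw := (twist dg (F := F) N).
Notation d_ := (gder dg (-1) delta).
Notation dT := (gderT dg (FF := FF) (-1) delta).
Notation dn_ := (gder ndg (-1) (onletters Fn delta)).
Notation dTn := (gderT ndg (FF := FFn) (-1) (onletters Fn delta)).

Hypothesis S_graded : graded_gen dg S.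
Hypothesis S_letter : forall s, S s -> span (fun u => exists a, u = mo [:: a]) s.
Hypothesis ph_hom : forall v b, isdeg dg (wdeg v + N + dg b) (ph v b).
Hypothesis ph_S : forall v s, S s -> idl S (gder dg (wdeg v + N) (ph v) s).
Hypothesis ph_idl : forall b u, idl S u -> idl S (phiF ph u b).
Hypothesis ph_comm : forall b v w,
  phiF ph (mo (v ++ w) - sg k (wdeg v * wdeg w) *: mo (w ++ v)) b = 0.
Hypothesis ph_unit : forall b, phiF ph (mo [::]) b = 0.
Hypothesis ph_d : forall v b, idl S (d_ (ph v b)
  - (phiF ph (d_ (mo v)) b + sg k (wdeg v + N) *: gder dg (wdeg v + N) (ph v) (delta b))).
Hypothesis delta_hom : forall a, isdeg dg (-1 + dg a) (delta a).
Hypothesis delta_S : forall s, S s -> idl S (d_ s).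
Hypothesis delta_au : forall a, au (delta a) = 0.
Hypothesis dgen_delta : forall a, idl S (dgen a - delta a).
Hypothesis opT_mum : forall u p, mum (opT_ u p) = op_ u (mum p).
Hypothesis opT_be : forall u p, be (opT_ u p) = op_ u (be p).
Hypothesis au_op_beta : forall z p, idl S (mum p) -> au (op_ z (be p)) = 0.

(** [dgen] is the differential of the statement, whose homogeneity is not assumed. The Leibniz
    arguments use the homogeneous [delta], congruent to it modulo the ideal of S. *)
Definition cxHC := @Subq k F (fun _ => True) (nat_rel dg S) (gder dg (-1) dgen) (isdeg dg).
Definition cxHH := @Subq k (FF * F)%type
  (fun p => idl S (mum p.1) /\ au p.2 = 0)
  (fun p => (om1 dg S p.1 /\ p.2 = 0) \/ (p.1 = 0 /\ idl S p.2))
  (fun p => (- gderT dg (-1) dgen p.1, be p.1 + gder dg (-1) dgen p.2))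
  (fun i p => isdegT dg (i - 1) p.1 /\ isdeg dg i p.2).
Definition cxHR := @Subq k Fn (fun _ => True) (idl Sn)
  (gder ndg (-1) (onletters Fn dgen)) (isdeg ndg).
Definition cxHO := @Subq k FFn (fun _ => True) (omrel ndg Sn)
  (gderT ndg (-1) (onletters Fn dgen)) (isdegT ndg).

Definition aug0 (u : F) : F := u - au u *: mo [::].
(** [tw] supplies the sign for passing the shift of the first summand; [aug0] projects the bracket
    back to \bar R. *)
Definition actcone (u : F) (p : FF * F) : FF * F := (opT_ (tw u) p.1, aug0 (op_ u p.2)).

Lemma auP a x y : au (a *: x + y : F) = a * au x + au y :> k.
Proof. exact: linearP. Qed.

Lemma linear_aug0 : linear aug0.
Proof.
apply: linear_add; first by lin.
apply: linear_opp => a x y.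
by rewrite auP scalerDl scalerA.
Qed.
HB.instance Definition _ := GRing.isLinear.Build k F F _ aug0 linear_aug0.

Lemma au_aug0 u : au (aug0 u) = 0.
Proof.
rewrite /aug0 linearB linearZ /= /au [lw _ (mo [::])]lwE.
by rewrite [_ *: _]mulr1 subrr.
Qed.

Lemma lHC : linear_subq cxHC.
Proof. by split=> //; apply: linearP. Qed.
Lemma lHR : linear_subq cxHR.
Proof. by split=> //; apply: linearP. Qed.
Lemma lHO : linear_subq cxHO.
Proof. by split=> //; apply: linearP. Qed.
Lemma lHH : linear_subq cxHH.
Proof.
split; first by apply: linear_pair; lin.
move=> p; elim=> [|a x y [h1 h2] _ [h3 h4]]; split => /=.
- by rewrite linear0; apply: span0.
- exact: linear0.
- by rewrite linearP; apply: spanD => //; apply: spanZ.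
by rewrite auP h2 h4 mulr0 addr0.
Qed.

Lemma au_d u : au (d_ u) = 0.
Proof.
move: u; apply: (@frA_lin _ _ _ k^o) => [||w]; [by lin|exact: linear_0|].
rewrite gder_mo; elim: w => [|a w IH] /=; first exact: linear0.
by rewrite linearD linearZ /= !auM delta_au IH mul0r mulr0 scaler0 addr0.
Qed.

Lemma dgen_d u : idl S (gder dg (-1) dgen u - d_ u).
Proof. exact: gder_congr. Qed.
Lemma dgen_dT p : tidl S (gderT dg (-1) dgen p - dT p).
Proof. exact: gderT_congr. Qed.
Lemma dgenn_delta c : idl Sn (onletters Fn dgen c - onletters Fn delta c).
Proof. by rewrite /onletters -pnB; apply: pn_idl. Qed.
Lemma dgen_dn u : idl Sn (gder ndg (-1) (onletters Fn dgen) u - dn_ u).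
Proof. by apply: gder_congr => c; apply: dgenn_delta. Qed.
Lemma dgen_dTn p : tidl Sn (gderT ndg (-1) (onletters Fn dgen) p - dTn p).
Proof. by apply: gderT_congr => c; apply: dgenn_delta. Qed.

Lemma cone_rel p u : span (om1 dg S) p -> idl S u -> span (@rel k cxHH) (p, u).
Proof.
move=> hp hu; apply: (span_pair (A := om1 dg S) (B := idl S)) hp (span_gen hu) => x hx.
  by left.
by right.
Qed.

Let d_hom w : isdeg dg (wdeg w - 1) (d_ (mo w)).
Proof. by rewrite addrC; apply: gder_isdeg (isdeg_mo F dg w). Qed.

Lemma bracket_HC : exists b, induces2 (X := cxHC) (Y := cxHC) (Z := cxHC) op_ b.
Proof.
apply: (@operation_exists k cxHC cxHC cxHC lHC lHC op_ op_ tw d_ d_ d_ (fun _ => False)) => //=.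
- exact: opl_linear.
- exact: op_linear.
- exact: opl_linear.
- exact: op_linear.
- by move=> u; apply/nat_idl/dgen_d.
- by move=> u _; apply/nat_idl/dgen_d.
- by move=> u _; apply/nat_idl/dgen_d.
- exact: linearP.
- by move=> x y _; rewrite subrr; apply: span0.
- by move=> x y hx _; apply/nat_idl/op_nat.
- by move=> x y hy; apply: nat_op.
- exact: twK.
- exact: linearP.
- by move=> x; apply: nat_twist.
- by move=> x; apply: tw_d.
by move=> x y _; apply/nat_idl/(op_d (d := d_) ph_hom (linearP _) d_hom delta_hom ph_d).
Qed.

Lemma action_HH : exists b, induces2 (X := cxHC) (Y := cxHH) (Z := cxHH) actcone b.
Proof.
pose dc (p : FF * F) := (- dT p.1, be p.1 + d_ p.2).
(* The bracket is its own model, so the set of discrepancies is empty. *)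
apply: (@operation_exists k cxHC cxHH cxHH lHC lHH actcone actcone tw d_ dc dc (fun _ => False)) => //=.
- move=> p; apply: linear_pair; first by apply: linear_opT; apply: linearP.
  by apply: linear_comp; apply: opl_linear.
- by move=> u; apply: linear_pair; lin.
- move=> p; apply: linear_pair; first by apply: linear_opT; apply: linearP.
  by apply: linear_comp; apply: opl_linear.
- by move=> u; apply: linear_pair; lin.
- move=> x y [hy _]; split; last exact: au_aug0.
  by rewrite opT_mum; apply: op_idl.
- by move=> u; apply/nat_idl/dgen_d.
- move=> p _; apply: cone_rel => /=.
    by apply: om1_tidl; rewrite -opprD; apply: spanN; apply: dgen_dT.
  by rewrite opprD addrACA subrr add0r; apply: dgen_d.
- move=> p _; apply: cone_rel => /=.
    by apply: om1_tidl; rewrite -opprD; apply: spanN; apply: dgen_dT.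
  by rewrite opprD addrACA subrr add0r; apply: dgen_d.
- by apply: linear_pair; lin.
- by move=> x y _; rewrite subrr; apply: span0.
- move=> x y hx _; apply: cone_rel => /=.
    apply: om1_tidl; move: (nat_twist N S_graded hx).
    move: (tw x); apply: span_lin => [|u hu]; first exact: opTl_linear.
    exact: opT_nat.
  have h : idl S (op_ x y.2) by apply: op_nat.
  by rewrite /aug0 (au_idl S_letter h) scale0r subr0.
- move=> x [p u] [[/= hp ->]|[/= -> hu]]; apply: cone_rel => /=.
  + exact: om1_opT.
  + by rewrite /aug0 !linear0 scale0r subr0; apply: span0.
  + by rewrite linear0; apply: span0.
  have h : idl S (op_ x u) by apply: op_idl.
  by rewrite /aug0 (au_idl S_letter h) scale0r subr0.
- exact: twK.
- exact: linearP.
- by move=> x; apply: nat_twist.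
- by move=> x; apply: tw_d.
move=> x [p u] [hp _]; apply: cone_rel => /=.
  (* The shifted summand is acted on by [tw x], so the Leibniz rule is used for [tw x]. The minus
     sign in [tw_d] matches that of the differential of the cone. *)
  apply: om1_tidl; rewrite (tw_d N delta_hom).
  have := opT_d (d := d_) ph_hom (linearP _) d_hom delta_hom ph_d (tw x) p.
  move/spanN; apply: span_eq; rewrite !twK.
  have eN v : opT_ (- v) p = - opT_ v p by exact: linearN.
  by rewrite linearN eN /=; lmod k; ring.
have h1 := op_d (d := d_) ph_hom (linearP _) d_hom delta_hom ph_d x u.
have eD a b : aug0 (a + b) = aug0 a + aug0 b by exact: linearD.
have eO a b : op_ (tw x) (a + b) = op_ (tw x) a + op_ (tw x) b by exact: linearD.
have e1 : d_ (aug0 (op_ x u)) = d_ (op_ x u).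
  by rewrite /aug0 gderD gderN gderZ gder1 scaler0 subr0.
(* The projection changes nothing here: the two terms without beta sum to [d_ (op_ x u)] modulo the
   ideal, hence have no constant term in total, and the beta term has none by [au_op_beta], as p
   lies in Omega^1. *)
have e2 : aug0 (op_ (d_ x) u + (op_ (tw x) (be p) + op_ (tw x) (d_ u)))
    = op_ (d_ x) u + (op_ (tw x) (be p) + op_ (tw x) (d_ u)).
  rewrite /aug0; set c := au _; suff -> : c = 0 by rewrite scale0r subr0.
  have := au_idl S_letter h1; rewrite linearB /= au_d sub0r => /eqP; rewrite oppr_eq0 => /eqP h2.
  by rewrite /c addrCA linearD /= au_op_beta // h2 addr0.
rewrite opT_be eO -eD e1 e2; apply: span_eq h1.
by lmod k; ring.
Qed.

Variables (aR : F -> Fn -> Fn) (aO : F -> FFn -> FFn).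
Hypotheses (aRl : forall x, linear (aR^~ x)) (aRr : forall u, linear (aR u)).
Hypotheses (aOl : forall p, linear (aO^~ p)) (aOr : forall u, linear (aO u)).
Hypothesis aR_opn : forall u x, idl Sn (aR u x - opn (aug0 u) x).
Hypothesis aO_opTn : forall u p, tidl Sn (aO u p - opTn (aug0 u) p).

(** The unit is a relation of R_nat and acts by zero modulo relations, so removing the constant term
    of u does not affect its action. *)
Lemma opn_aug0 u x : idl Sn (opn (aug0 u) x - opn u x).
Proof.
have h : idl Sn (opn (mo [::]) x).
  by apply: (opn_nat N S_graded ph_idl ph_comm ph_unit); constructor 2.
have eB a b : opn (a - b) x = opn a x - opn b x by exact: linearB.
by rewrite /aug0 eB opZl addrAC subrr sub0r; apply/spanN/spanZ.
Qed.

Lemma opTn_aug0 u p : tidl Sn (opTn (aug0 u) p - opTn u p).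
Proof.
have h : tidl Sn (opTn (mo [::]) p).
  by apply: (opTn_nat N S_graded ph_idl ph_comm ph_unit); constructor 2.
have eB a b : opTn (a - b) p = opTn a p - opTn b p by exact: linearB.
by rewrite /aug0 eB opTZl addrAC subrr sub0r; apply/spanN/spanZ.
Qed.

Lemma aRE u x : idl Sn (aR u x - opn u x).
Proof. exact: span_trans (aR_opn u x) (opn_aug0 u x). Qed.
Lemma aOE u p : tidl Sn (aO u p - opTn u p).
Proof. exact: span_trans (aO_opTn u p) (opTn_aug0 u p). Qed.

Let Sng : graded_gen ndg Sn.
Proof. exact: Sn_graded. Qed.
Let phn_hom v c : isdeg ndg (wdeg v + N + ndg c) (phin Fn ph v c).
Proof. exact: phin_hom. Qed.
Let phn_S v s : Sn s -> idl Sn (gder ndg (wdeg v + N) (phin Fn ph v) s).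
Proof. exact: phin_Sn. Qed.
Let phn_d v c : idl Sn (dn_ (phin Fn ph v c) - (phiF (phin Fn ph) (d_ (mo v)) c
  + sg k (wdeg v + N) *: gder ndg (wdeg v + N) (phin Fn ph v) (onletters Fn delta c))).
Proof. exact: phin_d. Qed.
Let deltan_hom c : isdeg ndg (-1 + ndg c) (onletters Fn delta c).
Proof. exact: isdeg_onletters. Qed.
Let deltan_S s : Sn s -> idl Sn (dn_ s).
Proof. exact: gder_onletters_Sn. Qed.

Lemma action_HR : exists b, induces2 (X := cxHC) (Y := cxHR) (Z := cxHR) aR b.
Proof.
(* The Poisson action agrees with the induced derivation [opn] only modulo [Sn], an ideal which
   [dn_] preserves. *)
apply: (@operation_exists k cxHC cxHR cxHR lHC lHR aR opn tw d_ dn_ dn_ (idl Sn)) => //=.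
- exact: opl_linear.
- exact: op_linear.
- by move=> u; apply/nat_idl/dgen_d.
- by move=> u _; apply: span_gen; apply: dgen_dn.
- by move=> u _; apply: span_gen; apply: dgen_dn.
- exact: linearP.
- by move=> z; apply: span_gen.
- by move=> z h; apply: span_gen; apply: gder_idl h.
- by move=> u x _; apply: span_gen; apply: aRE.
- by move=> x y hx _; apply: span_gen; apply: (opn_nat N S_graded ph_idl ph_comm ph_unit).
- by move=> x y hy; apply: span_gen; apply: op_idl.
- exact: twK.
- exact: linearP.
- by move=> x; apply: nat_twist.
- by move=> x; apply: tw_d.
move=> x y _; apply: span_gen.
exact: (op_d (d := d_) phn_hom (linearP _) d_hom deltan_hom phn_d).
Qed.

Lemma action_HO : exists b, induces2 (X := cxHC) (Y := cxHO) (Z := cxHO) aO b.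
Proof.
apply: (@operation_exists k cxHC cxHO cxHO lHC lHO aO opTn tw d_ dTn dTn (tidl Sn)) => //=.
- exact: opTl_linear.
- exact: opT_linear.
- by move=> u; apply/nat_idl/dgen_d.
- by move=> u _; apply: omrel_tidl; apply: dgen_dTn.
- by move=> u _; apply: omrel_tidl; apply: dgen_dTn.
- exact: linearP.
- by move=> z; apply: omrel_tidl.
- by move=> z h; apply: omrel_tidl; apply: gderT_tidl h.
- by move=> u x _; apply: span_gen; apply: aOE.
- by move=> x y hx _; apply: omrel_tidl; apply: (opTn_nat N S_graded ph_idl ph_comm ph_unit).
- by move=> x y hy; apply: omrel_opTn.
- exact: twK.
- exact: linearP.
- by move=> x; apply: nat_twist.
- by move=> x; apply: tw_d.
move=> x y _; apply: omrel_tidl.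
exact: (opT_d (d := d_) phn_hom (linearP _) d_hom deltan_hom phn_d).
Qed.

Lemma au_comm v w : au (mo v ** mo w - sg k (wdeg v * wdeg w) *: (mo w ** mo v)) = 0.
Proof.
rewrite linearB linearZ /= !moM /au !lwE.
case: v => [|a v]; case: w => [|b w] /=; rewrite ?wdeg_nil ?mul0r ?mulr0 ?scale1r ?scaler0 ?subrr ?subr0 //.
Qed.

Lemma au_dgen u : au (gder dg (-1) dgen u) = 0.
Proof.
have := au_idl S_letter (dgen_d u); rewrite linearB /= au_d => /eqP.
by rewrite subr0 => /eqP.
Qed.

Lemma gderB e (f : L -> F) u v : gder dg e f (u - v) = gder dg e f u - gder dg e f v.
Proof. exact: linearB. Qed.

Lemma trn_gder e (f : L -> F) u : gder ndg e (onletters Fn f) (trn Fn u) = trn Fn (gder dg e f u).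
Proof. by rewrite linear_sum; apply: eq_bigr => i _; apply: pn_gder. Qed.

Definition conn (u : F) : FF * F := (dn FF u, 0).
Definition tr0 (u : F) : Fn := trn Fn (aug0 u).
Definition trcone (p : FF * F) : FFn := TO Fn FFn p.1.
Definition ddn (u : Fn) : FFn := ten FFn (mon [::]) u.

Lemma connes_map : exists B : {linear homology cxHC -> homology cxHH},
  induces (X := cxHC) (Y := cxHH) conn B.
Proof.
(* The scalar is -1 because the shifted summand of the cone carries the opposite differential; the
   second component causes no trouble since [be] kills the image of [dn]. *)
apply: (@induced_exists k cxHC cxHH lHC lHH conn (-1)) => //=.
- by apply: linear_pair; [lin|exact: linear_0].
- by move=> u _; rewrite mum_dn /au linear0; split=> //; apply: span0.
- move=> u hu; apply: cone_rel; last exact: span0.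
  case: hu => [h|->|[v [w ->]]]; last by rewrite !moM; apply: dn_comm.
    exact/om1_tidl/dn_idl.
  by rewrite dnE subrr; apply: span0.
- move=> u _; apply: cone_rel => /=.
    by rewrite gderT_dn scaleN1r opprK subrr; apply: span0.
  by rewrite be_dn [gder _ _ _ 0]linear0 addr0 scaler0 subrr; apply: span0.
by rewrite oppr_eq0 oner_eq0.
Qed.

Lemma trace_map : exists T : {linear homology cxHC -> homology cxHR},
  induces (X := cxHC) (Y := cxHR) tr0 T.
Proof.
apply: (@induced_exists k cxHC cxHR lHC lHR tr0 1) => //=.
- by rewrite /tr0; lin.
- move=> u hu; apply: span_gen; rewrite /tr0; case: hu => [h|->|[v [w ->]]].
  + by rewrite /aug0 (au_idl S_letter h) scale0r subr0; apply: trn_idl.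
  + by rewrite /aug0 /au lwE scale1r subrr linear0; apply: span0.
  by rewrite /aug0 au_comm scale0r subr0; apply: trn_comm.
- move=> u _; apply: span_gen; rewrite scale1r /tr0 trn_gder /aug0 gderB gderZ gder1.
  by rewrite au_dgen scale0r scaler0 subrr; apply: span0.
exact: oner_neq0.
Qed.

Lemma trcone_map : exists T : {linear homology cxHH -> homology cxHO},
  induces (X := cxHH) (Y := cxHO) trcone T.
Proof.
apply: (@induced_exists k cxHH cxHO lHH lHO trcone (-1)) => //=.
- by rewrite /trcone; lin.
- move=> [p u] [[/= h _]|[/= -> _]]; rewrite /trcone /=; first exact: TO_om1.
  by rewrite linear0; apply: span0.
- move=> [p u] _; rewrite /trcone /= TO_gderT linearN scaleN1r opprK addNr; exact: span0.
by rewrite oppr_eq0 oner_eq0.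
Qed.

Lemma gderTn_one e f u : gderT ndg e f (ten FFn (mon [::]) u) = ten FFn (mon [::]) (gder ndg e f u).
Proof. by rewrite gderT_ten gder1 ten0l add0r sgm_mo wdeg_nil mulr0 scale1r. Qed.

Lemma ddn_map : exists d : {linear homology cxHR -> homology cxHO},
  induces (X := cxHR) (Y := cxHO) ddn d.
Proof.
apply: (@induced_exists k cxHR cxHO lHR lHO ddn 1) => //=.
- by rewrite /ddn; lin.
- by move=> u h; apply/omrel_tidl/tidl_r.
- by move=> u _; rewrite /ddn gderTn_one scale1r subrr; apply: span0.
exact: oner_neq0.
Qed.

Hypothesis aR_hom : forall i j u x, isdeg dg i u -> isdeg ndg j x -> isdeg ndg (i + j + N) (aR u x).
Hypothesis aO_hom : forall i j u p, isdeg dg i u -> isdegT ndg j p -> isdegT ndg (i + j + N) (aO u p).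

Lemma aug0_hom i u : isdeg dg i u -> isdeg dg i (aug0 u).
Proof.
move: u; apply: isdeg_lin_span => [|w <-]; first exact: linear_aug0.
rewrite /aug0 /au lwE; case: w => [|a w].
  by rewrite scale1r subrr; apply: span0.
by rewrite scale0r subr0; apply: isdeg_mo.
Qed.

Lemma TO_hom d (p : FF) : isdegT dg d p -> isdegT ndg d (TO Fn FFn p).
Proof.
move: p; apply: isdegT_lin_span => [|v w <-]; first exact: linearP.
rewrite -(ten_mo F) TO_ten; apply: spanN; apply: span_sum => i _; apply: span_sum => l _.
by rewrite !pn_mo; apply: isdegT_ten; apply: pw_hom.
Qed.

Lemma dn_hom d (u : F) : isdeg dg d u -> isdegT dg d (dn FF u).
Proof.
have h1 : isdeg dg 0 (mo [::]) by rewrite -(wdeg_nil dg); apply: isdeg_mo.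
move=> h; rewrite dnE; apply: spanB; first by rewrite -[d]addr0; apply: isdegT_ten.
by rewrite -[d]add0r; apply: isdegT_ten.
Qed.

Lemma conn_hom i u : @hdg k cxHC i u -> @hdg k cxHH (i + 1) (conn u).
Proof. by move=> h; split; [rewrite addrK; apply: dn_hom|apply: span0]. Qed.

Lemma tr0_hom i u : @hdg k cxHC i u -> @hdg k cxHR (i + 0) (tr0 u).
Proof. by move=> h; rewrite addr0; apply/trn_hom/aug0_hom. Qed.

Lemma trcone_hom i p : @hdg k cxHH i p -> @hdg k cxHO (i + -1) (trcone p).
Proof. by case=> h _; apply: TO_hom. Qed.

Lemma ddn_hom i u : @hdg k cxHR i u -> @hdg k cxHO (i + 0) (ddn u).
Proof.
have h1 : isdeg ndg 0 (mon [::]) by rewrite -(wdeg_nil ndg); apply: isdeg_mo.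
by move=> h; rewrite addrC; apply: isdegT_ten.
Qed.

Lemma actcone_hom i j u p : @hdg k cxHC i u -> @hdg k cxHH j p ->
  @hdg k cxHH (i + j + N) (actcone u p).
Proof.
move=> hu [h1 h2]; split; last by apply/aug0_hom/op_isdeg.
rewrite /= (twist_isdeg N hu) opTZl; apply: spanZ.
have -> : i + j + N - 1 = i + (j - 1) + N by ring.
exact: opT_isdegT.
Qed.

Lemma opT_dn u x : opT_ u (dn FF x) = dn FF (op_ u x).
Proof.
move: u; apply: frA_lin => [||v]; first exact: opTl_linear.
  by apply: linear_comp; apply: opl_linear.
by rewrite opT_mo op_mo gderT_dn.
Qed.

Lemma opTn_ddn u x : opTn u (ddn x) = ddn (opn u x).
Proof.
rewrite /ddn; move: u; apply: frA_lin => [||v]; first exact: opTl_linear.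
  by apply: linear_comp; apply: opl_linear.
by rewrite opT_mo op_mo gderTn_one.
Qed.

Lemma opn_trn u x : opn u (trn Fn x) = trn Fn (op_ u x).
Proof. by rewrite linear_sum; apply: eq_bigr => i _; apply: opn_pn. Qed.

(** The sign of a map of degree 1 passing the operator is exactly the sign that [tw] introduces on
    the shifted summand, so the two cancel. *)
Lemma conn_lie bHC aHH B :
  induces2 (X := cxHC) (Y := cxHC) (Z := cxHC) op_ bHC ->
  induces2 (X := cxHC) (Y := cxHH) (Z := cxHH) actcone aHH ->
  induces (X := cxHC) (Y := cxHH) conn B -> lie_mod_hom N 1 bHC aHH B.
Proof.
move=> hb ha hB; apply: (lie_mod_hom_of lHC lHH hb ha hB conn_hom) => i x y dx.
rewrite /conn /actcone /= (twist_isdeg N dx) opTZl opT_dn; apply: cone_rel => /=.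
  by rewrite scalerA mul1r sgK scale1r subrr; apply: span0.
by rewrite [op_ x 0]linear0 [aug0 0]linear0 scaler0 subrr; apply: span0.
Qed.

Lemma trcone_lie aHH aHO T :
  induces2 (X := cxHC) (Y := cxHH) (Z := cxHH) actcone aHH ->
  induces2 (X := cxHC) (Y := cxHO) (Z := cxHO) aO aHO ->
  induces (X := cxHH) (Y := cxHO) trcone T -> lie_mod_hom N (-1) aHH aHO T.
Proof.
move=> ha hb hT; apply: (lie_mod_hom_of lHH lHO ha hb hT trcone_hom) => i x y dx.
rewrite /trcone /actcone /= (twist_isdeg N dx) opTZl linearZ /= -opTn_TO mulN1r sgN -scalerBr.
by apply: spanZ; apply: spanBC; apply: omrel_tidl; apply: aOE.
Qed.

Lemma ddn_lie aHR aHO d :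
  induces2 (X := cxHC) (Y := cxHR) (Z := cxHR) aR aHR ->
  induces2 (X := cxHC) (Y := cxHO) (Z := cxHO) aO aHO ->
  induces (X := cxHR) (Y := cxHO) ddn d -> lie_mod_hom N 0 aHR aHO d.
Proof.
move=> ha hb hd; apply: (lie_mod_hom_of lHR lHO ha hb hd ddn_hom) => i x y dx.
rewrite mul0r scale1r; apply: (span_trans (y := opTn x (ddn y))).
  by rewrite opTn_ddn /ddn -tenBr; apply/omrel_tidl/tidl_r/aRE.
by apply: spanBC; apply: omrel_tidl; apply: aOE.
Qed.

Lemma cyc_one : @cyc k cxHR (mon [::]).
Proof. by split=> //=; rewrite gder1; apply: span0. Qed.

Lemma trn_one : trn Fn (mo [::]) = n%:R *: mon [::].
Proof.
rewrite /trn; under eq_bigr => i _ do rewrite pn_mo /= eqxx.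
by rewrite sumr_const card_ord scaler_nat.
Qed.

Lemma op_aug0 u x : op_ u (aug0 x) = op_ u x.
Proof.
have e : op_ u (mo [::]) = 0.
  move: u; apply: frA_lin => [||v]; [exact: opl_linear|exact: linear_0|].
  by rewrite op_mo gder1.
have eB a b : op_ u (a - b) = op_ u a - op_ u b by exact: linearB.
have eZ c a : op_ u (c *: a) = c *: op_ u a by exact: linearZ.
by rewrite /aug0 eB eZ e scaler0 subr0.
Qed.

(** The full trace [trn] is strictly equivariant for [opn]. The defect comes from [tr0], which drops
    the constant term of {r, s}, while the trace of the unit is n. *)
Lemma trace_lie bHC aHR (T : {linear homology cxHC -> homology cxHR}) :
  induces2 (X := cxHC) (Y := cxHC) (Z := cxHC) op_ bHC ->
  induces2 (X := cxHC) (Y := cxHR) (Z := cxHR) aR aHR ->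
  induces (X := cxHC) (Y := cxHR) tr0 T ->
  graded_map 0 T /\
  forall r s : F, @cyc k cxHC r -> @cyc k cxHC s ->
    aHR (@cls k cxHC r) (T (@cls k cxHC s))
    = T (bHC (@cls k cxHC r) (@cls k cxHC s)) + (n%:R * (au (op_ r s) : k)) *: @cls k cxHR (mon [::]).
Proof.
move=> hb ha hT; split; first exact: graded_map_of hT tr0_hom.
move=> r s cr cs; have [c1 ->] := hT s cs; have [c2 ->] := ha r _ cr c1.
have [c3 ->] := hb r s cr cs; have [c4 ->] := hT _ c3.
rewrite addrC -(cls_lin lHR) //; last exact: cyc_one.
apply: cls_rel => //; first exact: (cyc_lin lHR _ cyc_one c4).
apply: span_gen; apply: span_trans (aRE _ _) _.
rewrite opn_trn op_aug0 /tr0 /aug0 linearB linearZ /= trn_one.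
pose c : k := au (op_ r s); rewrite -/c.
by rewrite [n%:R * c]mulrC -scalerA [_ *: _ + (_ - _)]addrC subrK subrr; apply: span0.
Qed.

Lemma TO_dn (u : F) : TO Fn FFn (dn FF u) = ten FFn (mon [::]) (trn Fn u) - ten FFn (trn Fn u) (mon [::]).
Proof.
have e1 : \sum_i \sum_l ten FFn (pn Fn i l u) (pn Fn l i (mo [::])) = ten FFn (trn Fn u) (mon [::]).
  rewrite /trn ten_suml; apply: eq_bigr => i _; rewrite (bigD1 i) //= big1 ?addr0 => [|l li].
    by rewrite pn_mo /= eqxx.
  by rewrite [pn _ _ _ (mo _)]pn_mo /= (negPf li) linear0.
have e2 : \sum_i \sum_l ten FFn (pn Fn i l (mo [::])) (pn Fn l i u) = ten FFn (mon [::]) (trn Fn u).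
  rewrite /trn linear_sum; apply: eq_bigr => i _; rewrite (bigD1 i) //= big1 ?addr0 => [|l li].
    by rewrite pn_mo /= eqxx.
  by rewrite pn_mo /= eq_sym (negPf li) ten0l.
by rewrite dnE linearB /= !TO_ten e1 e2 opprK addrC.
Qed.

(** By [TO_dn] both sides represent the form 1 (x) Tr u up to tensors of the form w (x) 1. Those
    come from the other half of [dn] and from the dropped constant term, and vanish because d(1) =
    0. *)
Lemma trace_square B T T' d x :
  induces (X := cxHC) (Y := cxHH) conn B -> induces (X := cxHC) (Y := cxHR) tr0 T ->
  induces (X := cxHH) (Y := cxHO) trcone T' -> induces (X := cxHR) (Y := cxHO) ddn d ->
  d (T x) = T' (B x).
Proof.
move=> hB hT hT' hd; have [u cu ->] := cls_surj lHC x.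
have [c1 ->] := hT u cu; have [c2 ->] := hd _ c1.
have [c3 ->] := hB u cu; have [c4 ->] := hT' _ c3.
apply: cls_rel => //; rewrite /ddn /tr0 /trcone /conn /= TO_dn.
have h w : span (omrel ndg Sn) (ten FFn w (mon [::])) by exact: leib1.
rewrite /aug0 linearB linearZ /= trn_one tenBr !tenZr.
pose c : k := au u; rewrite -/c.
apply: span_eq (spanB (h (trn Fn u)) (spanZ c (spanZ n%:R (h (mon [::]))))).
by rewrite opprB [RHS]addrC addrA subrK.
Qed.

Lemma trace_diagram : diagram_prop N (X := cxHC) (Y := cxHH) (Z := cxHR) (W := cxHO)
  op_ actcone aR aO conn tr0 trcone ddn (fun r s => n%:R * (au (op_ r s) : k)) (mon [::]).
Proof.
have [bHC hb] := bracket_HC; have [aHH hh] := action_HH.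
have [aHR hr] := action_HR; have [aHO ho] := action_HO.
have [B hB] := connes_map; have [T hT] := trace_map.
have [T' hT'] := trcone_map; have [d hd] := ddn_map.
exists bHC, aHH, aHR, aHO, B, T, T', d; split; first by split.
split.
  split; [apply: graded_op_of hb _|apply: graded_op_of hh _|
          apply: graded_op_of hr _|apply: graded_op_of ho _] => i j x y.
  - exact: op_isdeg.
  - exact: actcone_hom.
  - exact: aR_hom.
  - exact: aO_hom.
split; first by split.
split; last by move=> x; apply: trace_square.
split; [exact: conn_lie|exact: trace_lie|exact: trcone_lie|exact: ddn_lie].
Qed.
End Main.

Lemma au_delta (k : fieldType) (L : choiceType) (F : freemod k (seq L)) d1 cp (a : L) :
  au (delta F d1 cp a) = 0.
Proof.
rewrite /delta linearD linearN linear_sum /= {1}/au lwE oppr0 add0r.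
by apply: big1 => t _; rewrite linearZ /= /au lwE scaler0.
Qed.

Lemma opT_twist_lw (k : fieldType) (L : choiceType) (dg : L -> int) (F : freemod k (seq L))
    (FF : freemod k (seq L * seq L)) N (ph : seq L -> L -> F) (u : F) (p : FF) :
  opT dg dg N ph (twist dg N u) p
  = lw (fun x => sg k (Defs.wdeg dg x + N) *: opT dg dg N ph (fmono F x) p) u.
Proof.
move: u; apply: frA_lin => [||x]; [|exact: linearP|by rewrite twist_mo opTZl lwE].
by apply: linear_opT; apply: linearP.
Qed.

Section Instance.
Variables (k : fieldType) (C : dgcoalg k) (m : int) (P : cyclic_pairing C m) (n : nat).
Notation L := (hletter C).
Notation fL := (fr k L).
Notation fLL := (frr k L).
Notation Ln := ('I_n * 'I_n * L)%type.
Notation fn := (fr k Ln).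
Notation fnn := (frr k Ln).
Notation dg := (@vdeg k C).
Notation ndg := (@ndg L dg n).
Notation S := (@Rgen k C).
Notation Sn := (rep_rel dg (n := n) (F := fL) (Fn := fn) S).
Notation vp := (vpair P).
Notation N := (m + 2).
Notation ph := (phi dg fL fLL vp).

Lemma Trn_aug0 (u : frA k L) : Trn n u = trn (F := fL) fn (aug0 (F := fL) u).
Proof. by rewrite TrnE augIE. Qed.

Definition aR (u : fL) (x : fn) : fn := actRn P u x.
Definition aO (u : fL) (p : fnn) : fnn := actOm P u p.

Lemma aR_trn u x : aR u x = pois P (trn (F := fL) fn (aug0 (F := fL) u)) x.
Proof. by rewrite /aR /actRn Trn_aug0. Qed.
Lemma aO_trn u p : aO u p = actT ndg N (@poisw k C m P n) (trn (F := fL) fn (aug0 (F := fL) u)) p.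
Proof. by rewrite /aO /actOm Trn_aug0. Qed.

Lemma aR_linearl x : linear (aR^~ x).
Proof.
move=> a u v; rewrite !aR_trn.
by rewrite linear_aug0 linearP; apply: pois_linearl.
Qed.
Lemma aR_linearr u : linear (aR u).
Proof. by move=> a x y; rewrite !aR_trn; apply: pois_linearr. Qed.
Lemma aO_linearl p : linear (aO^~ p).
Proof.
move=> a u v; rewrite !aO_trn.
by rewrite linear_aug0 linearP; apply: actOm_linearl.
Qed.
Lemma aO_linearr u : linear (aO u).
Proof. by move=> a x y; rewrite !aO_trn; apply: actOm_linearr. Qed.

Lemma aR_op u x : idl (F := fn) Sn (aR u x
  - op dg ndg (F := fL) (F' := fn) N (phin fn ph) (aug0 (F := fL) u) x).
Proof. rewrite aR_trn; exact: span_trans (poisE P _ x) (pois_trn _ _ _ _ _ _ _). Qed.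
Lemma aO_op u p : tidl (F := fn) (FF := fnn) Sn (aO u p
  - opT dg ndg (F := fL) (F' := fn) (FF' := fnn) N (phin fn ph) (aug0 (F := fL) u) p).
Proof.
rewrite aO_trn; apply: (@span_trans k fnn _ (opT ndg ndg (F := fn) (F' := fn) (FF' := fnn) N
  (psl dg fn vp) (trn (F := fL) fn (aug0 (F := fL) u)) p)); [exact: actOmE|exact: poisT_trn].
Qed.

Lemma aR_hom i j u x : isdeg dg (F := fL) i u -> isdeg ndg (F := fn) j x ->
  isdeg ndg (F := fn) (i + j + N) (aR u x).
Proof. by move=> hu hx; rewrite aR_trn; apply: isdeg_pois => //; apply/trn_hom/aug0_hom. Qed.
Lemma aO_hom i j u p : isdeg dg (F := fL) i u -> isdegT ndg (FF := fnn) j p ->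
  isdegT ndg (FF := fnn) (i + j + N) (aO u p).
Proof. by move=> hu hx; rewrite aO_trn; apply: isdeg_actOm => //; apply/trn_hom/aug0_hom. Qed.

Definition diagram := @trace_diagram k L dg N fL fLL S ph
  (delta fL (@d1 k C) (@cpd k C)) (@dgen k C) n fn fnn
  (@Rgen_graded k C) (@Rgen_letter k C)
  (phi_hom fL fLL (@vpair_deg k C m P))
  (phi_S dg N (F := fL) fLL (S := S) (@Rgen_letter k C) (@vpair_Rgenr k C m P))
  (phiF_idl (F := fL) fLL (S := S) (@vpair_deg k C m P) (@Rgen_graded k C) (@Rgen_letter k C) (@vpair_Rgenl k C m P))
  (phiF_comm fL fLL (@vpair_deg k C m P))
  (phiF_unit dg fL fLL vp)
  (phi_d (F := fL) fLL (S := S) (@vpair_deg k C m P) (@d1_deg k C) (@cpd_deg k C) (@vpair_d k C m P)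
     (@cp_cycl k C m P) (@cp_cycr k C m P))
  (delta_hom fL (@d1_deg k C) (@cpd_deg k C))
  (@delta_Rgen k C) (@au_delta k L fL (@d1 k C) (@cpd k C)) (@dgen_delta k C)
  (mum_opT dg N (F := fL) (FF := fLL) vp) (be_opT (F := fL) (FF := fLL) (@vpair_deg k C m P))
  (au_op_be N (F := fL) (FF := fLL) (S := S) (@Rgen_graded k C) (@Rgen_letter k C) (@vpair_Rgenr k C m P))
  aR aO aR_linearl aR_linearr aO_linearl aO_linearr aR_op aO_op aR_hom aO_hom.

(** The types of the homology spaces depend on the predicates in a [subq]. Extensionality makes
    equivalent predicates equal, so the complexes can be rewritten into their abstract forms. *)
Lemma predE1 (U : Type) (A B : U -> Prop) : (forall u, A u <-> B u) -> A = B.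
Proof. by move=> h; apply/funext => u; apply/propext. Qed.

Lemma natrel_eq : @natrel k C = nat_rel dg (F := fL) S.
Proof. by apply: predE1 => u; apply: natrelE. Qed.
Lemma dR_eq : @dR k C = gder (F := fL) dg (-1) (@dgen k C).
Proof. by apply/funext => u; apply: derE. Qed.
Lemma homF_eq (K : choiceType) (d : K -> int) : @homF k K d = isdeg (F := fr k K) d.
Proof. by apply/funext => i; apply: predE1 => u; apply: homFE. Qed.
Lemma homFF_eq (K : choiceType) (d : K -> int) : @homFF k K d = isdegT (FF := frr k K) d.
Proof. by apply/funext => i; apply: predE1 => u; apply: homFFE. Qed.
Lemma Rnrel_eq : @Rnrel k C n = idl (F := fn) Sn.
Proof. by apply: predE1 => u; apply: Rnrel_idl. Qed.
Lemma dRn_eq : @dRn k C n = gder (F := fn) ndg (-1) (onletters (F := fL) fn (@dgen k C)).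
Proof. by apply/funext => u; apply: dRnE. Qed.
Lemma Omnrel_eq : @Omnrel k C n = omrel ndg (F := fn) (FF := fnn) Sn.
Proof. by apply: predE1 => u; apply: OmnrelE. Qed.
Lemma derTn_eq : derT (@ndeg k C n) (@dngen k C n)
  = gderT (F := fn) (FF := fnn) ndg (-1) (onletters (F := fL) fn (@dgen k C)).
Proof. by apply/funext => u; apply: derTnE. Qed.
Lemma Omega1_eq : @Omega1 k C = fun p => idl (F := fL) S (mum fL (FF := fLL) p).
Proof. by apply: predE1 => u; apply: Omega1E. Qed.
Lemma Omega1natrel_eq : @Omega1natrel k C = om1 dg (F := fL) (FF := fLL) S.
Proof. by apply: predE1 => u; apply: Omega1natrelE. Qed.
Lemma Rrel_eq : @Rrel k C = idl (F := fL) S.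
Proof. by apply: predE1 => u; apply: Rrel_idl. Qed.
Lemma dFF_eq : @dFF k C = gderT (F := fL) (FF := fLL) dg (-1) (@dgen k C).
Proof. by apply/funext => u; apply: derTE. Qed.
Lemma beta_eq : @beta k C = be dg (FF := fLL) fL.
Proof. by apply/funext => u; apply: betaE. Qed.
Lemma aug_eq : @aug k L = au (F := fL).
Proof. by apply/funext => u; apply: augE. Qed.

Lemma actHH_eq : actHH P = actcone dg N (F := fL) (FF := fLL) ph.
Proof.
apply/funext => u; apply/funext => p; apply: (f_equal2 pair).
  apply: (eq_trans (lextE (fun x : seq L => sg k (Defs.wdeg dg x + N) *: actFF P (mono k x) p.1) u)).
  apply: (eq_trans _ (esym (@opT_twist_lw k L dg fL fLL N ph u p.1))); apply: lw_ext => x.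
  exact: (f_equal (fun q : fLL => _ *: q) (eq_trans (actFFE P _ _)
    (f_equal (fun v : fL => opT dg dg (F := fL) (F' := fL) (FF' := fLL) N ph v p.1) (monoE k x)))).
by apply: (eq_trans (augIE _)); rewrite brE.
Qed.
Lemma br_eq : br P = op dg dg (F := fL) (F' := fL) N ph.
Proof. by apply/funext => u; apply/funext => v; apply: brE. Qed.
Lemma connes_eq : @connes k C = conn fLL (F := fL).
Proof. by apply/funext => u; apply: (f_equal (fun q : fLL => (q, 0 : fL))); apply: dncE. Qed.
Lemma Trn_eq : @Trn k C n = tr0 (F := fL) fn.
Proof. by apply/funext => u; apply: Trn_aug0. Qed.
Lemma TrHH_eq : @TrHH k C n = trcone (F := fL) (FF := fLL) fn fnn.
Proof. by apply/funext => p; apply: TrOmegaE. Qed.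
Lemma ddR_eq : @ddR k C n = ddn (Fn := fn) fnn.
Proof.
apply/funext => u; apply: (eq_trans (tensE _ _)).
exact: (f_equal (fun x : fn => ten fnn x u) (oneE k _)).
Qed.
End Instance.

Theorem theorem1p3 (k : fieldType) (char0 : [pchar k] =i pred0)
    (C : dgcoalg k) (Cnil : conilpotent C) (m : int) (P : cyclic_pairing C m)
    (A : augDGA k) (AC : koszul_dual C A) (n : nat) :
  exists
    (bHC : homology (HCcx C) -> homology (HCcx C) -> homology (HCcx C))
    (aHH : homology (HCcx C) -> homology (HHcx C) -> homology (HHcx C))
    (aHR : homology (HCcx C) -> homology (HRcx C n) -> homology (HRcx C n))
    (aHO : homology (HCcx C) -> homology (HOcx C n) -> homology (HOcx C n))
    (B : {linear homology (HCcx C) -> homology (HHcx C)})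
    (T : {linear homology (HCcx C) -> homology (HRcx C n)})
    (T' : {linear homology (HHcx C) -> homology (HOcx C n)})
    (d : {linear homology (HRcx C n) -> homology (HOcx C n)}),
  [/\ induces2 (X := HCcx C) (Y := HCcx C) (Z := HCcx C) (br P) bHC,
      induces2 (X := HCcx C) (Y := HHcx C) (Z := HHcx C) (actHH P) aHH,
      induces2 (X := HCcx C) (Y := HRcx C n) (Z := HRcx C n)
        (@actRn k C m P n) aHR
    & induces2 (X := HCcx C) (Y := HOcx C n) (Z := HOcx C n)
        (@actOm k C m P n) aHO] /\
  [/\ graded_op (m + 2) bHC, graded_op (m + 2) aHH,
      graded_op (m + 2) aHR & graded_op (m + 2) aHO] /\
  [/\ induces (X := HCcx C) (Y := HHcx C) (@connes k C) B,
      induces (X := HCcx C) (Y := HRcx C n) (@Trn k C n) T,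
      induces (X := HHcx C) (Y := HOcx C n) (@TrHH k C n) T'
    & induces (X := HRcx C n) (Y := HOcx C n) (@ddR k C n) d] /\
  [/\ lie_mod_hom (m + 2) 1 bHC aHH B,
      TrHC_hom P bHC aHR T,
      lie_mod_hom (m + 2) (-1) aHH aHO T'
    & lie_mod_hom (m + 2) 0 aHR aHO d] /\
  forall x, d (T x) = T' (B x).

Proof.
(* The goal is an instance of a property of arbitrary complexes and operations, which makes
   rewriting inside the dependent types possible. *)
change (@diagram_prop k (m + 2) (HCcx C) (HHcx C) (HRcx C n) (HOcx C n)
  (br P) (actHH P) (@actRn k C m P n) (@actOm k C m P n)
  (@connes k C) (@Trn k C n) (@TrHH k C n) (@ddR k C n)
  (fun r s => n%:R * aug (br P r s)) 1).
rewrite br_eq actHH_eq connes_eq Trn_eq TrHH_eq ddR_eq aug_eq.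
rewrite /HCcx /HHcx /HRcx /HOcx.
rewrite natrel_eq Omega1_eq Omega1natrel_eq Rnrel_eq Omnrel_eq.
rewrite Rrel_eq dFF_eq beta_eq dR_eq dRn_eq derTn_eq.
rewrite aug_eq !homF_eq !homFF_eq.
rewrite (oneE k ('I_n * 'I_n * hletter C)%type).
exact: (@diagram k C m P n).
Qed.
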